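(* Let $h,s\in\mathcal{T}$, let $H=\mathcal{R}(h)$ be the hypothesis region and $S=\mathcal{R}(s)^c$ the selective region. Define the $p$-value $$p_{\mathrm{SI}}(H|S,y)=\frac{\bar\Phi(\psi_{-1}(H|y))}{\bar\Phi(\psi_{-1}(H|y)+\psi_0(S|y))},$$ where $\psi_{-1}(H|y)$ and $\psi_0(S|y)$ are obtained by extrapolating $\psi_{\sigma^2}(H|y)$ and $\psi_{\sigma^2}(S|y)$ to $\sigma^2=-1$ and $\sigma^2=0$, respectively, by linear regression on $\sigma^2$ for $\sigma^2>0$. Then this $p$-value is second order accurate: for any $0<\alpha<1$, the rejection region $R=\{y\mid p_{\mathrm{SI}}(H|S,y)<\alpha\}$ satisfies $$\frac{P(Y\in R\mid\mu)}{P(Y\in S\mid\mu)}\doteq\alpha,\qquad\forall\mu\in\partial H.$$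
   Context: Large sample setting. $m\ge 0$ is fixed, $n\to\infty$. All functions and regions may depend on $n$. $\doteq$ denotes equality up to an error of order $O(n^{-1})$. Points of $\mathbb{R}^{m+1}$ are written $(u,v)$, $u\in\mathbb{R}^m$, $v\in\mathbb{R}$, and are considered in a neighborhood of the origin of size $O(1)$ (local alternatives). The model is $Y\sim N_{m+1}(\mu,I_{m+1})$, with probabilities $P(\cdot\mid\mu)$. $\bar\Phi=1-\Phi$ is the upper tail probability of $N(0,1)$. A smooth function $h:\mathbb{R}^m\to\mathbb{R}$ is expanded (repeated indices are summed over $1,\dots,m$) as $h(u)=h_0+h_iu_i+h_{ij}u_iu_j+h_{ijk}u_iu_ju_k+\cdots$, with $h_0=h(0)$, $h_i=\partial h/\partial u_i|_0$, $h_{ij}=\frac12\partial^2h/\partial u_i\partial u_j|_0$, etc. The class $\mathcal{T}$ (nearly parallel surfaces) consists of smooth $h$ with $h_0=O(1)$, $h_i=O(n^{-1/2})$, $h_{ij}=O(n^{-1/2})$ and, for $k\ge3$, $k$-th derivatives of order $O(n^{-(k-1)/2})$ (so $O(n^{-1})$), so that $h(u)\doteq h_0+h_iu_i+h_{ij}u_iu_j$. Put $\mathcal{R}(h)=\{(u,v)\mid v\le -h(u),\,u\in\mathbb{R}^m\}$. For $\sigma^2>0$, the bootstrap probability of a region $D$ is $\alpha_{\sigma^2}(D|y)=P_{\sigma^2}(Y^*\in D\mid y)$ where $Y^*\mid y\sim N_{m+1}(y,\sigma^2I_{m+1})$, and $\psi_{\sigma^2}(D|y)=\sigma\bar\Phi^{-1}(\alpha_{\sigma^2}(D|y))$.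 Extrapolation by linear regression means: fit the linear model $\beta_0+\beta_1\sigma^2$ to the values of $\psi_{\sigma^2}(D|y)$ at several (at least two) distinct fixed $\sigma^2>0$, and evaluate the fitted line at the required $\sigma^2\le0$. *)

(* Defs.v *)
From HB Require Import structures.
From mathcomp Require Import all_boot all_order all_algebra ring.
From mathcomp Require Import all_classical all_reals all_analysis.

Set Implicit Arguments.
Unset Strict Implicit.
Unset Printing Implicit Defensive.

Import Order.TTheory GRing.Theory Num.Theory.
Import numFieldNormedType.Exports.

Local Open Scope classical_set_scope.
Local Open Scope ring_scope.

Section asymptotics.
Context {R : realType} {T : Type}.

(* f_n(x) = O(g_n) as n goes to infinity, uniformly in x in D_n. *)
Definition bigO_on (D : nat -> set T) (f : nat -> T -> R) (g : nat -> R) :=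
  exists C : R, \forall n \near \oo, forall x, D n x -> `|f n x| <= C * g n.

(* Equality up to an error of order 1/n, uniformly in x in D_n. *)
Definition doteq_on (D : nat -> set T) (f g : nat -> T -> R) :=
  bigO_on D (fun n x => f n x - g n x) (fun n => n%:R^-1).

End asymptotics.

Section smooth_surfaces.
Context {R : realType} {m : nat}.
Implicit Types (f : 'rV[R]_m -> R) (h : nat -> 'rV[R]_m -> R).

Definition pderiv (t : seq 'I_m) f : 'rV[R]_m -> R :=
  foldr (fun i g u => 'D_(delta_mx 0 i) g u) f t.

Definition smooth f := forall t : seq 'I_m,
  continuous (pderiv t f) /\
  forall u i, derivable (pderiv t f) u (delta_mx 0 i).

(* Nearly parallel surfaces v = - h(u). The coefficients h_0, h_i, h_ij are taken at the origin. The
   bounds on the derivatives of order k >= 3 hold uniformly on a ball of radius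
   c sqrt n: n ^ (-(k-1)/2) is the order of the k-th derivatives, on such a
   ball, of sqrt n * g (u / sqrt n) for a fixed smooth g. Bounds on balls of
   radius O(1) only would leave h arbitrary on a region to which the law
   N(y, sigma2 I), for fixed sigma2, gives a probability not tending to 0. *)
Definition nearly_parallel h :=
  [/\ forall n, smooth (h n),
      (fun n => h n 0 : R^o) =O_\oo (fun=> 1 : R^o),
      forall i, (fun n => pderiv [:: i] (h n) 0 : R^o) =O_\oo
                (fun n => (Num.sqrt n%:R)^-1 : R^o),
      forall i j, (fun n => pderiv [:: i; j] (h n) 0 / 2 : R^o) =O_\oo
                  (fun n => (Num.sqrt n%:R)^-1 : R^o)
    & exists2 c : R, 0 < c & forall t : seq 'I_m, (3 <= size t)%N ->
        bigO_on (fun n => [set u | `|u| <= c * Num.sqrt n%:R])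
                (fun n => pderiv t (h n))
                (fun n => Num.sqrt n%:R ^- (size t).-1)].

(* R(h); a point (u, v) of R^(m+1) is a pair in 'rV[R]_m * R. *)
Definition region f : set ('rV[R]_m * R) := [set y | y.2 <= - f y.1].

End smooth_surfaces.

Definition boundary (T : topologicalType) (A : set T) : set T :=
  closure A `\` A°.

Definition tuple_cons (T : Type) n (p : T * n.-tuple T) : n.+1.-tuple T :=
  [tuple of p.1 :: p.2].

Section product_probability.
Context d (T : measurableType d) (R : realType).
Local Open Scope ereal_scope.

Lemma measurable_tuple_cons n :
  measurable_fun [set: T * n.-tuple T] (@tuple_cons T n).
Proof. exact: measurable_cons. Qed.

HB.instance Definition _ n :=
  isMeasurableFun.Build _ _ _ _ (@tuple_cons T n) (@measurable_tuple_cons n).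

Fixpoint product_probability n :
    ('I_n -> probability T R) -> probability (n.-tuple T) R :=
  match n with
  | 0 => fun=> \d_ [tuple]
  | n'.+1 => fun P => distribution
      (P ord0 \x product_probability (fun i => P (lift ord0 i)))
      (@tuple_cons T n')
  end.

Lemma measurable_box n (A : 'I_n -> set T) : (forall i, measurable (A i)) ->
  measurable [set t : n.-tuple T | forall i, A i (tnth t i)].
Proof.
move=> mA; rewrite (_ : mkset _ =
    \bigcap_(i in [set: 'I_n]) ((fun t : n.-tuple T => tnth t i) @^-1` A i)).
  apply: fin_bigcap_measurable => // i _; rewrite -[X in measurable X]setTI.
  exact: measurable_tnth.
by apply/seteqP; split=> t /= At i; [move=> _|]; exact: At.
Qed.

Lemma product_probability_box n (P : 'I_n -> probability T R)
    (A : 'I_n -> set T) : (forall i, measurable (A i)) ->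
  product_probability P [set t | forall i, A i (tnth t i)] =
  \prod_(i < n) P i (A i).
Proof.
elim: n P A => [|n IHn] P A mA.
  by rewrite big_ord0 /= diracE mem_set// => -[].
rewrite big_ord_recl -IHn//.
have mB := @measurable_box n (fun i => A (lift ord0 i)) (fun i => mA _).
rewrite -product_measure1E//.
rewrite /= /distribution /pushforward; congr (product_measure1 _ _ _).
apply/seteqP; split => [[x t] /= At|[x t] /= [A0 At] i].
  split; first by have := At ord0; rewrite tnth0.
  by move=> i; have := At (lift ord0 i); rewrite tnthS.
by case: (unliftP ord0 i) => [j|] ->; rewrite ?tnthS ?tnth0.
Qed.

End product_probability.

Section bootstrap.
Context {R : realType} {m : nat}.
Implicit Types (D : set ('rV[R]_m * R)) (y mu : 'rV[R]_m * R).

(* N_(m+1)(mu, sigma2 I) of D, the coordinates being independent N(mu_i, sigma2);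
   the second parameter of normal_prob is the standard deviation. *)
Definition gaussian mu (sigma2 : R) D : R :=
  fine ((product_probability
             (fun i => normal_prob (mu.1 ord0 i) (Num.sqrt sigma2))
           \x normal_prob mu.2 (Num.sqrt sigma2))%E
        [set z | D (\row_i tnth z.1 i, z.2)%R]).

Definition Phibar (z : R) : R := fine (normal_prob 0 1 `]z, +oo[%classic).

Definition Phibar_inv : R -> R := 'pinv_(fun=> 0) [set: R] Phibar.

Definition bootstrap_prob (sigma2 : R) D y : R := gaussian y sigma2 D.

Definition psi (sigma2 : R) D y : R :=
  Num.sqrt sigma2 * Phibar_inv (bootstrap_prob sigma2 D y).

End bootstrap.

Section regression.
Context {R : realType} {K : nat}.
Implicit Types (t x : 'I_K -> R) (b : R * R).

Definition rss t x b : R := \sum_i (x i - (b.1 + b.2 * t i)) ^+ 2.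

(* Intercept and slope of the ordinary least squares line through (t_i, x_i). *)
Definition least_squares t x : R * R :=
  get [set b | forall b', rss t x b <= rss t x b'].

Definition extrapolate t x (t0 : R) : R :=
  (least_squares t x).1 + (least_squares t x).2 * t0.

Lemma least_squares_unique t x : (1 < K)%N -> injective t ->
  exists! b, forall b', rss t x b <= rss t x b'.
Proof.
move=> K1 tI.
have i0 : 'I_K by exists 0%N; exact: ltnW.
pose n : R := K%:R; have n0 : n != 0 by rewrite pnatr_eq0 -lt0n ltnW.
have sum1 (c : R) : \sum_(i < K) c = c * n by rewrite sumr_const card_ord mulr_natr.
pose tb := (\sum_i t i) / n; pose xb := (\sum_i x i) / n.
pose Stt := \sum_i (t i - tb) * t i; pose Stx := \sum_i (x i - xb) * t i.
have neq : exists i j, t i != t j.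
  exists (Ordinal (ltnW K1)), (Ordinal K1); apply/eqP => /tI.
  by move/(congr1 val).
have St0 : \sum_i (t i - tb) = 0.
  by rewrite sumrB sum1 /tb divfK// subrr.
have SttE : Stt = \sum_i (t i - tb) ^+ 2.
  rewrite (eq_bigr (fun i => (t i - tb) * t i - (t i - tb) * tb)); last first.
    by move=> i _; rewrite -mulrBr expr2.
  by rewrite sumrB -mulr_suml St0 mul0r subr0.
have Stt0 : Stt != 0.
  rewrite SttE psumr_neq0; last by move=> i _; exact: sqr_ge0.
  case: neq => i [j tij]; apply/hasP.
  have [ti|ti] := eqVneq (t i) tb; last first.
    by exists i; rewrite ?mem_index_enum// lt0r sqr_ge0 expf_neq0 ?subr_eq0.
  exists j; rewrite ?mem_index_enum// lt0r sqr_ge0 andbT.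
  by rewrite expf_neq0// subr_eq0 -ti eq_sym.
pose b2 := Stx / Stt; pose b1 := xb - b2 * tb.
pose e i := x i - (b1 + b2 * t i).
have e0 : \sum_i e i = 0.
  rewrite (eq_bigr (fun i => (x i - xb) - b2 * (t i - tb))); last first.
    by move=> i _; rewrite /e /b1; ring.
  by rewrite sumrB -mulr_sumr St0 mulr0 subr0 sumrB sum1 /xb divfK// subrr.
have et0 : \sum_i e i * t i = 0.
  rewrite (eq_bigr (fun i => (x i - xb) * t i - b2 * ((t i - tb) * t i))); last first.
    by move=> i _; rewrite /e /b1; ring.
  by rewrite sumrB -mulr_sumr -/Stx -/Stt /b2 divfK// subrr.
have rssE b : rss t x b = rss t x (b1, b2) +
    \sum_i ((b.1 - b1) + (b.2 - b2) * t i) ^+ 2.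
  pose S := \sum_i ((b.1 - b1) * e i + (b.2 - b2) * (e i * t i)).
  have s0 : S = 0 by rewrite /S big_split /= -!mulr_sumr e0 et0 !mulr0 addr0.
  apply/eqP; rewrite -subr_eq0 /rss -big_split -sumrB /=; apply/eqP.
  transitivity (- 2 * S); last by rewrite s0 mulr0.
  by rewrite mulr_sumr; apply: eq_bigr => i _; rewrite /e; ring.
have min b : rss t x (b1, b2) <= rss t x b.
  by rewrite (rssE b) lerDl; apply: sumr_ge0 => i _; exact: sqr_ge0.
exists (b1, b2); split => // b /(_ (b1, b2)).
rewrite (rssE b) gerDl => bmin.
have s0 : \sum_i ((b.1 - b1) + (b.2 - b2) * t i) ^+ 2 = 0.
  by apply/eqP; rewrite eq_le bmin sumr_ge0// => i _; exact: sqr_ge0.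
have z i : (b.1 - b1) + (b.2 - b2) * t i = 0.
  apply/eqP; rewrite -sqrf_eq0; apply/eqP.
  by apply: (psumr_eq0P _ s0) => // j _; exact: sqr_ge0.
case: neq => i [j tij].
have : (b.2 - b2) * (t i - t j) = 0.
  by have := z i; have := z j => zj zi; rewrite -(subrr 0) -{1}zi -zj; ring.
move/eqP; rewrite mulf_eq0 (subr_eq0 (t i)) (negbTE tij) orbF subr_eq0 => /eqP b2E.
have := z i; rewrite b2E subrr mul0r addr0 => /eqP; rewrite subr_eq0 => /eqP b1E.
by rewrite (surjective_pairing b) b1E b2E.
Qed.

End regression.

Section selective_pvalue.
Context {R : realType} {m : nat}.
Implicit Types (H S : set ('rV[R]_m * R)) (y : 'rV[R]_m * R).

(* psi_(t0)(D|y) extrapolated from the values of psi at the variances t_i. *)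
Definition psi_extrapolated K (t : 'I_K -> R) (t0 : R) D y : R :=
  extrapolate t (fun i => @psi R m (t i) D y) t0.

Definition p_SI KH KS (tH : 'I_KH -> R) (tS : 'I_KS -> R) H S y : R :=
  Phibar (psi_extrapolated tH (-1) H y) /
  Phibar (psi_extrapolated tH (-1) H y + psi_extrapolated tS 0 S y).

End selective_pvalue.

(* Main.v *)
(* On a ball of radius of order sqrt n, a nearly parallel surface is given up to
   O(|u|^3 / n) by a quadratic polynomial q whose increments are O(n^(-1/2)).
   Let Z be standard normal in R^m and let k = O(n^(-1/2)) be the mean of the
   quadratic part of q(Z). The bootstrap probability of R(h) at (u, v) is the
   mean of Phibar((v + h(u + s Z)) / s), s being the standard deviation. The
   fluctuation q(u + s Z) - q(u) - s^2 k is centered and of order n^(-1/2), so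
   that it contributes O(1/n) only, and psi_(s^2) = v + q(u) + s^2 k up to
   O(1/n). This is linear in s^2, hence linear regression gives
     psi_(-1)(H) = v + q_h(u) - k_h,
     psi_(-1)(H) + psi_0(S) = G(u) := q_h(u) - q_s(u) - k_h,
   where G does not depend on v. Given the first m coordinates U of Y, rejection
   is therefore, up to O(1/n), the event V > c(G(U)) - q_h(U) + k_h, where c(g)
   is defined by Phibar(c(g)) = alpha Phibar(g). At mu = (theta, - h(theta)) it
   has conditional probability Phibar(c(G(U)) - D), where
   D = q_h(U) - q_h(theta) - k_h is again centered and of order n^(-1/2). As
   G(U) also varies by O(n^(-1/2)) only, D can be dropped, and
   P(R) = E Phibar(c(G(U))) = alpha E Phibar(G(U)) up to O(1/n). In the same way
   P(S) = E Phibar(G(U)) up to O(1/n), and this is bounded away from 0.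
   The balls on which these estimates hold are large enough for their Gaussian
   complements to be negligible. *)

From HB Require Import structures.
Require Import Defs.
From mathcomp Require Import all_boot all_order all_algebra ring lra.
From mathcomp Require Import all_classical all_reals all_analysis measurable_realfun.

Set Implicit Arguments.
Unset Strict Implicit.
Unset Printing Implicit Defensive.

Import Order.TTheory GRing.Theory Num.Theory.
Import numFieldNormedType.Exports.
Local Open Scope classical_set_scope.
Local Open Scope ring_scope.

(** * The standard normal law *)

(** The expansion of psi holds only for bounded v, since inverting [Phibar] is Lipschitz on compact
    sets only, whereas the last coordinate of Y is unbounded. For v up to size r a cruder bound, psi
    = v + O(1), is therefore proved as well. It suffices there: psi_(-1)(H) + psi_0(S) stays
    bounded, so the sign of a large v decides. One length r = n^(1/8) governs all estimates: r^4 =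
    sqrt n and r^8 = n are the two orders of magnitude that occur. On |u| <= r the error (1 + |u|)^4
    / r^8 is at most 16 / r^4, small enough to be carried through the inverse of [Phibar]. Outside
    such a ball the trivial bound 1 is absorbed by a power of (1 + |u|) / r, whose Gaussian moments
    are finite. The bounds are stated for every large r, with constants that depend on the surfaces
    only through C; the index n enters only when a nearly parallel surface is turned into a nearly
    quadratic one, and in the final theorem. *)

Section normal_law.
Context {R : realType}.
Implicit Types (x y z d a t : R) (A : set R).
Local Notation N := (normal_prob (0 : R) 1).

(** Closed upper rays are stable under intersection, generate the Borel sets, and exhaust the
    line. *)
Lemma probability_real_unique (P Q : probability (measurableTypeR R) R) :
  (forall x, P `[x, +oo[%classic = Q `[x, +oo[%classic) ->
  forall A, measurable A -> P A = Q A.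
Proof.
move=> PQ A mA.
apply: (@measure_unique _ R (measurableTypeR R) (@RGenCInfty.G R)
  (fun k : nat => `[- (k%:R : R), +oo[%classic)) => //.
- exact: RGenCInfty.measurableE.
- move=> _ _ [x ->] [y ->]; exists (Num.max x y).
  apply/seteqP; split => z /=; rewrite !in_itv/= !andbT ge_max.
    by case=> -> ->.
  by case/andP.
- by move=> k; exists (- k%:R).
- apply/seteqP; split => // z _; exists (Num.bound `|z|) => //=.
  rewrite in_itv/= andbT lerNl ltW// (le_lt_trans _ (archi_boundP _))//.
  by rewrite -normrN ler_norm.
- by move=> _ [x ->]; exact: PQ.
- by move=> k; rewrite (le_lt_trans (probability_le1 _ _))// ltry.
Qed.

(** On a ray this is a substitution in the density integral. It reduces every Gaussian law of the
    development to the standard one. *)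
Lemma normal_prob_affine (m s : R) (s0 : 0 < s) A : measurable A ->
  normal_prob m s A = N ((fun x => m + s * x) @^-1` A).
Proof.
move=> mA.
have mf : measurable_fun setT (fun x : measurableTypeR R => m + s * x : measurableTypeR R).
  by apply: measurable_funD => //; apply: measurable_funM.
pose f : {mfun measurableTypeR R >-> measurableTypeR R} :=
  HB.pack (fun x => m + s * x) (isMeasurableFun.Build _ _ _ _ _ mf).
apply: (@probability_real_unique (normal_prob m s) (distribution N f) _ A mA) => x.
rewrite /distribution /pushforward /=.
have F'E : (fun x : R^o => (m + s * x) : R^o)^`()%classic = cst s.
  apply/funext => t; rewrite derive1E deriveD// derive_cst add0r.
  by rewrite deriveM// derive_cst derive_id scaler0 addr0/= /GRing.scale/= mulr1.
(* The substitution theorem wants the endpoint as a value of the affine map. *)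
have xE : x = m + s * ((x - m) / s).
  by rewrite [s * _]mulrC divfK ?gt_eqF// addrC subrK.
have sE : (fun t => m + s * t) @^-1` `[x, +oo[ = `[(x - m) / s, +oo[%classic.
  apply/seteqP; split => t /=; rewrite !in_itv/= !andbT.
    by move=> xt; rewrite ler_pdivrMr// mulrC lerBlDl.
  by rewrite ler_pdivrMr// mulrC lerBlDl.
rewrite sE /normal_prob [in LHS]xE.
rewrite (@increasing_ge0_integration_by_substitutiony _
  (fun t : R => m + s * t) (normal_pdf m s)).
- apply: eq_integral => t _; congr EFin; rewrite /= F'E/=.
  rewrite !normal_pdfE ?gt_eqF//= /normal_fun /normal_peak !fctE/=.
  rewrite mulrAC; congr (_ * _).
    rewrite -mulrnAr sqrtrM ?sqr_ge0// sqrtr_sqr gtr0_norm// invfM mulrAC.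
    by rewrite mulVf ?gt_eqF// mul1r expr1n mul1r.
  congr expR; rewrite subr0 [m + _]addrC addrK expr1n.
  by field; rewrite gt_eqF.
- by move=> a b _ _ ab; rewrite ltrD2l ltr_pM2l.
- by rewrite F'E => ? _; exact: cvg_cst.
- by rewrite F'E; exact: is_cvg_cst.
- by rewrite F'E; exact: is_cvg_cst.
- have cF : forall t : R, {for t, continuous (fun t : R => m + s * t)}.
    move=> t; apply: cvgD; first exact: cvg_cst.
    by apply: cvgM; [exact: cvg_cst|exact: cvg_id].
  split; first by move=> t _.
  exact/cvg_at_right_filter/cF.
- exact: (cvg_comp _ _ (gt0_cvgMry s0 (@cvg_id _ _)) (cvg_addrl m)).
- apply: continuous_subspaceT; apply: continuous_normal_pdf; exact: lt0r_neq0.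
- by move=> t _; exact: normal_pdf_ge0.
Qed.

Lemma normal_prob_oppr A : measurable A -> N A = N (-%R @^-1` A).
Proof.
move=> mA.
have mf : measurable_fun setT (fun x : measurableTypeR R => - x : measurableTypeR R).
  exact: measurable_funN.
pose f : {mfun measurableTypeR R >-> measurableTypeR R} :=
  HB.pack (fun x => - x) (isMeasurableFun.Build _ _ _ _ _ mf).
apply: (@probability_real_unique N (distribution N f) _ A mA) => x.
rewrite /distribution /pushforward /=.
have sE : -%R @^-1` `[x, +oo[ = `]-oo, (- x)]%classic.
  by apply/seteqP; split => t /=; rewrite !in_itv/= !andbT lerNr.
rewrite sE /normal_prob ge0_integration_by_substitutionNy.
- apply: eq_integral => t _; congr EFin.
  rewrite /= !normal_pdfE ?oner_eq0//= /normal_fun.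
  by rewrite !subr0 sqrrN.
- apply: continuous_subspaceT; apply: continuous_normal_pdf; exact: lt0r_neq0.
- by move=> t _; exact: normal_pdf_ge0.
Qed.


Local Notation phi := (normal_pdf (0 : R) 1).

Lemma phiE x : phi x = normal_peak 1 * expR (- (x ^+ 2 / 2)).
Proof.
rewrite normal_pdfE ?oner_eq0//= /normal_fun subr0 expr1n mulNr.
by rewrite -(mulr_natr 1 2) mul1r.
Qed.

Lemma phi_gt0 x : 0 < phi x.
Proof. by rewrite phiE mulr_gt0 ?expR_gt0// normal_peak_gt0// oner_neq0. Qed.

Lemma normal_peak1_le1 : normal_peak (1 : R) <= 1.
Proof.
rewrite /normal_peak expr1n mul1r invf_le1.
  rewrite -[leLHS]sqrtr1 ler_sqrt; last by rewrite -(mulr_natr pi 2) mulr_ge0// pi_ge0.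
  have := @pi_ge2 R; rewrite -(mulr_natr pi 2); lra.
by rewrite sqrtr_gt0 pmulrn_lgt0// pi_gt0.
Qed.

Lemma phi_le1 x : phi x <= 1.
Proof.
by rewrite (le_trans (normal_pdf_ub _ _ _)) ?oner_neq0// normal_peak1_le1.
Qed.

Lemma phi_antitone x y : `|x| <= `|y| -> phi y <= phi x.
Proof.
move=> xy; rewrite !phiE ler_wpM2l ?normal_peak_ge0// ler_expR lerN2.
rewrite ler_pM2r ?invr_gt0// -(real_normK (num_real x)) -(real_normK (num_real y)).
by rewrite ler_sqr ?nnegrE.
Qed.

(** The derivative is - x phi(x), and |x| <= 1 + x^2 / 2 <= exp(x^2 / 2). *)
Lemma phi_lipschitz x y : `|phi x - phi y| <= `|x - y|.
Proof.
wlog xy : x y / x <= y.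
  move=> h; have [|/ltW] := leP x y; first exact: h.
  by move=> yx; rewrite distrC [leRHS]distrC; exact: h.
pose D t : R := normal_peak 1 * (expR (- (t ^+ 2 / 2)) * (- t)).
have dphi t : is_derive t 1 (phi : R -> R) (D t).
  rewrite (_ : phi = fun x => normal_peak 1 * expR (- (x ^+ 2 / 2))); last first.
    by apply/funext => z; rewrite phiE.
  apply: is_derive_eq; rewrite /D /GRing.scale/=; by field.
rewrite distrC [leRHS]distrC.
have [|c _ ->] := @MVT_segment _ phi D _ _ xy (fun t _ => dphi t).
  by apply: continuous_subspaceT; apply: continuous_normal_pdf; rewrite oner_neq0.
rewrite normrM ler_piMl// /D normrM (ger0_norm (normal_peak_ge0 _)).
rewrite mulr_ile1 ?normal_peak_ge0 ?normal_peak1_le1//.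
rewrite normrM normrN (ger0_norm (expR_ge0 _)) expRN mulrC.
rewrite ler_pdivrMr ?expR_gt0// mul1r (le_trans _ (expR_ge1Dx _))//.
rewrite -(real_normK (num_real c)).
have : 0 <= (`|c| - 1) ^+ 2 by exact: sqr_ge0.
rewrite sqrrB1 -(mulr_natr _ 2); lra.
Qed.

Lemma normal_prob_fin A : measurable A -> N A \is a fin_num.
Proof.
move=> mA; rewrite ge0_fin_numE; last exact: measure_ge0.
apply: (@le_lt_trans _ _ 1%E _ _ _ (ltry _)).
exact: (@probability_le1 _ _ _ N).
Qed.

Lemma Phibar_subE x y : x <= y ->
  Phibar x - Phibar y = fine (N `]x, y]%classic).
Proof.
move=> xy; rewrite /Phibar.
have -> : `]x, +oo[%classic = `]x, y]%classic `|` `]y, +oo[%classic.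
  by rewrite -itv_bndbnd_setU// bnd_simp.
rewrite measureU//.
  by rewrite fineD ?normal_prob_fin// addrK.
apply/seteqP; split => // t /= []; rewrite !in_itv/= andbT => /andP[_ ty].
by rewrite ltNge ty.
Qed.

Lemma Phibar_sub_bounds (x y lo hi : R) : x <= y -> 0 <= lo ->
  (forall t, x <= t <= y -> lo <= phi t <= hi) ->
  lo * (y - x) <= Phibar x - Phibar y <= hi * (y - x).
Proof.
move=> xy lo0 b; rewrite Phibar_subE// -!lee_fin fineK ?normal_prob_fin//.
have mI : lebesgue_measure (`]x, y]%classic : set R) = (y - x)%:E.
  rewrite lebesgue_measure_itv/= lte_fin -EFinD; case: ltgtP xy => // ->.
  by rewrite subrr.
have mphi : measurable_fun `]x, y]%classic (fun t => (phi t)%:E).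
  by apply/measurable_funTS/measurable_EFinP; exact: measurable_normal_pdf.
have b' t : `]x, y]%classic t -> lo <= phi t <= hi.
  by rewrite /= in_itv/= => /andP[xt ty]; apply: b; rewrite ty ltW.
apply/andP; split.
  rewrite EFinM -mI -integral_cst//; apply: ge0_le_integral => //.
  by move=> t /b' /andP[]; rewrite lee_fin.
rewrite EFinM -mI -integral_cst//; apply: ge0_le_integral => //.
- by move=> t _; rewrite lee_fin normal_pdf_ge0.
- by move=> t /b' /andP[_]; rewrite lee_fin.
Qed.

(** On [-M, M] the density is at least phi(M). This lower bound on the slope is what makes
    [Phibar_inv] Lipschitz on compact sets. *)
Lemma Phibar_sub_ge (M x y : R) : x <= y -> `|x| <= M -> `|y| <= M ->
  phi M * (y - x) <= Phibar x - Phibar y.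
Proof.
move=> xy xM yM.
suff /(@Phibar_sub_bounds x y (phi M) 1 xy (ltW (phi_gt0 M)))/andP[] : forall t, x <= t <= y -> phi M <= phi t <= 1 by [].
  move=> t xty.
  rewrite phi_le1 andbT phi_antitone//.
  have M0 : 0 <= M by exact: le_trans xM.
  by rewrite (ger0_norm M0) ler_norml; move: xM yM xty; rewrite !ler_norml; lra.
Qed.

Lemma Phibar_lipschitz x y : `|Phibar x - Phibar y| <= `|x - y|.
Proof.
wlog xy : x y / x <= y.
  move=> h; have [|/ltW] := leP x y; first exact: h.
  by move=> yx; rewrite distrC [leRHS]distrC; exact: h.
have /andP[] := @Phibar_sub_bounds x y 0 1 xy (lexx 0)
   (fun t _ => introT andP (conj (normal_pdf_ge0 _ _ _) (phi_le1 _))).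
rewrite mul0r mul1r => p0 p1.
by rewrite ger0_norm// distrC ger0_norm// subr_ge0.
Qed.

(** The density is 1-Lipschitz, so it varies by at most |d| along the interval. *)
Lemma Phibar_taylor x d : `|Phibar (x + d) - Phibar x + phi x * d| <= d ^+ 2.
Proof.
(* The point of expansion [c] may be either endpoint, which serves both signs of [d]. *)
have aux a b : a <= b -> forall c, a <= c <= b ->
    `|Phibar a - Phibar b - phi c * (b - a)| <= (b - a) ^+ 2.
  move=> ab c cab.
  (* Truncated at 0 because [Phibar_sub_bounds] takes a nonnegative lower bound. *)
  have lo0 : 0 <= Num.max 0 (phi c - (b - a)) by rewrite le_max lexx.
  have /(@Phibar_sub_bounds a b _ _ ab lo0) : forall t, a <= t <= b ->
      Num.max 0 (phi c - (b - a)) <= phi t <= phi c + (b - a).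
    move=> t tab; have := phi_lipschitz t c; rewrite ler_norml => /andP[l1 l2].
    have : `|t - c| <= b - a by rewrite ler_norml; lra.
    rewrite ge_max normal_pdf_ge0/=; lra.
  move/andP => [h1 h2]; rewrite ler_norml expr2; apply/andP; split.
    rewrite -subr_ge0; move: h1; rewrite -subr_ge0.
    have : (phi c - (b - a)) * (b - a) <= Num.max 0 (phi c - (b - a)) * (b - a).
      by rewrite ler_wpM2r ?subr_ge0// le_max lexx orbT.
    lra.
  rewrite -subr_ge0; move: h2; rewrite -subr_ge0; lra.
have [d0|/ltW d0] := leP 0 d.
  have := @aux x (x + d) _ x; rewrite lerDl d0 lexx => /(_ isT isT).
  by rewrite -normrN [x + d - x]addrAC subrr add0r; congr (`|_| <= _); ring.
have := @aux (x + d) x _ x; rewrite gerDl d0 lexx => /(_ isT isT).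
have -> : x - (x + d) = - d by ring.
by rewrite sqrrN; congr (`|_| <= _); ring.
Qed.

Lemma Phibar_decr x y : x < y -> Phibar y < Phibar x.
Proof.
move=> xy; rewrite -subr_gt0.
apply: (lt_le_trans _ (@Phibar_sub_ge (Num.max `|x| `|y|) _ _ (ltW xy) _ _)).
- by rewrite mulr_gt0 ?phi_gt0 ?subr_gt0.
- by rewrite le_max lexx.
- by rewrite le_max lexx orbT.
Qed.

Lemma Phibar_antitone x y : x <= y -> Phibar y <= Phibar x.
Proof. by rewrite le_eqVlt => /predU1P[->//|/Phibar_decr/ltW]. Qed.

Lemma ltr_Phibar x y : (Phibar x < Phibar y) = (y < x).
Proof.
by apply/idP/idP => [|/Phibar_decr//]; apply: contraTT; rewrite -!leNgt => /Phibar_antitone.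
Qed.

Lemma Phibar_ge0 x : 0 <= Phibar x.
Proof. by rewrite /Phibar fine_ge0. Qed.

Lemma Phibar_gt0 x : 0 < Phibar x.
Proof. by rewrite (le_lt_trans (Phibar_ge0 (x + 1)))// Phibar_decr// ltrDl. Qed.

Lemma Phibar_le1 x : Phibar x <= 1.
Proof. by rewrite -lee_fin /Phibar fineK ?normal_prob_fin ?probability_le1. Qed.

Lemma Phibar_lt1 x : Phibar x < 1.
Proof.
by apply: (lt_le_trans _ (Phibar_le1 (x - 1))); rewrite Phibar_decr// gtrBl.
Qed.

Lemma Phibar_itvNyc x : N `]-oo, x]%classic = (1 - Phibar x)%:E.
Proof.
by rewrite -setCitvr probability_setC// EFinB /Phibar fineK// normal_prob_fin.
Qed.

Lemma PhibarN x : Phibar (- x) = 1 - Phibar x.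
Proof.
rewrite {1}/Phibar normal_prob_oppr//.
have -> : -%R @^-1` `]- x, +oo[ = `]-oo, x[%classic.
  by apply/seteqP; split => t /=; rewrite !in_itv/= ?andbT ltrN2.
have -> : N `]-oo, x[%classic = N `]-oo, x]%classic.
  rewrite /normal_prob integral_itv_bndo_bndc//.
  by apply/measurable_funTS/measurable_EFinP; exact: measurable_normal_pdf.
by rewrite Phibar_itvNyc.
Qed.

(** Half of the exponent x^2 / 2 yields the factor exp(- t^2 / 4); the other half is the exponent of
    the density of N(0, 2), of total mass 1. The ratio sqrt 2 of the two peaks is bounded by 2. *)
Lemma normal_tail t : 0 <= t ->
  (N [set x | (t <= `|x|)%R] <= (2 * expR (- (t ^+ 2 / 4)))%:E)%E.
Proof.
move=> t0; pose s := Num.sqrt 2 : R.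
have s0 : 0 < s by rewrite sqrtr_gt0.
have mA : measurable [set x : R | t <= `|x|].
  rewrite (_ : mkset _ = (fun x : R => `|x|) @^-1` `[t, +oo[%classic); last first.
    by apply/seteqP; split => x /=; rewrite in_itv/= andbT.
  by rewrite -[X in measurable X]setTI; exact: normr_measurable.
pose c := 2 * expR (- (t ^+ 2 / 4)).
have c0 : 0 <= c by rewrite mulr_ge0// expR_ge0.
have phile x : t <= `|x| -> phi x <= c * normal_pdf 0 s x.
  move=> tx; rewrite phiE normal_pdfE ?gt_eqF//= /normal_fun subr0.
  have -> : normal_peak 1 = s * normal_peak s :> R.
    rewrite /normal_peak expr1n mul1r -mulrnAr sqrtrM ?sqr_ge0//.
    by rewrite sqrtr_sqr gtr0_norm// invfM mulrA divff ?gt_eqF// mul1r.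
  rewrite sqr_sqrtr// -(mulr_natr 2 2) -natrM mulNr.
  have -> : - (x ^+ 2 / 2) = - (x ^+ 2 / 4) + - (x ^+ 2 / 4) :> R by lra.
  rewrite expRD.
  have e4 : expR (- (x ^+ 2 / 4)) <= expR (- (t ^+ 2 / 4)).
    rewrite ler_expR lerN2 ler_pM2r ?invr_gt0// -(real_normK (num_real x)).
    by rewrite ler_sqr ?nnegrE.
  have s2 : s <= 2.
    rewrite -[leRHS](ger0_norm (ler0n _ 2)) -sqrtr_sqr ler_sqrt// ?exprn_gt0//.
    by rewrite expr2 ler_peMr// ler1n.
  have pk := normal_peak_ge0 s.
  have e0 := expR_ge0 (- (x ^+ 2 / 4)).
  set E := expR (- (x ^+ 2 / 4)) in e4 e0 *; set F := expR _ in e4 *.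
  have -> : s * normal_peak s * (E * E) = normal_peak s * E * (s * E) by ring.
  have -> : 2 * F * (normal_peak s * E) = normal_peak s * E * (2 * F) by ring.
  by rewrite ler_wpM2l ?mulr_ge0// ler_pM// ltW.
have mpdf s' : measurable_fun setT (fun x : R => (normal_pdf 0 s' x)%:E).
  by apply/measurable_EFinP; exact: measurable_normal_pdf.
apply: (@le_trans _ _ (c%:E * normal_prob 0 s [set x | (t <= `|x|)%R])%E).
  rewrite /normal_prob -ge0_integralZl//; last 2 first.
  - by apply/measurable_funTS; exact: mpdf.
  - by move=> x _; rewrite lee_fin normal_pdf_ge0.
  apply: ge0_le_integral => //.
  - by move=> x _; rewrite lee_fin normal_pdf_ge0.
  - by apply/measurable_funTS; exact: mpdf.
  - by apply: measurable_funeM; apply/measurable_funTS; exact: mpdf.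
by rewrite -[leRHS]mule1 lee_wpmul2l ?lee_fin// probability_le1.
Qed.

Lemma Phibar_tail t : 0 <= t -> Phibar t <= 2 * expR (- (t ^+ 2 / 4)).
Proof.
move=> t0; rewrite -lee_fin; apply: (le_trans _ (normal_tail t0)).
rewrite /Phibar fineK ?normal_prob_fin//; apply: le_measure.
- by rewrite inE.
- rewrite inE (_ : mkset _ = (fun x : R => `|x|) @^-1` `[t, +oo[%classic); last first.
    by apply/seteqP; split => x /=; rewrite in_itv/= andbT.
  by rewrite -[X in measurable X]setTI; exact: normr_measurable.
- move=> x /=; rewrite in_itv/= andbT => /ltW tx.
  exact: le_trans (ler_norm x).
Qed.

Lemma continuous_Phibar : continuous (Phibar : R -> R).
Proof.
move=> x; apply/cvgrPdist_le => e e0; near=> t.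
apply: (le_trans (Phibar_lipschitz _ _)).
by near: t; exact: (@cvgr_dist_le _ R^o R^o _ _ id x (@cvg_id _ _) _ e0).
Unshelve. all: by end_near. Qed.

Lemma measurable_Phibar : measurable_fun setT (Phibar : R -> R).
Proof.
apply: nonincreasing_measurable => // x y; exact: Phibar_antitone.
Qed.

Lemma Phibar_surj a : 0 < a < 1 -> exists x, Phibar x = a.
Proof.
move=> /andP[a0 a1].
have small (e : R) : 0 < e -> exists2 t, 0 <= t & Phibar t <= e.
  (* For this t one has e t >= 2, while t <= 1 + t^2 / 4 <= exp(t^2 / 4); hence the tail bound is at
     most e. *)
  move=> e0; exists (2 + 2 / e); first by rewrite addr_ge0// divr_ge0// ltW.
  set t := 2 + _; have t2 : 2 <= t by rewrite lerDl divr_ge0// ltW.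
  have t0 : 0 <= t by lra.
  apply: (le_trans (Phibar_tail t0)).
  rewrite expRN ler_pdivrMr ?expR_gt0//.
  apply: (@le_trans _ _ (e * t)).
    by rewrite mulrDr [e * (_ / _)]mulrC divfK ?gt_eqF// lerDr mulr_ge0// ltW.
  rewrite ler_pM2l// (le_trans _ (expR_ge1Dx _))// expr2.
  have : 0 <= (t - 2) ^+ 2 by exact: sqr_ge0.
  rewrite expr2; lra.
have [t1 t10 pt1] := small _ a0.
have [t2 t20 pt2] : exists2 t, 0 <= t & Phibar t <= 1 - a.
  by apply: small; rewrite subr_gt0.
have le12 : - t2 <= t1 by lra.
have p2 : a <= Phibar (- t2) by rewrite PhibarN; lra.
have [||c _ <-] := @IVT _ (Phibar : R -> R) _ _ a le12.
- by apply: continuous_subspaceT => ?; exact: continuous_Phibar.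
- by rewrite ge_min le_max pt1 p2 orbT.
- by exists c.
Qed.

Lemma PhibarK : cancel (Phibar : R -> R) Phibar_inv.
Proof.
move=> x; apply: pinvKV; last by rewrite inE.
move=> y z _ _ yz; apply/eqP; rewrite eq_le !leNgt.
by rewrite -(ltr_Phibar y z) -(ltr_Phibar z y) yz ltxx.
Qed.

Lemma Phibar_invK (a : R) : 0 < a < 1 -> Phibar (Phibar_inv a) = a.
Proof. by move=> /Phibar_surj[x <-]; rewrite PhibarK. Qed.

(** The enclosure itself places [a] in (0, 1), where [Phibar_inv] is a genuine inverse. *)
Lemma Phibar_inv_between (a b c : R) : Phibar b <= a <= Phibar c -> c <= Phibar_inv a <= b.
Proof.
move=> /andP[ba ac]; have a01 : 0 < a < 1.
  by rewrite (lt_le_trans (Phibar_gt0 _) ba) (le_lt_trans ac (Phibar_lt1 _)).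
by rewrite !leNgt -(ltr_Phibar c) -(ltr_Phibar _ b) Phibar_invK// -!leNgt ba ac.
Qed.

(** The bound on [eta] keeps the step [eta / phi (M + 1)] at most 1, so both shifted points stay in
    [-(M + 1), M + 1], where the slope of [Phibar] is at least phi(M + 1) in absolute value. *)
Lemma Phibar_inv_near (M x a eta : R) : `|x| <= M -> eta <= phi (M + 1) ->
  `|a - Phibar x| <= eta -> `|Phibar_inv a - x| <= eta / phi (M + 1).
Proof.
move=> xM etaM ax; have eta0 : 0 <= eta by exact: le_trans ax.
have p0 := phi_gt0 (M + 1).
set d := eta / phi (M + 1); have dE : phi (M + 1) * d = eta.
  by rewrite mulrC divfK// gt_eqF.
have d0 : 0 <= d by rewrite divr_ge0// ltW.
have d1 : d <= 1 by rewrite ler_pdivrMr ?mul1r.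
have := @Phibar_sub_ge (M + 1) (x - d) x; have := @Phibar_sub_ge (M + 1) x (x + d).
have -> : x - (x - d) = d by ring.
have -> : x + d - x = d by ring.
rewrite dE !ler_norml; move: xM ax; rewrite !ler_norml => xM ax h1 h2.
have h3 : x <= x + d by lra.
have h4 : x - d <= x by lra.
have {}h1 : eta <= Phibar x - Phibar (x + d) by apply: h1 => //; lra.
have {}h2 : eta <= Phibar (x - d) - Phibar x by apply: h2 => //; lra.
have /Phibar_inv_between : Phibar (x + d) <= a <= Phibar (x - d) by lra.
lra.
Qed.

(** On (0, 1) [Phibar_inv] reverses the order, so a lower ray pulls back to an upper ray. *)
Lemma measurable_Phibar_inv (disp : measure_display) (T : measurableType disp) (f : T -> R) :
  (forall y : T, 0 < f y < 1) -> measurable_fun setT f ->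
  measurable_fun setT (Phibar_inv \o f).
Proof.
move=> f01 mf; apply: (measurability _ (@RGenInftyO.measurableE R)) => //.
move=> _ [_ [c ->] <-]; rewrite setTI.
rewrite (_ : _ @^-1` _ = setT `&` f @^-1` `]Phibar c, +oo[%classic); first exact: mf.
apply/seteqP; split => y /=; rewrite !in_itv/= andbT.
  by rewrite -ltr_Phibar Phibar_invK.
by case=> _; rewrite -{1}(Phibar_invK (f01 y)) ltr_Phibar.
Qed.

End normal_law.

(** * Row vectors and tuples of reals *)

Section vectors.
Context {R : realType}.

Lemma rV_norm_coord n (x : 'rV[R]_n) i : `|x 0 i| <= `|x|.
Proof.
rewrite -[leRHS]/(mx_norm x) mx_normrE.
exact: (le_bigmax _ (fun ij : 'I_1 * 'I_n => `|x ij.1 ij.2|) (0, i)).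
Qed.

Lemma rV_norm_le n (x : 'rV[R]_n) b : 0 <= b ->
  (forall i, `|x 0 i| <= b) -> `|x| <= b.
Proof.
move=> b0 xb; rewrite -[leLHS]/(mx_norm x) mx_normrE bigmax_le// => -[i j] _ /=.
by rewrite ord1.
Qed.

(** Tuples carry the product sigma-algebra and the probabilities, row vectors the topology and the
    linear structure. *)
Definition vec n (z : n.-tuple R) : 'rV[R]_n := \row_i tnth z i.

Lemma vec_axpy n (u z : n.-tuple R) (s : R) :
  vec [tuple tnth u i + s * tnth z i | i < n] = vec u + s *: vec z.
Proof. by apply/rowP => i; rewrite !mxE tnth_mktuple. Qed.

Lemma vecK n (u : 'rV[R]_n) : vec [tuple u 0 i | i < n] = u.
Proof. by apply/rowP => i; rewrite !mxE tnth_mktuple. Qed.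

(** The function is the pointwise limit of its values at the corners of a grid of mesh 1 / (k + 1).
    Each approximation is constant on countably many cells, and the cells are measurable boxes. *)
Lemma measurable_continuous_vec n (f : 'rV[R]_n -> R) :
  continuous f ->
  measurable_fun setT (f \o @vec n : n.-tuple (measurableTypeR R) -> R).
Proof.
move=> cf.
pose grid (k : nat) (q : 'rV[int]_n) : 'rV[R]_n := \row_i ((q 0 i)%:~R / k.+1%:R).
pose fl (k : nat) (z : n.-tuple (measurableTypeR R)) : 'rV[int]_n :=
  \row_i Num.floor (k.+1%:R * tnth z i).
apply: (@measurable_fun_cvg _ _ _ _ (fun k z => f (grid k (fl k z)))) => [k|z _].
  move=> _ Y mY; rewrite setTI.
  pose box (q : 'rV[int]_n) := [set z : n.-tuple (measurableTypeR R) |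
    forall i, `[(q 0 i)%:~R / k.+1%:R, ((q 0 i)%:~R + 1) / k.+1%:R[%classic (tnth z i)].
  have boxE q z : box q z <-> fl k z = q.
    have itvE (a : int) (x : R) : `[a%:~R / k.+1%:R, (a%:~R + 1) / k.+1%:R[%classic x
        <-> Num.floor (k.+1%:R * x) = a.
      rewrite /= in_itv/= ler_pdivrMr// ltr_pdivlMr// ![x * _]mulrC.
      by rewrite -intrD1; split => [/floor_def//|<-]; exact: floor_itv.
    split => [zq|<- i].
      by apply/rowP => i; rewrite mxE; apply/itvE/zq.
    by apply/itvE; rewrite mxE.
  rewrite (_ : _ @^-1` _ = \bigcup_q (if f (grid k q) \in Y then box q else set0)).
    apply: countable_bigcupT_measurable; first exact: countableP.
    move=> q; case: ifP => // _.
    exact: (@measurable_box _ (measurableTypeR R) n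
      (fun i => `[(q 0 i)%:~R / k.+1%:R, ((q 0 i)%:~R + 1) / k.+1%:R[%classic)).
  apply/seteqP; split => z /=.
    move=> Yz; exists (fl k z) => //; rewrite mem_set//.
    by apply/boxE.
  by case=> q _; case: ifPn => // /set_mem Yq /boxE ->.
suff gz : grid k (fl k z) @[k --> \oo] --> vec z.
  exact: (cvg_comp _ _ gz (cf (vec z))).
apply/cvgrPdist_le => e e0.
have := @cvg_harmonic R => /cvgrPdist_le /(_ e e0); apply: filterS => k.
rewrite sub0r normrN /harmonic ger0_norm ?invr_ge0// => ke.
apply: le_trans ke; apply: rV_norm_le => [|i]; first by rewrite invr_ge0.
rewrite !mxE; have k0 : 0 < k.+1%:R :> R by [].
set a := tnth z i; set b := (Num.floor _)%:~R.
have -> : a - b / k.+1%:R = (k.+1%:R * a - b) / k.+1%:R.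
  by rewrite mulrBl mulrAC divff ?mul1r// gt_eqF.
have /andP[f1 f2] := floor_itv (k.+1%:R * a).
rewrite normrM [X in _ * X]ger0_norm ?invr_ge0// ler_piMl ?invr_ge0//.
by rewrite ger0_norm ?subr_ge0// lerBlDr addrC ltW// -intrD1.
Qed.

End vectors.

(** * Product probabilities under coordinatewise maps *)

Section pushforward_of_products.
Context {R : realType}.

Lemma product_pushforward d1 d2 d3 d4 (T1 : measurableType d1)
    (T2 : measurableType d2) (S1 : measurableType d3) (S2 : measurableType d4)
    (P1 : probability T1 R) (P2 : probability T2 R)
    (Q1 : probability S1 R) (Q2 : probability S2 R) (f1 : T1 -> S1) (f2 : T2 -> S2) :
  measurable_fun setT f1 -> measurable_fun setT f2 ->
  (forall A, measurable A -> Q1 A = P1 (f1 @^-1` A)) ->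
  (forall A, measurable A -> Q2 A = P2 (f2 @^-1` A)) ->
  forall A, measurable A ->
  (Q1 \x Q2)%E A = (P1 \x P2)%E ((fun z => (f1 z.1, f2 z.2)) @^-1` A).
Proof.
move=> mf1 mf2 Q1E Q2E A mA.
have mF : measurable_fun setT (fun z : T1 * T2 => (f1 z.1, f2 z.2)).
  apply: measurable_fun_pair; first exact: (measurableT_comp mf1 measurable_fst).
  exact: (measurableT_comp mf2 measurable_snd).
pose F : {mfun (T1 * T2)%type >-> (S1 * S2)%type} :=
  HB.pack (fun z : T1 * T2 => (f1 z.1, f2 z.2)) (isMeasurableFun.Build _ _ _ _ _ mF).
apply: (@product_measure_unique _ _ _ _ _ Q1 Q2 (distribution (P1 \x P2)%E F)) => //.
move=> B C mB mC.
transitivity (P1 (f1 @^-1` B) * P2 (f2 @^-1` C))%E; last first.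
  by congr (_ * _)%E; [exact/esym/Q1E|exact/esym/Q2E].
rewrite -product_measure1E//.
- by rewrite -[X in measurable X]setTI; exact: mf1.
- by rewrite -[X in measurable X]setTI; exact: mf2.
Qed.

Lemma measurable_tuple_map d (T : measurableType d) n (f : 'I_n -> T -> T) :
  (forall i, measurable_fun setT (f i)) ->
  measurable_fun setT (fun t : n.-tuple T => [tuple f i (tnth t i) | i < n]).
Proof.
move=> mf; apply/measurable_fun_tnthP => i.
rewrite (_ : _ \o _ = f i \o (@tnth _ _ ^~ i)); last first.
  by apply/funext => t /=; rewrite tnth_mktuple.
by apply: measurableT_comp => //; exact: measurable_tnth.
Qed.

Lemma product_probability_pushforward d (T : measurableType d) n
    (P Q : 'I_n -> probability T R) (f : 'I_n -> T -> T) :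
  (forall i, measurable_fun setT (f i)) ->
  (forall i A, measurable A -> Q i A = P i (f i @^-1` A)) ->
  forall A, measurable A -> product_probability Q A =
    product_probability P ((fun t => [tuple f i (tnth t i) | i < n]) @^-1` A).
Proof.
elim: n P Q f => [|n IHn] P Q f mf QE A mA.
  rewrite (_ : _ @^-1` A = A)//; apply/funext => t.
  by rewrite /preimage/= [in LHS]tuple0 [in RHS]tuple0.
rewrite /= /distribution /pushforward/=.
rewrite (product_pushforward (mf ord0) (measurable_tuple_map (fun i => mf (lift ord0 i)))
  (QE ord0) (IHn _ _ _ (fun i => mf (lift ord0 i)) (fun i => QE (lift ord0 i)))).
  congr (_ _); apply/seteqP; split => -[x t] /=;
    congr A; apply: eq_from_tnth => i; rewrite ?tnth_mktuple;
    by case: (unliftP ord0 i) => [j|] ->; rewrite !(tnthS, tnth0, tnth_mktuple).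
by rewrite -[X in measurable X]setTI; exact: measurable_tuple_cons.
Qed.

End pushforward_of_products.

(** * The standard normal law on tuples *)

Section standard_normal_tuple.
Context {R : realType}.
Local Notation N := (normal_prob (0 : R) 1).

Definition normal_tuple n : probability (n.-tuple (measurableTypeR R)) R :=
  product_probability (fun _ : 'I_n => N).
Local Notation PZ := normal_tuple.

(** With mean and variance moved into the event, all later expectations are taken under one fixed
    law. *)
Lemma gaussianE m (mu : 'rV[R]_m * R) (s2 : R) (D : set ('rV[R]_m * R)) : 0 < s2 ->
  measurable [set z : m.-tuple (measurableTypeR R) * measurableTypeR R | D (vec z.1, z.2)] ->
  gaussian mu s2 D = fine ((PZ m \x N)%E
    [set z | D (mu.1 + Num.sqrt s2 *: vec z.1, mu.2 + Num.sqrt s2 * z.2)]).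
Proof.
move=> s0 mD; have r0 : 0 < Num.sqrt s2 by rewrite sqrtr_gt0.
have maff (a : R) : measurable_fun setT
    (fun x : measurableTypeR R => a + Num.sqrt s2 * x : measurableTypeR R).
  by apply: measurable_funD => //; apply: measurable_funM.
rewrite /gaussian; apply: (congr1 fine).
rewrite (product_pushforward (measurable_tuple_map (fun i => maff (mu.1 ord0 i)))
  (maff mu.2)
  (product_probability_pushforward (fun i => maff (mu.1 ord0 i))
     (fun i A mA => @normal_prob_affine _ (mu.1 ord0 i) _ r0 A mA))
  (fun A mA => @normal_prob_affine _ mu.2 _ r0 A mA) mD).
congr (_ _); apply/seteqP; split => -[t x] /=; congr (D (_, _)); apply/rowP => i;
  by rewrite !mxE tnth_mktuple.
Qed.

Definition neg_tuple n (z : n.-tuple R) : n.-tuple R := [tuple - tnth z i | i < n].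

Lemma vec_neg n (z : n.-tuple R) : vec (neg_tuple z) = - vec z.
Proof. by apply/rowP => i; rewrite !mxE tnth_mktuple. Qed.

Lemma measurable_neg_tuple n :
  measurable_fun setT (@neg_tuple n : n.-tuple (measurableTypeR R) -> n.-tuple (measurableTypeR R)).
Proof.
apply: (@measurable_tuple_map _ (measurableTypeR R) n (fun _ x => - x)) => i.
exact: measurable_funN.
Qed.

(** This symmetry is what removes the odd terms of a quadratic polynomial from its mean. *)
Lemma normal_tuple_sym n (f : n.-tuple (measurableTypeR R) -> R) :
  measurable_fun setT f ->
  (PZ n).-integrable setT (EFin \o (fun z => f (neg_tuple z))) ->
  (\int[PZ n]_z f z = \int[PZ n]_z f (neg_tuple z))%R.
Proof.
move=> mf intf; rewrite /Rintegral; congr fine.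
have PN A : measurable A -> PZ n A = pushforward (PZ n) (@neg_tuple n) A.
  apply: (@product_probability_pushforward R _ (measurableTypeR R) n
    (fun=> N) (fun=> N) (fun _ x => - x)) => i.
    exact: measurable_funN.
  by move=> B; exact: normal_prob_oppr.
pose F : {mfun n.-tuple (measurableTypeR R) >-> n.-tuple (measurableTypeR R)} :=
  HB.pack (@neg_tuple n) (isMeasurableFun.Build _ _ _ _ _ (@measurable_neg_tuple n)).
rewrite (eq_measure_integral (distribution (PZ n) F)); last by move=> A mA _; exact: PN.
by rewrite integral_pushforward//; exact/measurable_EFinP.
Qed.

Lemma normal_tuple_coord n (i : 'I_n) A : measurable A ->
  PZ n [set z | A (tnth z i)] = N A.
Proof.
move=> mA.
have := @product_probability_box _ _ R n (fun=> N) (fun j => if j == i then A else setT).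
rewrite (bigD1 i)//= eqxx big1 ?mule1; last by move=> j /negPf ->; rewrite probability_setT.
move=> <-; last by move=> j; case: ifP.
congr (_ _); apply/seteqP; split => z /=; last by move/(_ i); rewrite eqxx.
by move=> Az j; case: eqP => // ->.
Qed.

Lemma measurable_norm_vec n : measurable_fun setT (fun z : n.-tuple (measurableTypeR R) => `|vec z|).
Proof. apply: (measurable_continuous_vec (f := fun u : 'rV[R]_n => `|u|)); exact: norm_continuous. Qed.

Lemma measurable_norm_ge n t :
  measurable [set z : n.-tuple (measurableTypeR R) | t <= `|vec z|].
Proof.
rewrite (_ : mkset _ = (fun z : n.-tuple (measurableTypeR R) => `|vec z|) @^-1` `[t, +oo[%classic).
  by rewrite -[X in measurable X]setTI; exact: measurable_norm_vec.
by apply/seteqP; split => x /=; rewrite in_itv/= andbT.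
Qed.

(** The norm is the maximum norm, so this is a union bound over the coordinates. Strict positivity
    of [t] settles n = 0, where the norm is 0. *)
Lemma normal_tuple_tail n t : 0 < t ->
  (PZ n [set z | (t <= `|vec z|)%R] <= (n%:R * (2 * expR (- (t ^+ 2 / 4))))%:E)%E.
Proof.
move=> t0; set b := 2 * _.
pose A k := [set z : n.-tuple (measurableTypeR R) | t <= `|nth 0 z k|].
have mabs : measurable [set x : measurableTypeR R | t <= `|x|].
  rewrite (_ : mkset _ = (fun x : R => `|x|) @^-1` `[t, +oo[%classic); last first.
    by apply/seteqP; split => x /=; rewrite in_itv/= andbT.
  by rewrite -[X in measurable X]setTI; exact: normr_measurable.
have AE (i : 'I_n) : A i = (fun z => tnth z i) @^-1` [set x : R | t <= `|x|].
  by apply/seteqP; split => z /=; rewrite (tnth_nth 0).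
have mA k : (k < n)%N -> measurable (A k).
  move=> kn; rewrite -[k]/(val (Ordinal kn)) AE -[X in measurable X]setTI.
  exact: measurable_tnth.
apply: (@le_trans _ _ (PZ n (\big[setU/set0]_(i < n) A i))).
  apply: le_measure.
  - by rewrite inE; exact: measurable_norm_ge.
  - by rewrite inE; apply: bigsetU_measurable => i _; exact: mA.
  - move=> z /= tz; rewrite -bigcup_mkord; apply: contrapT => nA.
    have : `|vec z| < t; last by rewrite ltNge tz.
    rewrite -[ltLHS]/(mx_norm (vec z)) mx_normrE; apply: bigmax_lt => // -[i j] _ /=.
    rewrite mxE ltNge; apply/negP => tj; apply: nA; exists j => //=.
    by rewrite -/(A j) AE.
apply: (le_trans (Boole_inequality _ mA)).
apply: (@le_trans _ _ (\sum_(i < n) b%:E)%E).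
  apply: lee_sum => i _; have AN : PZ n (A i) = N [set x | (t <= `|x|)%R].
    by rewrite AE; exact: (normal_tuple_coord i mabs).
  exact: (eq_ind_r (fun x => (x <= b%:E)%E) (normal_tail (ltW t0)) AN).
by rewrite sumEFin sumr_const card_ord mulr_natl.
Qed.

(** Take the power k + 1 of exp(x / (k + 1)) >= 1 + x / (k + 1). *)
Lemma expR_ge_expn (k : nat) (x : R) : 0 <= x -> (1 + x) ^+ k.+1 <= k.+1%:R ^+ k.+1 * expR x.
Proof.
move=> x0; have k0 : 0 < k.+1%:R :> R by [].
have -> : expR x = expR (x / k.+1%:R) ^+ k.+1.
  by rewrite -expRM_natl mulrC divfK// gt_eqF.
rewrite -exprMn lerXn2r ?nnegrE ?addr_ge0 ?mulr_ge0 ?expR_ge0//.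
apply: (@le_trans _ _ (k.+1%:R * (1 + x / k.+1%:R))).
  rewrite mulrDr mulr1 [k.+1%:R * (_ / _)]mulrC divfK ?gt_eqF// lerD2r.
  by rewrite ler1n.
by rewrite ler_pM2l// expR_ge1Dx.
Qed.

Lemma measurable_moment n k :
  measurable_fun setT (fun z : n.-tuple (measurableTypeR R) => (1 + `|vec z|) ^+ k).
Proof.
by apply: measurable_funX; apply: measurable_funD => //; exact: measurable_norm_vec.
Qed.

(** The moment is dominated by a series over the events |z| >= k with weights (k + 2)^12, whose
    terms decay geometrically by the Gaussian tail bound. The exponent 12 exceeds every polynomial
    degree met below, so one moment serves throughout. *)
Lemma integrable_moment n :
  (PZ n).-integrable setT (EFin \o (fun z => (1 + `|vec z|) ^+ 12)).
Proof.
pose a (k : nat) : R := k.+2%:R ^+ 12.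
pose A (k : nat) := [set z : n.-tuple (measurableTypeR R) | k%:R <= `|vec z|].
have mA k : measurable (A k) by exact: measurable_norm_ge.
pose C0 : R := 12%:R ^+ 12 * expR 6.
(* The first summand serves k = 0. For K = k > 0, the weight is at most 12^12 exp(K + 1), the
   geometric factor at most exp(K + 1), and 2 (K + 1) - K^2 / 4 <= 6 because (K - 4)^2 >= 0. *)
pose C : R := 2 * a 0 + n%:R * 2 * C0.
have a0 k : 0 <= a k by rewrite exprn_ge0.
have C00 : 0 <= C0 by rewrite mulr_ge0 ?exprn_ge0 ?expR_ge0.
have aC k : ((a k)%:E * PZ n (A k) <= (C / (2 ^ k.+1)%:R)%:E)%E.
  have pk : 0 < (2 ^ k.+1)%:R :> R by rewrite ltr0n expn_gt0.
  case: k => [|k] in pk *.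
    apply: (@le_trans _ _ ((a 0)%:E * 1)%E).
      by rewrite lee_wpmul2l ?lee_fin// probability_le1.
    rewrite mule1 lee_fin ler_pdivlMr// /C expn1 mulrC lerDl.
    by rewrite !mulr_ge0.
  have k0 : 0 < k.+1%:R :> R by [].
  apply: (le_trans (lee_wpmul2l _ (@normal_tuple_tail n _ k0))); first by rewrite lee_fin.
  rewrite -EFinM lee_fin ler_pdivlMr//.
  set K := k.+1%:R in k0 *.
  have h1 : a k.+1 <= 12%:R ^+ 12 * expR (K + 1).
    have -> : a k.+1 = (1 + (K + 1)) ^+ 12 by rewrite /a /K -!natr1; congr (_ ^+ _); ring.
    by apply: expR_ge_expn; rewrite addr_ge0// ltW.
  have h2 : (2 ^ k.+2)%:R <= expR (K + 1).
    rewrite natrX /K natr1 -[k.+2%:R]mulr1 expRM_natl lerXn2r ?nnegrE ?expR_ge0//.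
    by apply: le_trans (expR_ge1Dx 1).
  have h3 : expR (K + 1) * expR (K + 1) * expR (- (K ^+ 2 / 4)) <= expR 6.
    rewrite -!expRD ler_expR.
    have : 0 <= (K - 4) ^+ 2 by exact: sqr_ge0.
    rewrite !expr2; lra.
  apply: (@le_trans _ _ (n%:R * 2 * C0)); last by rewrite lerDr mulr_ge0.
  have e0 := expR_ge0 (- (K ^+ 2 / 4)).
  have -> : a k.+1 * (n%:R * (2 * expR (- (K ^+ 2 / 4)))) * (2 ^ k.+2)%:R =
    n%:R * 2 * (a k.+1 * (2 ^ k.+2)%:R * expR (- (K ^+ 2 / 4))) by ring.
  rewrite ler_wpM2l ?mulr_ge0// /C0.
  apply: (@le_trans _ _ (12%:R ^+ 12 * (expR (K + 1) * expR (K + 1) * expR (- (K ^+ 2 / 4))))).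
    by rewrite !mulrA ler_wpM2r// ler_pM.
  by rewrite ler_wpM2l ?exprn_ge0.
apply/integrableP; split.
  by apply/measurable_EFinP; exact: measurable_moment.
apply: (@le_lt_trans _ _ (\int[PZ n]_z \sum_(0 <= k <oo) (a k * \1_(A k) z)%:E)%E).
  apply: ge0_le_integral => //.
  - by apply: measurableT_comp => //; apply/measurable_EFinP; exact: measurable_moment.
  - apply: ge0_emeasurable_sum => k *; first by rewrite lee_fin mulr_ge0.
    by apply/measurable_EFinP; apply: measurable_funM.
  move=> z _ /=.
  have pos (k : nat) : (0 <= (a k * \1_(A k) z)%:E)%E by rewrite lee_fin mulr_ge0.
  set v := `|vec z|.
  have /andP[kv vk] := truncn_itv (normr_ge0 (vec z)); rewrite -/v in kv vk.
  (* The single term whose index is the integer part of |z| already dominates. *)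
  apply: (le_trans _ (@nneseries_lim_ge _ _ _ 0 (Num.truncn v).+1 (fun k _ _ => pos k))).
  have v0 : 0 <= v by exact: normr_ge0.
  rewrite sumEFin lee_fin big_nat_recr//= ger0_norm ?exprn_ge0 ?addr_ge0//.
  apply: ler_wpDl; first by apply: sumr_ge0 => k _; rewrite mulr_ge0.
  have vS : 1 + v <= (Num.truncn v).+2%:R.
    have -> : (Num.truncn v).+2%:R = 1 + (Num.truncn v).+1%:R :> R by rewrite addrC natr1.
    by rewrite lerD2l ltW.
  rewrite indicE mem_set// mulr1 /a.
  by apply: lerXn2r; rewrite ?nnegrE; [exact: addr_ge0|exact: ler0n|exact: vS].
rewrite integral_nneseries//; last 2 first.
- move=> k; apply/measurable_EFinP; apply: measurable_funM => //.
- by move=> k z _; rewrite lee_fin mulr_ge0.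
apply: (@le_lt_trans _ _ C%:E); last exact: ltry.
apply: le_trans (@epsilon_trick0 _ C xpredT _).
  apply: lee_nneseries => [k _ _|k _].
    by apply: integral_ge0 => z _; rewrite lee_fin mulr_ge0.
  under eq_integral do rewrite EFinM.
  rewrite ge0_integralZl//; first by rewrite integral_indic// setIT.
    by apply/measurable_EFinP; exact: measurable_indic.
  by rewrite lee_fin.
by rewrite addr_ge0 ?mulr_ge0.
Qed.

End standard_normal_tuple.

(** * Taylor expansion *)

Section path_integration.
Context {R : realType} {m : nat}.
Implicit Types (f : 'rV[R]_m -> R) (u w : 'rV[R]_m).
Local Notation e i := (@delta_mx R 1 m 0 i).

Lemma is_derive_line f (df : R) u (i : 'I_m) (x : R) :
  is_derive (u + x *: e i) (e i) f df ->
  is_derive x 1 (fun t : R => f (u + t *: e i)) df.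
Proof.
move=> [dv dE].
have E : (fun h : R => h^-1 *: (((fun t : R => f (u + t *: e i)) \o shift x) (h *: 1)
      - f (u + x *: e i))) =
    (fun h : R => h^-1 *: ((f \o shift (u + x *: e i)) (h *: e i) - f (u + x *: e i))).
  apply/funext => h /=; congr (_ *: (f _ - _)).
  by rewrite (_ : h%:A = h) ?scalerDl 1?addrCA//; exact: mulr1.
split; first by rewrite /derivable E.
by rewrite -dE /derive E.
Qed.

(** The vertices of the path from 0 to [u] along the axes. *)
Definition prefix u (k : nat) : 'rV[R]_m := \row_i (if (i < k)%N then u 0 i else 0).

Lemma prefix0 u : prefix u 0 = 0.
Proof. by apply/rowP => i; rewrite !mxE. Qed.

Lemma prefix_full u : prefix u m = u.
Proof. by apply/rowP => i; rewrite !mxE ltn_ord. Qed.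

Lemma prefixS u (k : 'I_m) : prefix u k.+1 = prefix u k + u 0 k *: e k.
Proof.
apply/rowP => i; rewrite !mxE/= ltnS leq_eqVlt -(inj_eq val_inj)/=.
by case: (ltngtP i k) => /= [||/val_inj ->]; rewrite ?mulr0 ?mulr1 ?addr0 ?add0r.
Qed.

(** In the maximum norm the path never leaves the ball of radius |u|, so derivative bounds on that
    ball are enough. *)
Lemma prefix_line_le u (k : 'I_m) x : `|x| <= `|u| -> `|prefix u k + x *: e k| <= `|u|.
Proof.
move=> xu; apply: rV_norm_le => // i; rewrite !mxE/=.
case: eqP => [->|_]; first by rewrite ltnn add0r mulr1.
by rewrite mulr0 addr0; case: ifP => _; rewrite ?normr0// rV_norm_coord.
Qed.

(* The path runs from 0 to [u] along the coordinate axes; [p i] is a primitive of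
   an approximation of the i-th partial derivative of [f] along its i-th edge. *)
Lemma path_bound f (df : 'I_m -> 'rV[R]_m -> R) (p dp : 'I_m -> R -> R) u (B : R) :
  (forall w i, is_derive w (e i) f (df i w)) ->
  (forall i (x : R), is_derive x 1 (p i) (dp i x)) -> (forall i, p i 0 = 0) ->
  (forall (i : 'I_m) x, `|x| <= `|u| -> `|df i (prefix u i + x *: e i) - dp i x| <= B) ->
  `|f u - f 0 - \sum_i p i (u 0 i)| <= m%:R * (B * `|u|).
Proof.
move=> fd pd p0 dB.
(* Mean value theorem on the i-th edge for [f] minus the primitive; the sign of the coordinate gives
   the direction of the edge. *)
have step (i : 'I_m) : `|f (prefix u i.+1) - f (prefix u i) - p i (u 0 i)| <= B * `|u|.
  pose g (t : R) := f (prefix u i + t *: e i) - p i t.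
  pose dg (t : R) := df i (prefix u i + t *: e i) - dp i t.
  have gd (t : R) : is_derive t 1 g (dg t).
    have h1 := @is_derive_line f _ (prefix u i) i t (fd _ i).
    have h2 := pd i t.
    exact: is_deriveB.
  have cg : continuous g.
    move=> t; apply: (@differentiable_continuous _ R^o R^o).
    by apply/derivable1_diffP; case: (gd t).
  have gE : f (prefix u i.+1) - f (prefix u i) - p i (u 0 i) = g (u 0 i) - g 0.
    by rewrite /g prefixS p0 scale0r addr0; ring.
  rewrite gE; have [c cu ->] : exists2 c, `|c| <= `|u 0 i| & g (u 0 i) - g 0 = dg c * (u 0 i).
    have [u0|/ltW u0] := leP 0 (u 0 i).
      have [|c] := @MVT_segment _ g dg _ _ u0 (fun t _ => gd t).
        exact: continuous_subspaceT.
      rewrite in_itv/= subr0 => /andP[c0 cu] E; exists c => //.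
      by rewrite !ger0_norm.
    have [|c] := @MVT_segment _ g dg _ _ u0 (fun t _ => gd t).
      exact: continuous_subspaceT.
    rewrite in_itv/= sub0r => /andP[uc c0] E; exists c.
      by rewrite !ler0_norm// lerN2.
    by rewrite -[LHS]opprB E; ring.
  rewrite normrM ler_pM//; last exact: rV_norm_coord.
  by apply: dB; apply: le_trans cu (rV_norm_coord _ _).
have -> : f u - f 0 - \sum_i p i (u 0 i) =
    \sum_(i < m) (f (prefix u i.+1) - f (prefix u i) - p i (u 0 i)).
  rewrite sumrB; congr (_ - _).
  rewrite -(big_mkord xpredT (fun k => f (prefix u k.+1) - f (prefix u k))).
  by rewrite telescope_sumr// prefix_full prefix0.
apply: (le_trans (ler_norm_sum _ _ _)).
apply: (@le_trans _ _ (\sum_(i < m) B * `|u|)); first exact: ler_sum.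
by rewrite sumr_const card_ord mulr_natl.
Qed.

Lemma path_bound0 f (df : 'I_m -> 'rV[R]_m -> R) u (B : R) :
  (forall w i, is_derive w (e i) f (df i w)) ->
  (forall w i, `|w| <= `|u| -> `|df i w| <= B) ->
  `|f u - f 0| <= m%:R * (B * `|u|).
Proof.
move=> fd dB.
have := @path_bound f df (fun _ _ => 0) (fun _ _ => 0) u B fd.
rewrite big1// subr0; apply => // i x xu.
by rewrite subr0; apply: dB; exact: prefix_line_le.
Qed.

Definition quad_form (A : 'M[R]_m) u w : R := (u *m A *m w^T) 0 0.

Definition quad (c : R) (b : 'cV[R]_m) (A : 'M[R]_m) w : R :=
  c + (w *m b) 0 0 + quad_form A w w.

Definition taylor1 f : 'cV[R]_m := \col_i pderiv [:: i] f 0.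

(* Upper triangular rather than symmetric: this is the form that integration
   along the coordinate path yields. *)
Definition taylor2 f : 'M[R]_m :=
  \matrix_(j, i) (if (j < i)%N then pderiv [:: j; i] f 0 else
      if j == i then pderiv [:: i; i] f 0 / 2 else 0).

(** Three integrations along the path, from third derivatives to second ([s1]), to first ([s2]), to
    [f]. Each contributes a factor m |u|. *)
Lemma quadratic_taylor f u (B : R) : smooth f ->
  (forall t w, size t = 3%N -> `|w| <= `|u| -> `|pderiv t f w| <= B) ->
  `|f u - quad (f 0) (taylor1 f) (taylor2 f) u| <= m%:R ^+ 3 * B * `|u| ^+ 3.
Proof.
move=> sf fB; set b := taylor1 f; set A := taylor2 f.
have dpd t w i : is_derive w (e i) (pderiv t f) (pderiv (i :: t) f w).
  by apply/derivableP; have [_] := sf t; apply.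
pose H j i := pderiv [:: j; i] f 0.
have AE (j i : 'I_m) : A j i =
    if (j < i)%N then H j i else if j == i then H i i / 2 else 0 by rewrite mxE.
have s1 j i w : `|w| <= `|u| -> `|pderiv [:: j; i] f w - H j i| <= m%:R * (B * `|w|).
  move=> wu; apply: (@path_bound0 _ (fun k => pderiv [:: k; j; i] f))  => v k vw.
  by apply: fB => //; exact: le_trans wu.
(* For m = 0 the hypothesis on [B] is void, so only the product is known to be nonnegative. *)
have B0 : m%:R * B >= 0.
  case: (posnP m) => [->|m0]; first by rewrite mul0r.
  pose i0 := Ordinal m0; rewrite mulr_ge0//.
  by apply: le_trans (fB [:: i0; i0; i0] 0 _ _) => //; rewrite normr0.
have s2 i w : `|w| <= `|u| ->
    `|pderiv [:: i] f w - b i 0 - \sum_j H j i * w 0 j| <= m%:R ^+ 2 * B * `|u| ^+ 2.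
  move=> wu; rewrite mxE.
  have := @path_bound (pderiv [:: i] f) (fun j => pderiv [:: j; i] f)
    (fun j x => H j i * x) (fun j x => H j i) w (m%:R * (B * `|w|)) (dpd _).
  move=> /(_ _ _ _)/le_trans; apply.
  - move=> j x; apply: is_derive_eq; rewrite /GRing.scale/=; ring.
  - by move=> j; rewrite mulr0.
  - move=> j x xw; apply: (le_trans (s1 _ _ _ _)).
      by apply: le_trans wu; exact: prefix_line_le.
    rewrite mulrA [leRHS]mulrA ler_wpM2l//; exact: prefix_line_le.
  rewrite !expr2 -!mulrA ler_wpM2l// mulrA [leRHS]mulrA ler_wpM2l//.
  by rewrite ler_pM.
have := @path_bound f (fun i => pderiv [:: i] f)
  (* On the i-th edge the coordinates before i have reached their final values, the i-th equals x
     and the others are still 0; this integrates the linear approximation of the i-th derivative. *)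
  (fun i x => (b i 0 + \sum_(j < m | (j < i)%N) H j i * u 0 j) * x + H i i / 2 * x ^+ 2)
  (fun i x => (b i 0 + \sum_(j < m | (j < i)%N) H j i * u 0 j) + H i i * x)
  u (m%:R ^+ 2 * B * `|u| ^+ 2) (dpd [::]).
have -> : f u - f 0 - \sum_i ((b i 0 + \sum_(j < m | (j < i)%N) H j i * u 0 j) * u 0 i +
    H i i / 2 * (u 0 i) ^+ 2) = f u - quad (f 0) b A u.
  rewrite /quad -[X in _ = _ - X]addrA opprD addrA; congr (_ - _).
  rewrite /quad_form mxE [X in _ = _ + X]mxE -big_split/=; apply: eq_bigr => i _.
  rewrite [u^T _ _]mxE [(u *m A) _ _]mxE mulrDl [b i 0 * _]mulrC -addrA; congr (_ + _).
  rewrite [X in _ = X * _](bigID (fun j : 'I_m => (j < i)%N))/= mulrDl.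
  rewrite [X in _ = _ + X * _](bigD1 i)/= ?ltnn// [X in _ = _ + (_ + X) * _]big1.
    rewrite addr0 AE ltnn eqxx !mulr_suml; congr (_ + _).
      by apply: eq_bigr => j ji; rewrite AE ji; ring.
    by rewrite expr2; ring.
  move=> j /andP[nji ji]; rewrite AE (negbTE nji) (negbTE ji).
  by rewrite mulr0.
move=> /(_ _ _ _)/le_trans; apply.
- move=> i x; apply: is_derive_eq; rewrite /GRing.scale/=; by field.
- by move=> i; rewrite mulr0 expr0n/= mulr0 addr0.
- move=> i x xu; apply: le_trans (s2 i _ (prefix_line_le i xu)).
  rewrite le_eqVlt; apply/orP; left; apply/eqP; congr `|_|.
  have wE j : (prefix u i + x *: e i) 0 j =
      (if (j < i)%N then u 0 j else 0) + x * (j == i)%:R by rewrite !mxE.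
  rewrite -[RHS]addrA -opprD; congr (_ - _); rewrite -addrA; congr (_ + _).
  rewrite [RHS](bigID (fun j : 'I_m => (j < i)%N))/=.
  rewrite [X in _ = _ + X](bigD1 i)/= ?ltnn// [X in _ = _ + (_ + X)]big1.
    rewrite addr0 wE ltnn eqxx mulr1 add0r; congr (_ + _).
    apply: eq_bigr => j ji; rewrite wE ji -(inj_eq val_inj)/= ltn_eqF//.
    by rewrite mulr0 addr0.
  move=> j /andP[nji ji]; rewrite wE (negbTE nji) (negbTE ji).
  by rewrite mulr0 addr0 mulr0.
by rewrite !exprS expr0 !mulr1 !mulrA.
Qed.

End path_integration.

(** * Expectations under the standard normal law *)

Section normal_expectation.
Context {R : realType} {m : nat}.
Local Notation PZ := (@normal_tuple R m).
Local Notation tuple := (m.-tuple (measurableTypeR R)).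
Implicit Types (f g : tuple -> R).

Definition moment : R := \int[PZ]_z ((1 + `|vec z|) ^+ 12).

Lemma pow_le12 (k : nat) (x : R) : 0 <= x -> (k <= 12)%N -> (1 + x) ^+ k <= (1 + x) ^+ 12.
Proof. by move=> x0 k12; apply: ler_weXn2l => //; rewrite lerDl. Qed.

Lemma integrable_dominated f K : measurable_fun setT f ->
  (forall z, `|f z| <= K * (1 + `|vec z|) ^+ 12) ->
  PZ.-integrable setT (EFin \o f).
Proof.
move=> mf fK.
have iK : PZ.-integrable setT (EFin \o (fun z => K * (1 + `|vec z|) ^+ 12)).
  rewrite (_ : _ \o _ = (fun z => K%:E * (EFin \o (fun z : tuple => (1 + `|vec z|) ^+ 12)%R) z)%E).
    by apply: integrableZl => //; exact: integrable_moment.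
  by apply/funext => z /=; rewrite EFinM.
apply: (le_integrable measurableT _ _ iK); first exact/measurable_EFinP.
by move=> z _ /=; rewrite lee_fin; apply: le_trans (fK z) (ler_norm _).
Qed.

Lemma expectation_le f K : measurable_fun setT f ->
  (forall z, `|f z| <= K * (1 + `|vec z|) ^+ 12) ->
  `|\int[PZ]_z f z| <= K * moment.
Proof.
move=> mf fK; have intf := integrable_dominated mf fK.
apply: (le_trans (le_normr_Rintegral measurableT intf)).
rewrite /moment -RintegralZl//; last exact: integrable_moment.
apply: le_Rintegral => //.
- by apply: (@integrable_dominated _ K) => [|z]; [exact: measurableT_comp|rewrite normr_id].
- apply: (@integrable_dominated _ K) => [|z].
    by apply: measurable_funM => //; exact: measurable_moment.
  rewrite ger0_norm//; apply: le_trans (fK z); exact: normr_ge0.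
Qed.

Lemma moment_ge0 : 0 <= moment.
Proof. by apply: Rintegral_ge0 => z _; rewrite exprn_ge0// addr_ge0. Qed.

Lemma expectation_cst (c : R) : \int[PZ]_z c = c.
Proof.
rewrite Rintegral_cst// -[RHS]mulr1; congr (_ * _).
exact: (congr1 fine (probability_setT PZ)).
Qed.

Lemma measurable_affine_vec (f : 'rV[R]_m -> R) (u : 'rV[R]_m) (s : R) : continuous f ->
  measurable_fun setT (fun z : tuple => f (u + s *: vec z)).
Proof.
move=> cf; apply: (measurable_continuous_vec (f := fun w => f (u + s *: w))).
have ca : continuous (fun w : 'rV[R]_m => u + s *: w).
  by move=> w; apply: continuousD; [exact: cst_continuous|exact: scaler_continuous].
by move=> w; exact: (cvg_comp _ _ (ca w) (cf _)).
Qed.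

Lemma affine_norm_le (u x : 'rV[R]_m) (s : R) :
  1 + `|u + s *: x| <= (1 + `|u|) * (1 + `|s|) * (1 + `|x|).
Proof.
apply: (@le_trans _ _ (1 + (`|u| + `|s| * `|x|))).
  by rewrite lerD2l (le_trans (ler_normD _ _))// lerD2l -mx_normZ.
have a0 := normr_ge0 u; have s0 := normr_ge0 s; have x0 := normr_ge0 x.
have := mulr_ge0 (mulr_ge0 a0 s0) x0.
have := mulr_ge0 a0 s0; have := mulr_ge0 a0 x0; have := mulr_ge0 s0 x0.
nra.
Qed.

End normal_expectation.

(** * Nearly quadratic surfaces *)

Section near_quadratic.
Context {R : realType} {m : nat}.
Implicit Types (f q : 'rV[R]_m -> R) (u w x : 'rV[R]_m).
Local Notation PZ := (@normal_tuple R m).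

(* The scale [r] stands for n ^ (1/8), so that [r ^+ 4] = sqrt n; [k] is the
   mean of the quadratic part of [q]. *)
Record near_quadratic (C r : R) f q (k : R) : Prop := NearQuadratic {
  nq_cont : continuous f;
  nq_qcont : continuous q;
  nq_bound : forall w, `|q w| <= C * (1 + (1 + `|w|) ^+ 2 / r ^+ 4);
  nq_diff : forall u x, `|q (u + x) - q u| <= C * (1 + `|u|) ^+ 2 * (1 + `|x|) ^+ 2 / r ^+ 4;
  nq_k : `|k| <= C / r ^+ 4;
  nq_mean : forall u s, \int[PZ]_z q (u + s *: vec z) = q u + s ^+ 2 * k;
  nq_near : forall w, C * `|w| <= r ^+ 4 -> `|f w - q w| <= C * `|w| ^+ 3 / r ^+ 8 }.

Lemma nq_integrable C r f q k u s : 0 < r -> 0 <= C -> near_quadratic C r f q k ->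
  PZ.-integrable setT (EFin \o (fun z => q (u + s *: vec z))).
Proof.
move=> r0 C0 [_ cq qb _ _ _ _].
pose b := (1 + `|u|) * (1 + `|s|).
apply: (@integrable_dominated _ _ _ (C * (1 + b ^+ 2 / r ^+ 4))) => [|z].
  exact: measurable_affine_vec.
apply: (le_trans (qb _)); rewrite -[leRHS]mulrA ler_wpM2l// mulrDl mul1r lerD//.
  by rewrite exprn_ege1// lerDl.
rewrite [leRHS]mulrAC ler_wpM2r ?invr_ge0 ?exprn_ge0 ?(ltW r0)//.
apply: (@le_trans _ _ (b ^+ 2 * (1 + `|vec z|) ^+ 2)).
  rewrite -exprMn ler_pXn2r ?nnegrE ?addr_ge0 ?mulr_ge0 ?addr_ge0//.
  exact: affine_norm_le.
by rewrite ler_wpM2l ?exprn_ge0 ?mulr_ge0 ?addr_ge0// pow_le12.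
Qed.

(** Complementing a region amounts, after reflection of v, to negating its surface; this carries the
    estimates for regions over to the selective region. *)
Lemma near_quadraticN C r f q k : 0 < r -> 0 <= C -> near_quadratic C r f q k ->
  near_quadratic C r (fun u => - f u) (fun u => - q u) (- k).
Proof.
move=> r0 C0 nq; have [cf cq qb qd kb qm qn] := nq; split.
- by move=> u; apply: continuousN; exact: cf.
- by move=> u; apply: continuousN; exact: cq.
- by move=> w; rewrite normrN.
- by move=> u x; rewrite -opprD normrN.
- by rewrite normrN.
- move=> u s; rewrite mulrN -opprD -qm.
  rewrite -[RHS]mulN1r -RintegralZl//; last exact: nq_integrable nq.
  by apply: eq_Rintegral => z _; rewrite mulN1r.
- by move=> w wr; rewrite -opprD normrN; exact: qn.
Qed.

Lemma mulmx_norm_le n (u : 'rV[R]_m) (A : 'M[R]_(m, n)) (a : R) j :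
  (forall i j, `|A i j| <= a) -> `|(u *m A) 0 j| <= m%:R * a * `|u|.
Proof.
move=> Aa; rewrite mxE; apply: (le_trans (ler_norm_sum _ _ _)).
apply: (@le_trans _ _ (\sum_(i < m) a * `|u|)).
  apply: ler_sum => i _; rewrite normrM mulrC ler_pM//.
  exact: rV_norm_coord.
by rewrite sumr_const card_ord -mulrA mulr_natl.
Qed.

Lemma quad_form_le (A : 'M[R]_m) (a : R) u w : (forall i j, `|A i j| <= a) ->
  `|quad_form A u w| <= m%:R ^+ 2 * a * `|u| * `|w|.
Proof.
move=> Aa; rewrite /quad_form.
apply: (le_trans (@mulmx_norm_le 1 (u *m A) w^T `|w| 0 _)).
  by move=> i j; rewrite mxE ord1 rV_norm_coord.
have uA : m%:R * `|u *m A| <= m%:R * (m%:R * a * `|u|).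
  case: (posnP m) => [m0|m0].
    by have -> : m%:R = 0 :> R; [rewrite m0|rewrite !mul0r].
  rewrite ler_wpM2l//; apply: rV_norm_le => [|i]; last exact: mulmx_norm_le.
  rewrite !mulr_ge0//; apply: le_trans (Aa (Ordinal m0) (Ordinal m0)).
  exact: normr_ge0.
rewrite mulrAC; apply: (le_trans (ler_wpM2r (normr_ge0 w) uA)).
by rewrite le_eqVlt; apply/orP; left; apply/eqP; ring.
Qed.

Lemma mulmx_coordD (b : 'cV[R]_m) u w :
  ((u + w) *m b) 0 0 = (u *m b) 0 0 + (w *m b) 0 0.
Proof. by rewrite mulmxDl mxE. Qed.

Lemma mulmx_coordN (b : 'cV[R]_m) u : (- u *m b) 0 0 = - (u *m b) 0 0.
Proof. by rewrite mulNmx mxE. Qed.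

Lemma quad_formDl A u w x : quad_form A (u + w) x = quad_form A u x + quad_form A w x.
Proof. by rewrite /quad_form !mulmxDl mxE. Qed.

Lemma quad_formDr A u w x : quad_form A u (w + x) = quad_form A u w + quad_form A u x.
Proof. by rewrite /quad_form linearD/= mulmxDr mxE. Qed.

Lemma quad_formZ A s u : quad_form A (s *: u) (s *: u) = s ^+ 2 * quad_form A u u.
Proof. by rewrite /quad_form linearZ/= -!scalemxAl -scalemxAr !mxE mulrA. Qed.

Lemma continuous_mulmx n (A : 'M[R]_(m, n)) j : continuous (fun u => (u *m A) 0 j).
Proof.
rewrite (_ : (fun _ => _) = (fun u => \sum_i u 0 i * A i j)); last first.
  by apply/funext => u; rewrite mxE.
apply: continuous_big; first exact: add_continuous.
move=> i _ u; apply: continuousM; [exact: coord_continuous|exact: cst_continuous].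
Qed.

Lemma continuous_quad c b A : continuous (@quad R m c b A).
Proof.
have cq : continuous (fun u : 'rV[R]_m => quad_form A u u).
  rewrite (_ : (fun _ => _) = (fun v : 'rV[R]_m => \sum_i (v *m A) 0 i * v 0 i)); last first.
    apply/funext => v /=; rewrite /quad_form mxE; apply: eq_bigr => i _.
    by rewrite [v^T _ _]mxE.
  apply: continuous_big; first exact: add_continuous.
  move=> i _ v; apply: continuousM; first exact: continuous_mulmx.
  exact: coord_continuous.
move=> u; exact: (cvgD (cvgD (cvg_cst c) (@continuous_mulmx 1 b 0 u)) (cq u)).
Qed.

(** In the factor 1 + m + 3 m^2 the terms bound the constant, the linear part, and the three
    quadratic terms of an increment q(u + x) - q(u). The factor 1 + [moment] pays for the bound on
    k. *)
Lemma near_quadratic_quad (C0 r : R) f (c : R) (b : 'cV[R]_m) (A : 'M[R]_m) C :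
  0 < r -> 0 <= C0 -> C0 * (1 + m%:R + 3 * m%:R ^+ 2) <= C -> continuous f ->
  `|c| <= C0 -> (forall i j, `|b i j| <= C0 / r ^+ 4) ->
  (forall i j, `|A i j| <= C0 / r ^+ 4) ->
  (forall w, C * `|w| <= r ^+ 4 -> `|f w - quad c b A w| <= C * `|w| ^+ 3 / r ^+ 8) ->
  exists k, near_quadratic (C * (1 + @moment R m)) r f (quad c b A) k.
Proof.
move=> r0 C00 C0C cf cC bC AC fC.
have M0 := @moment_ge0 R m.
exists (\int[PZ]_z quad_form A (vec z) (vec z)).
have C_ge0 : 0 <= C.
  by apply: le_trans C0C; rewrite mulr_ge0 ?addr_ge0 ?mulr_ge0 ?exprn_ge0.
have CM : C <= C * (1 + @moment R m) by rewrite ler_peMr// lerDl.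
have r4 : 0 < r ^+ 4 by rewrite exprn_gt0.
have m0 : 0 <= m%:R :> R by [].
have P2 (x : R) : 0 <= x -> x <= (1 + x) ^+ 2 /\ x ^+ 2 <= (1 + x) ^+ 2 /\ 1 <= (1 + x) ^+ 2.
  by move=> x0; rewrite !expr2; split; [nra|split; nra].
set e := C0 / r ^+ 4 in bC AC.
have e0 : 0 <= e by rewrite divr_ge0// ltW.
have linb w : `|(w *m b) 0 0| <= m%:R * e * `|w| by exact: mulmx_norm_le.
have qfb u w : `|quad_form A u w| <= m%:R ^+ 2 * e * `|u| * `|w| by exact: quad_form_le.
set M := @moment R m in M0 CM *.
have [Ca Cb Cc] : [/\ C0 <= C, C0 * (m%:R + m%:R ^+ 2) <= C & C0 * (m%:R + 3 * m%:R ^+ 2) <= C].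
  have := mulr_ge0 C00 m0; have := mulr_ge0 C00 (sqr_ge0 (m%:R : R)).
  by split; apply: le_trans C0C; nra.
have eC (a : R) : C0 * a <= C -> e * a <= C / r ^+ 4.
  by move=> h; rewrite /e mulrAC ler_wpM2r// invr_ge0 ltW.
have CMr : C / r ^+ 4 <= C * (1 + M) / r ^+ 4 by rewrite ler_wpM2r// invr_ge0 ltW.
have mQ : measurable_fun setT (fun z : m.-tuple (measurableTypeR R) => quad_form A (vec z) (vec z)).
  have -> : (fun z : m.-tuple (measurableTypeR R) => quad_form A (vec z) (vec z)) =
      (fun z => quad 0 0 A (0 + 1 *: vec z)).
    by apply/funext => z; rewrite /quad mulmx0 mxE !add0r scale1r.
  by apply: measurable_affine_vec; exact: continuous_quad.
have Qb (z : m.-tuple (measurableTypeR R)) :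
    `|quad_form A (vec z) (vec z)| <= m%:R ^+ 2 * e * (1 + `|vec z|) ^+ 12.
  apply: (le_trans (qfb _ _)); rewrite -mulrA ler_wpM2l//.
    exact: mulr_ge0 (exprn_ge0 2 m0) e0.
  rewrite -expr2; have [_ [p2 _]] := P2 _ (normr_ge0 (vec z)).
  by apply: (le_trans p2); exact: pow_le12.
have qb w : `|quad c b A w| <= C * (1 + (1 + `|w|) ^+ 2 / r ^+ 4).
  have w0 := normr_ge0 w; have [p1 [p2 p3]] := P2 _ w0.
  rewrite /quad; apply: (le_trans (ler_normD _ _)).
  apply: (le_trans (lerD (ler_normD _ _) (qfb w w))).
  rewrite mulrDr mulr1 -addrA lerD//; first exact: le_trans Ca.
  apply: (le_trans (lerD (linb w) (lexx _))).
  apply: (@le_trans _ _ (e * (m%:R + m%:R ^+ 2) * (1 + `|w|) ^+ 2)).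
    have h1 := ler_wpM2l (mulr_ge0 m0 e0) p1.
    have h2 := ler_wpM2l (mulr_ge0 (sqr_ge0 (m%:R : R)) e0) p2.
    move: h1 h2; rewrite !expr2; nra.
  rewrite [leRHS]mulrA [leRHS]mulrAC ler_wpM2r ?exprn_ge0 ?addr_ge0//; exact: eC.
split => //.
- exact: continuous_quad.
- move=> w; apply: (le_trans (qb w)).
  by rewrite ler_wpM2r// addr_ge0// divr_ge0 ?exprn_ge0 ?addr_ge0// ltW.
- move=> u x; have u0 := normr_ge0 u; have x0 := normr_ge0 x.
  have [p1 [p2 p3]] := P2 _ u0; have [p4 [p5 p6]] := P2 _ x0.
  have -> : quad c b A (u + x) - quad c b A u =
      (x *m b) 0 0 + quad_form A u x + quad_form A x u + quad_form A x x.
    by rewrite /quad mulmx_coordD quad_formDl !quad_formDr; ring.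
  apply: (le_trans (ler_normD _ _)); apply: (le_trans (lerD (ler_normD _ _) (qfb x x))).
  apply: (le_trans (lerD (lerD (ler_normD _ _) (qfb x u)) (lexx _))).
  apply: (le_trans (lerD (lerD (lerD (linb x) (qfb u x)) (lexx _)) (lexx _))).
  set y := (1 + `|u|) ^+ 2 * (1 + `|x|) ^+ 2.
  have y0 : 0 <= y by rewrite mulr_ge0// exprn_ge0// addr_ge0.
  have q1 : `|x| <= y by apply: (@le_trans _ _ (1 * `|x|)); [rewrite mul1r|rewrite ler_pM].
  have q2 : `|u| * `|x| <= y by rewrite ler_pM.
  have q3 : `|x| * `|x| <= y.
    by apply: (@le_trans _ _ (1 * `|x| ^+ 2)); [rewrite mul1r expr2|rewrite ler_pM// exprn_ge0].
  apply: (@le_trans _ _ (e * (m%:R + 3 * m%:R ^+ 2) * y)).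
    have h1 := ler_wpM2l (mulr_ge0 m0 e0) q1.
    have h2 := ler_wpM2l (mulr_ge0 (sqr_ge0 (m%:R : R)) e0) q2.
    have h3 := ler_wpM2l (mulr_ge0 (sqr_ge0 (m%:R : R)) e0) q3.
    move: h1 h2 h3; move: (m%:R ^+ 2) => m2; nra.
  rewrite -[X in _ <= X / _]mulrA -/y [leRHS]mulrAC ler_wpM2r//.
  by apply: le_trans CMr; exact: eC.
- apply: (@le_trans _ _ (m%:R ^+ 2 * e * M)); first exact: expectation_le.
  rewrite [m%:R ^+ 2 * e]mulrC; apply: (@le_trans _ _ (C / r ^+ 4 * M)).
    rewrite ler_wpM2r//; apply: eC; apply: le_trans Cb.
    by rewrite ler_wpM2l// lerDr.
  by rewrite mulrAC ler_wpM2r ?invr_ge0 ?(ltW r4)// ler_wpM2l// lerDr.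
- move=> u s; have cq := @continuous_quad c b A.
  pose g (z : m.-tuple (measurableTypeR R)) := quad c b A (u + s *: vec z).
  have mg : measurable_fun setT g by exact: measurable_affine_vec.
  (* Averaging over z and - z cancels all odd terms, so the mean is q(u) + s^2 k exactly. *)
  have gE z : g z + g (neg_tuple z) =
      2 * quad c b A u + 2 * s ^+ 2 * quad_form A (vec z) (vec z).
    rewrite /g vec_neg scalerN /quad !mulmx_coordD mulmx_coordN.
    rewrite !(quad_formDl, quad_formDr).
    have -> : quad_form A (- (s *: vec z)) (- (s *: vec z)) = s ^+ 2 * quad_form A (vec z) (vec z).
      by rewrite -scaleNr quad_formZ sqrrN.
    rewrite quad_formZ.
    have -> : quad_form A u (- (s *: vec z)) = - quad_form A u (s *: vec z).
      by rewrite /quad_form linearN/= mulmxN mxE.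
    have -> : quad_form A (- (s *: vec z)) u = - quad_form A (s *: vec z) u.
      by rewrite /quad_form !mulNmx mxE.
    ring.
  have gb z : `|g z| <= (C * (1 + ((1 + `|u|) * (1 + `|s|)) ^+ 2 / r ^+ 4)) * (1 + `|vec z|) ^+ 12.
    apply: (le_trans (qb _)).
    rewrite -[leRHS]mulrA ler_wpM2l// mulrDl mul1r lerD//; first by rewrite exprn_ege1// lerDl.
    rewrite [leRHS]mulrAC ler_wpM2r ?invr_ge0 ?(ltW r4)//.
    apply: (@le_trans _ _ (((1 + `|u|) * (1 + `|s|)) ^+ 2 * (1 + `|vec z|) ^+ 2)).
      rewrite -exprMn ler_pXn2r ?nnegrE ?addr_ge0 ?mulr_ge0 ?addr_ge0//.
      exact: affine_norm_le.
    by rewrite ler_wpM2l ?exprn_ge0 ?mulr_ge0 ?addr_ge0// pow_le12.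
  have ig : PZ.-integrable setT (EFin \o g) by exact: integrable_dominated gb.
  have igN : PZ.-integrable setT (EFin \o (fun z => g (neg_tuple z))).
    apply: (integrable_dominated (K := C * (1 + ((1 + `|u|) * (1 + `|s|)) ^+ 2 / r ^+ 4))) => [|z].
      exact: (measurableT_comp mg (@measurable_neg_tuple R m)).
    by apply: (le_trans (gb _)); rewrite vec_neg normrN.
  have iQ : PZ.-integrable setT (EFin \o (fun z => quad_form A (vec z) (vec z))).
    by apply: (integrable_dominated mQ) => z; exact: Qb.
  have E2 : 2 * \int[PZ]_z g z = 2 * quad c b A u + 2 * s ^+ 2 * \int[PZ]_z quad_form A (vec z) (vec z).
    rewrite mulr2n mulrDl mul1r {2}(normal_tuple_sym mg igN) -RintegralD//.
    under eq_Rintegral do rewrite gE.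
    rewrite RintegralD//.
    - by rewrite expectation_cst RintegralZl.
    - apply: (@integrable_dominated _ _ _ `|2 * quad c b A u|) => [|z]; first exact: measurable_cst.
      by rewrite ler_peMr// exprn_ege1// lerDl.
    - apply: (@integrable_dominated _ _ _ (`|2 * s ^+ 2| * (m%:R ^+ 2 * e))) => [|z].
        by apply: measurable_funM.
      by rewrite normrM -mulrA ler_wpM2l.
  have two0 : (2 : R) != 0 by [].
  by apply: (mulfI two0); rewrite E2; ring.
- move=> w wr; apply: (@le_trans _ _ (C * `|w| ^+ 3 / r ^+ 8)).
    apply: fC; apply: le_trans wr; by rewrite ler_wpM2r.
  by rewrite ler_wpM2r ?invr_ge0 ?exprn_ge0 ?(ltW r0)// ler_wpM2r// exprn_ge0.
Qed.

End near_quadratic.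

(** * Nearly parallel surfaces are nearly quadratic *)

Section from_nearly_parallel.
Context {R : realType} {m : nat}.

Definition root8 (n : nat) : R := Num.sqrt (Num.sqrt (Num.sqrt n%:R)).

Lemma root8_4 n : root8 n ^+ 4 = Num.sqrt n%:R.
Proof. by rewrite /root8 (exprM _ 2 2) !sqr_sqrtr ?sqrtr_ge0. Qed.

Lemma root8_8 n : root8 n ^+ 8 = n%:R.
Proof. by rewrite (exprM _ 4 2) root8_4 sqr_sqrtr. Qed.

Lemma root8_gt0 n : (0 < n)%N -> 0 < root8 n.
Proof. by move=> n0; rewrite !sqrtr_gt0 ltr0n. Qed.

Lemma bound_sum (I : finType) (F : I -> R) i : F i <= \sum_j `|F j|.
Proof.
rewrite (bigD1 i)//=; apply: (le_trans (ler_norm _)).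
by rewrite lerDl; apply: sumr_ge0.
Qed.

(** The derivatives of orders 1 to 3 are finite in number, so their O-constants add up to a single
    one and hold from a common rank on. *)
Lemma nearly_parallel_quadratic (h : nat -> 'rV[R]_m -> R) : nearly_parallel h ->
  exists2 C : R, 1 <= C & \forall n \near \oo,
    exists q k, near_quadratic C (root8 n) (h n) q k.
Proof.
case=> sm /eqO_exP[K0 K00 h0] h1 h2 [c c0 h3].
have {h1} /choice[K1 h1] : forall i, exists K : R, \forall n \near \oo,
    `|pderiv [:: i] (h n) 0| <= K * (Num.sqrt n%:R)^-1.
  move=> i; have /eqO_exP[K _ hK] := h1 i; exists K; apply: filterS hK => n.
  by rewrite [X in _ * X]ger0_norm ?invr_ge0.
have {h2} /choice[K2 h2] : forall p : 'I_m * 'I_m, exists K : R, \forall n \near \oo,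
    `|pderiv [:: p.1; p.2] (h n) 0 / 2| <= K * (Num.sqrt n%:R)^-1.
  move=> p; have /eqO_exP[K _ hK] := h2 p.1 p.2; exists K; apply: filterS hK => n.
  by rewrite [X in _ <= _ * X -> _]ger0_norm ?invr_ge0.
have {h3} /choice[K3 h3] : forall t : 3.-tuple 'I_m, exists K : R, \forall n \near \oo,
    forall x, `|x| <= c * Num.sqrt n%:R -> `|pderiv t (h n) x| <= K * Num.sqrt n%:R ^- 2.
  move=> t; have [|K hK] := h3 t; first by rewrite size_tuple.
  by exists K; apply: filterS hK => n; rewrite size_tuple.
pose S1 := \sum_i `|K1 i|; pose S2 := \sum_i `|K2 i|; pose S3 := \sum_i `|K3 i|.
have S10 : 0 <= S1 by apply: sumr_ge0.
have S20 : 0 <= S2 by apply: sumr_ge0.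
have S30 : 0 <= S3 by apply: sumr_ge0.
(* The off-diagonal Taylor coefficients are the full mixed derivatives, twice the halved ones that
   the hypothesis bounds. *)
pose C0 := K0 + S1 + 2 * S2.
have C00 : 0 <= C0 by rewrite !addr_ge0 ?mulr_ge0// ltW.
(* The second summand is for the Taylor remainder; [c^-1] makes C |w| <= sqrt n imply |w| <= c sqrt
   n, the ball on which third derivatives are controlled. *)
pose C := C0 * (1 + m%:R + 3 * m%:R ^+ 2) + m%:R ^+ 3 * S3 + c^-1 + 1.
have pos1 : 0 <= C0 * (1 + m%:R + 3 * m%:R ^+ 2).
  by rewrite mulr_ge0// !addr_ge0// mulr_ge0// exprn_ge0.
have pos2 : 0 <= m%:R ^+ 3 * S3 by rewrite mulr_ge0// exprn_ge0.
have pos3 : 0 <= c^-1 by rewrite invr_ge0 ltW.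
have C_ge1 : 1 <= C by rewrite lerDr !addr_ge0.
have M0 := @moment_ge0 R m.
exists (C * (1 + @moment R m)); first by rewrite mulr_ege1// lerDl.
near=> n.
have n0 : (0 < n)%N by near: n; exact: nbhs_infty_gt.
have r0 := root8_gt0 n0.
have s0 : 0 < Num.sqrt n%:R :> R by rewrite sqrtr_gt0 ltr0n.
have b0 : `|h n 0| <= K0.
  by near: n; apply: filterS h0 => n; rewrite normr1 mulr1.
have b1 : forall i, `|pderiv [:: i] (h n) 0| <= K1 i * (Num.sqrt n%:R)^-1.
  by near: n; apply: filter_forall.
have b2 : forall p : 'I_m * 'I_m, `|pderiv [:: p.1; p.2] (h n) 0 / 2| <= K2 p * (Num.sqrt n%:R)^-1.
  by near: n; apply: filter_forall.
have b3 : forall (t : 3.-tuple 'I_m) x, `|x| <= c * Num.sqrt n%:R ->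
    `|pderiv t (h n) x| <= K3 t * Num.sqrt n%:R ^- 2.
  by near: n; apply: filter_forall.
exists (quad (h n 0) (taylor1 (h n)) (taylor2 (h n))).
apply: (@near_quadratic_quad R m C0) => //; rewrite ?root8_4 ?root8_8.
- by rewrite /C -!addrA lerDl !addr_ge0.
- by have [] := sm n [::].
- by apply: le_trans b0 _; rewrite /C0 -addrA lerDl addr_ge0// mulr_ge0.
- move=> i j; rewrite mxE; apply: (le_trans (b1 i)).
  rewrite ler_wpM2r ?invr_ge0 ?(ltW s0)//; apply: (le_trans (bound_sum K1 i)).
  rewrite /C0 -/S1; have := ltW K00; lra.
- move=> j i; rewrite mxE; have S2C : 2 * S2 <= C0 by rewrite /C0; have := ltW K00; lra.
  have full (a b : 'I_m) : `|pderiv [:: a; b] (h n) 0 / 2| <= S2 / Num.sqrt n%:R.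
    apply: (le_trans (b2 (a, b))); rewrite ler_wpM2r ?invr_ge0 ?(ltW s0)//.
    exact: (bound_sum K2).
  case: ifP => _.
    rewrite -[pderiv _ _ _](@divfK _ 2)// normrM [`|2|]ger0_norm//.
    apply: (le_trans (ler_wpM2r _ (full j i))) => //.
    by rewrite mulrAC ler_wpM2r ?invr_ge0 ?(ltW s0)// mulrC.
  case: ifP => _.
    apply: (le_trans (full i i)); rewrite ler_wpM2r ?invr_ge0 ?(ltW s0)//.
    by move: S2C; lra.
  by rewrite normr0 divr_ge0// ltW.
- move=> w Cw.
  have wc : `|w| <= c * Num.sqrt n%:R.
    rewrite -ler_pdivrMl//; apply: le_trans Cw; rewrite ler_wpM2r//.
    by rewrite /C; lra.
  have := @quadratic_taylor R m (h n) w (S3 / n%:R) (sm n).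
  move=> /(_ _)/le_trans; apply.
    move=> t v st vw; have := b3 (Tuple (introT eqP st)) v (le_trans vw wc).
    move=> /le_trans; apply; rewrite -exprVn exprVn sqr_sqrtr//.
    by rewrite ler_wpM2r ?invr_ge0//; exact: (bound_sum K3).
  have -> : m%:R ^+ 3 * (S3 / n%:R) * `|w| ^+ 3 = m%:R ^+ 3 * S3 * `|w| ^+ 3 / n%:R by ring.
  apply: ler_wpM2r; first by rewrite invr_ge0.
  apply: ler_wpM2r; first exact: exprn_ge0.
  by rewrite /C; lra.
Unshelve. all: by end_near. Qed.

End from_nearly_parallel.

(** * Bootstrap probabilities *)

Section bootstrap_probability.
Context {R : realType} {m : nat}.
Implicit Types (f : 'rV[R]_m -> R) (u : 'rV[R]_m) (v s : R).
Local Notation PZ := (@normal_tuple R m).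
Local Notation N := (normal_prob (0 : R) 1).
Local Notation tuple := (m.-tuple (measurableTypeR R)).
Local Notation space := (tuple * measurableTypeR R)%type.

Definition tail_mean f v u s : R := \int[PZ]_z Phibar ((v + f (u + s *: vec z)) / s).

Lemma measurable_tail_integrand f v u s : continuous f ->
  measurable_fun setT (fun z : tuple => Phibar ((v + f (u + s *: vec z)) / s)).
Proof.
move=> cf; apply: (measurableT_comp measurable_Phibar).
apply: measurable_funM => //; apply: measurable_funD => //.
exact: measurable_affine_vec.
Qed.

Lemma integrable_unit (g : tuple -> R) : measurable_fun setT g ->
  (forall z, 0 <= g z <= 1) -> PZ.-integrable setT (EFin \o g).
Proof.
move=> mg g01; apply: (integrable_dominated (K := 1) mg) => z.
have /andP[g0 g1] := g01 z; rewrite mul1r ger0_norm//; apply: (le_trans g1).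
by rewrite exprn_ege1// lerDl.
Qed.

Lemma Phibar01 (x : R) : 0 <= Phibar x <= 1.
Proof. by rewrite Phibar_ge0 Phibar_le1. Qed.

Lemma integrable_tail_integrand f v u s : continuous f ->
  PZ.-integrable setT (EFin \o (fun z : tuple => Phibar ((v + f (u + s *: vec z)) / s))).
Proof.
move=> cf; apply: integrable_unit => [|z]; last exact: Phibar01.
exact: measurable_tail_integrand.
Qed.

(** If the mean were 0 then [g] would vanish almost everywhere, and the whole space would be null.
    This puts bootstrap probabilities strictly inside (0, 1), where [Phibar_inv] inverts
    [Phibar]. *)
Lemma expectation_gt0 (g : tuple -> R) : PZ.-integrable setT (EFin \o g) ->
  (forall z, 0 < g z) -> 0 < \int[PZ]_z g z.
Proof.
move=> ig g0; rewrite lt0r Rintegral_ge0 ?andbT; last by move=> z _; exact: ltW.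
apply/eqP => g00.
have mg : measurable_fun setT (EFin \o g) by case/integrableP: ig.
have : (\int[PZ]_(z in setT) `|(EFin \o g) z| = 0)%E.
  rewrite -[RHS]/(0%:E) -g00 /Rintegral fineK; last exact: integrable_fin_num.
  by apply: eq_integral => z _; rewrite /= ger0_norm// ltW.
move=> /(ae_eq_integral_abs _ measurableT mg)[A [mA A0 AE]].
have AT : A = setT.
  apply/seteqP; split => // z _; apply: AE => /= /(_ Logic.I)/eqP.
  by rewrite eqe gt_eqF.
have A0' : PZ setT = 0%E by rewrite -AT.
have E : (0 : R) = 1 := congr1 fine (etrans (esym A0') (probability_setT PZ)).
by move/eqP: E; rewrite eq_sym oner_eq0.
Qed.

Lemma tail_mean_gt0 f v u s : continuous f -> 0 < tail_mean f v u s.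
Proof.
move=> cf; apply: expectation_gt0 => [|z]; last exact: Phibar_gt0.
exact: integrable_tail_integrand.
Qed.

Lemma tail_meanN f v u s : continuous f ->
  tail_mean (fun w => - f w) (- v) u s = 1 - tail_mean f v u s.
Proof.
move=> cf; rewrite /tail_mean -[1](@expectation_cst R m) -RintegralB//.
- by apply: eq_Rintegral => z _; rewrite -opprD mulNr PhibarN.
- by apply: integrable_unit => // z; rewrite ler01 lexx.
- exact: integrable_tail_integrand.
Qed.

Lemma tail_mean_lt1 f v u s : continuous f -> tail_mean f v u s < 1.
Proof.
move=> cf; rewrite -subr_gt0 -tail_meanN//; apply: tail_mean_gt0 => w.
by apply: continuousN; exact: cf.
Qed.

Lemma tail_mean01 f v u s : continuous f -> 0 < tail_mean f v u s < 1.
Proof. by move=> cf; rewrite tail_mean_gt0// tail_mean_lt1. Qed.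

Lemma measurable_region f : continuous f ->
  measurable [set z : space | region f (vec z.1, z.2)].
Proof.
move=> cf; have mg : measurable_fun setT (fun z : space => z.2 + f (vec z.1)).
  apply: measurable_funD; first exact: measurable_snd.
  exact: (measurableT_comp (measurable_continuous_vec cf) measurable_fst).
rewrite (_ : mkset _ = setT `&` (fun z : space => z.2 + f (vec z.1)) @^-1` `]-oo, 0]%classic).
  exact: mg.
apply/seteqP; split => z /=; rewrite /region/= in_itv/=.
  by move=> h; split => //; rewrite -(subr0 (f _)) addrA subr0 -lerBrDr sub0r.
by case=> _; rewrite -lerBrDr sub0r.
Qed.

Lemma measurable_affine_tuple (s : R) : measurable_fun setT
  (fun p : tuple * tuple => [tuple tnth p.1 i + s * tnth p.2 i | i < m] : tuple).
Proof.
apply/measurable_fun_tnthP => i.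
rewrite (_ : _ \o _ = (fun p : tuple * tuple => tnth p.1 i + s * tnth p.2 i)); last first.
  by apply/funext => p /=; rewrite tnth_mktuple.
have mt := @measurable_tnth _ (measurableTypeR R) m i.
apply: measurable_funD; first exact: (measurableT_comp mt measurable_fst).
apply: measurable_funM; first exact: measurable_cst.
exact: (measurableT_comp mt measurable_snd).
Qed.

Lemma measurable_affine_preimage (mu : 'rV[R]_m * R) s (D : set ('rV[R]_m * R)) :
  measurable [set z : space | D (vec z.1, z.2)] ->
  measurable [set z : space | D (mu.1 + s *: vec z.1, mu.2 + s * z.2)].
Proof.
move=> mD; pose t0 : tuple := [tuple mu.1 0 i | i < m].
pose F (z : space) : space := ([tuple tnth t0 i + s * tnth z.1 i | i < m], mu.2 + s * z.2).
have mF : measurable_fun setT F.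
  apply: measurable_fun_pair.
    have mp : measurable_fun setT (fun z : space => (t0, z.1)).
      by apply: measurable_fun_pair; [exact: measurable_cst|exact: measurable_fst].
    exact: (measurableT_comp (measurable_affine_tuple s) mp).
  apply: measurable_funD; first exact: measurable_cst.
  by apply: measurable_funM; [exact: measurable_cst|exact: measurable_snd].
rewrite (_ : mkset _ = setT `&` F @^-1` [set z : space | D (vec z.1, z.2)]); first exact: mF.
by apply/seteqP; split => z /=; rewrite vec_axpy vecK; [split|case].
Qed.

Lemma gaussian_sections (mu : 'rV[R]_m * R) s2 (D : set ('rV[R]_m * R)) : 0 < s2 ->
  measurable [set z : space | D (vec z.1, z.2)] ->
  gaussian mu s2 D = \int[PZ]_z fine (N [set w | D (mu.1 + Num.sqrt s2 *: vec z, mu.2 + Num.sqrt s2 * w)]).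
Proof.
move=> s0 mD; rewrite gaussianE//=; congr fine; apply: eq_integral => z _.
have mA := measurable_affine_preimage mu (Num.sqrt s2) mD.
have E : [set w | D (mu.1 + Num.sqrt s2 *: vec z, mu.2 + Num.sqrt s2 * w)] =
    xsection [set z : space | D (mu.1 + Num.sqrt s2 *: vec z.1, mu.2 + Num.sqrt s2 * z.2)] z.
  by apply/seteqP; split => w; rewrite /xsection/= inE.
rewrite E fineK; first by [].
by apply: normal_prob_fin; exact: measurable_xsection.
Qed.

Lemma gaussian_setC (mu : 'rV[R]_m * R) s2 (D : set ('rV[R]_m * R)) : 0 < s2 ->
  measurable [set z : space | D (vec z.1, z.2)] ->
  gaussian mu s2 (~` D) = 1 - gaussian mu s2 D.
Proof.
move=> s0 mD; rewrite !gaussianE//; last exact: (measurableC mD).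
have mA := measurable_affine_preimage mu (Num.sqrt s2) mD.
pose P : probability space R := (PZ \x N)%E.
set A := [set z | D _] in mA *.
transitivity (fine (1 - P A)%E); first exact: (congr1 fine (probability_setC P mA)).
by rewrite fineB//; exact: fin_num_measure.
Qed.

Lemma bootstrap_region f u v s2 : 0 < s2 -> continuous f ->
  bootstrap_prob s2 (region f) (u, v) = tail_mean f v u (Num.sqrt s2).
Proof.
move=> s0 cf; have r0 : 0 < Num.sqrt s2 by rewrite sqrtr_gt0.
rewrite /bootstrap_prob (gaussian_sections (u, v) s0 (measurable_region cf)).
apply: eq_Rintegral => z _ /=.
set s := Num.sqrt s2 in r0 *; set x := f _.
rewrite (_ : mkset _ = `]-oo, (- ((v + x) / s))]%classic).
  by rewrite Phibar_itvNyc /= PhibarN opprB addrCA subrr addr0.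
apply/seteqP; split => w /=; rewrite /region/= in_itv/= -mulNr ler_pdivlMr// mulrC.
  by move=> h; rewrite opprD; move: h; rewrite -lerBrDl addrC.
by rewrite opprD => h; rewrite -lerBrDl addrC.
Qed.

Lemma bootstrap_setC_region f u v s2 : 0 < s2 -> continuous f ->
  bootstrap_prob s2 (~` region f) (u, v) =
  tail_mean (fun w => - f w) (- v) u (Num.sqrt s2).
Proof.
move=> s0 cf; rewrite tail_meanN// -(bootstrap_region u v s0 cf) /bootstrap_prob.
exact: gaussian_setC (measurable_region cf).
Qed.

(** Joint measurability in (u, v), by Fubini and Tonelli; the measurability of the rejection region
    rests on it. *)
Lemma measurable_tail_mean f s : continuous f ->
  measurable_fun setT (fun y : space => tail_mean f y.2 (vec y.1) s).
Proof.
move=> cf; rewrite /tail_mean /Rintegral.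
apply: measurableT_comp => //.
pose g (p : space * tuple) : \bar R := (Phibar ((p.1.2 + f (vec p.1.1 + s *: vec p.2)) / s))%:E.
apply: (@measurable_fun_fubini_tonelli_F _ _ _ _ R PZ g).
  apply/measurable_EFinP; apply: (measurableT_comp measurable_Phibar).
  apply: measurable_funM => //; apply: measurable_funD.
    exact: (measurableT_comp measurable_snd measurable_fst).
  have -> : (fun p : space * tuple => f (vec p.1.1 + s *: vec p.2)) =
      (f \o @vec R m) \o ((fun p : tuple * tuple =>
        [tuple tnth p.1 i + s * tnth p.2 i | i < m] : tuple) \o (fun p => (p.1.1, p.2))).
    by apply/funext => p /=; rewrite vec_axpy.
  apply: (measurableT_comp (measurable_continuous_vec cf)).
  apply: (measurableT_comp (measurable_affine_tuple s)).
  apply: measurable_fun_pair; last exact: measurable_snd.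
  exact: (measurableT_comp measurable_fst measurable_fst).
by move=> p; rewrite lee_fin Phibar_ge0.
Qed.

End bootstrap_probability.

(** * Expansion of psi *)

Section psi_expansion.
Context {R : realType} {m : nat}.
Implicit Types (f q : 'rV[R]_m -> R) (u : 'rV[R]_m) (v s k r C : R).
Local Notation PZ := (@normal_tuple R m).
Local Notation phi := (normal_pdf (0 : R) 1).
Local Notation tuple := (m.-tuple (measurableTypeR R)).

Lemma Phibar_sub_le1 (x y : R) : `|Phibar x - Phibar y| <= 1.
Proof.
rewrite ler_norml; have := Phibar_ge0 x; have := Phibar_le1 x.
have := Phibar_ge0 y; have := Phibar_le1 y; lra.
Qed.

(* Outside the ball where [f] is controlled the trivial bound 1 is absorbed by
   [|w| ^+ 2 / r ^+ 8]. *)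
Lemma nq_Phibar C r f q k s v w : 1 <= C -> 0 < s -> 0 < r -> near_quadratic C r f q k ->
  `|Phibar ((v + f w) / s) - Phibar ((v + q w) / s)| <= (C / s + C ^+ 2) * (1 + `|w|) ^+ 3 / r ^+ 8.
Proof.
move=> C1 s0 r0 nq; have C0 : 0 <= C by apply: le_trans C1.
have w0 := normr_ge0 w; have r8 : 0 < r ^+ 8 by rewrite exprn_gt0.
have [wr|wr] := leP (C * `|w|) (r ^+ 4).
  apply: (le_trans (Phibar_lipschitz _ _)).
  rewrite -mulrBl opprD addrACA subrr add0r normrM normfV (gtr0_norm s0).
  apply: (@le_trans _ _ (C * `|w| ^+ 3 / r ^+ 8 / s)).
    by rewrite ler_wpM2r ?invr_ge0 ?(ltW s0)// (nq_near nq).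
  rewrite mulrAC ler_wpM2r ?invr_ge0 ?(ltW r8)// mulrAC ler_pM//.
  - by rewrite divr_ge0// ltW.
  - by rewrite lerDl exprn_ge0.
  - by rewrite ler_pXn2r ?nnegrE ?addr_ge0// lerDr.
apply: (le_trans (Phibar_sub_le1 _ _)).
rewrite ler_pdivlMr// mul1r.
apply: (@le_trans _ _ ((C * `|w|) ^+ 2)).
  rewrite (exprM _ 4 2) ler_pXn2r ?nnegrE ?mulr_ge0 ?exprn_ge0 ?(ltW r0)//.
  exact: ltW.
rewrite exprMn ler_pM ?exprn_ge0//; first by rewrite lerDr divr_ge0// ltW.
apply: (@le_trans _ _ ((1 + `|w|) ^+ 2)).
  by rewrite ler_pXn2r ?nnegrE ?addr_ge0// lerDr.
by rewrite ler_weXn2l// lerDl.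
Qed.

Lemma scale_norm_le s (x : 'rV[R]_m) : 0 <= s -> 1 + `|s *: x| <= (1 + s) * (1 + `|x|).
Proof.
move=> s0; have := @affine_norm_le R m 0 x s.
by rewrite add0r normr0 addr0 mul1r (ger0_norm s0).
Qed.

Lemma nq_centered_le C r f q k s u (x : 'rV[R]_m) : 0 <= C -> 0 < r -> 0 <= s ->
  near_quadratic C r f q k ->
  `|q (u + s *: x) - q u - s ^+ 2 * k| <=
    C * ((1 + s) ^+ 2 + s ^+ 2) * (1 + `|u|) ^+ 2 * (1 + `|x|) ^+ 2 / r ^+ 4.
Proof.
move=> C0 r0 s0 nq; have r4 : 0 < r ^+ 4 by rewrite exprn_gt0.
have u0 := normr_ge0 u; have x0 := normr_ge0 x.
have U1 : 1 <= (1 + `|u|) ^+ 2 by rewrite exprn_ege1// lerDl.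
have X1 : 1 <= (1 + `|x|) ^+ 2 by rewrite exprn_ege1// lerDl.
have S1 : (1 + `|s *: x|) ^+ 2 <= (1 + s) ^+ 2 * (1 + `|x|) ^+ 2.
  rewrite -exprMn ler_pXn2r ?nnegrE ?addr_ge0 ?mulr_ge0 ?addr_ge0//.
  exact: scale_norm_le.
apply: (le_trans (ler_normB _ _)); apply: (le_trans (lerD (nq_diff nq u _) (lexx _))).
rewrite normrM (ger0_norm (sqr_ge0 s)).
apply: (le_trans (lerD (lexx _) (ler_wpM2l (sqr_ge0 s) (nq_k nq)))).
rewrite [X in _ + X <= _]mulrA -mulrDl ler_wpM2r ?invr_ge0 ?(ltW r4)//.
have h1 := ler_wpM2l (mulr_ge0 C0 (le_trans ler01 U1)) S1.
have h2 : s ^+ 2 * C <= s ^+ 2 * C * ((1 + `|u|) ^+ 2 * (1 + `|x|) ^+ 2).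
  by rewrite ler_peMr ?mulr_ge0 ?sqr_ge0// mulr_ege1.
apply: (le_trans (lerD h1 h2)).
by rewrite le_eqVlt; apply/orP; left; apply/eqP; ring.
Qed.

Lemma nq_centered_mean C r f q k s u : 0 <= C -> 0 < r -> near_quadratic C r f q k ->
  \int[PZ]_z (q (u + s *: vec z) - q u - s ^+ 2 * k) = 0.
Proof.
move=> C0 r0 nq.
under eq_Rintegral do rewrite -addrA -opprD.
have icst (c : R) : PZ.-integrable setT (EFin \o (fun _ : tuple => c)).
  apply: (integrable_dominated (K := `|c|)) => [|z]; first exact: measurable_cst.
  by rewrite ler_peMr// exprn_ege1// lerDl.
rewrite RintegralB//; last exact: nq_integrable nq.
by rewrite expectation_cst (nq_mean nq) subrr.
Qed.

(** Uniform in v, because [Phibar] and [phi] are Lipschitz on the whole line; only the inversion of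
    [Phibar] will restrict v. *)
Lemma tail_mean_approx C s : 1 <= C -> 0 < s -> exists2 K, 1 <= K &
  forall r f q k u v, 1 <= r -> near_quadratic C r f q k ->
  `|tail_mean f v u s - Phibar ((v + q u + s ^+ 2 * k) / s)| <= K * (1 + `|u|) ^+ 4 / r ^+ 8.
Proof.
move=> C1 s0; have C0 : 0 <= C by apply: le_trans C1.
have s0' := ltW s0.
pose D0 := C * ((1 + s) ^+ 2 + s ^+ 2) / s.
have D00 : 0 <= D0 by rewrite !mulr_ge0 ?invr_ge0 ?addr_ge0 ?exprn_ge0 ?addr_ge0.
pose K1 := (C / s + C ^+ 2) * (1 + s) ^+ 3.
have K10 : 0 <= K1 by rewrite !mulr_ge0 ?addr_ge0 ?exprn_ge0 ?divr_ge0 ?addr_ge0.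
have M0 := @moment_ge0 R m.
exists (1 + (K1 + D0 ^+ 2) * @moment R m).
  by rewrite lerDl mulr_ge0 ?addr_ge0 ?exprn_ge0.
move=> r f q k u v r1 nq; have r0 : 0 < r by apply: lt_le_trans r1.
have r8 : 0 < r ^+ 8 by rewrite exprn_gt0.
have u0 := normr_ge0 u.
pose d (z : tuple) := q (u + s *: vec z) - q u - s ^+ 2 * k.
set x := (v + q u + s ^+ 2 * k) / s.
have xE (z : tuple) : (v + q (u + s *: vec z)) / s = x + d z / s.
  by rewrite /x /d -mulrDl; congr (_ / _); ring.
have md : measurable_fun setT d.
  apply: measurable_funB => //; apply: measurable_funB => //.
  exact: measurable_affine_vec (nq_qcont nq).
(* Adding the first order term leaves the mean unchanged, as [d] is centered, and makes the
   integrand O(r^-8) pointwise, up to a polynomial factor. *)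
pose g (z : tuple) := Phibar ((v + f (u + s *: vec z)) / s) - Phibar x + phi x * (d z / s).
have U1 : 1 <= 1 + `|u| by rewrite lerDl.
have gb (z : tuple) : `|g z| <= (K1 + D0 ^+ 2) * (1 + `|u|) ^+ 4 / r ^+ 8 * (1 + `|vec z|) ^+ 12.
  have z0 := normr_ge0 (vec z).
  have gE : g z = (Phibar ((v + f (u + s *: vec z)) / s) - Phibar ((v + q (u + s *: vec z)) / s)) +
      (Phibar (x + d z / s) - Phibar x + phi x * (d z / s)) by rewrite xE /g; ring.
  rewrite gE; apply: (le_trans (ler_normD _ _)).
  apply: (le_trans (lerD (nq_Phibar v (u + s *: vec z) C1 s0 r0 nq) (Phibar_taylor _ _))).
  have -> : (K1 + D0 ^+ 2) * (1 + `|u|) ^+ 4 / r ^+ 8 * (1 + `|vec z|) ^+ 12 =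
      K1 * (1 + `|u|) ^+ 4 / r ^+ 8 * (1 + `|vec z|) ^+ 12 +
      D0 ^+ 2 * (1 + `|u|) ^+ 4 / r ^+ 8 * (1 + `|vec z|) ^+ 12 by ring.
  apply: lerD.
    rewrite [leRHS]mulrAC ler_wpM2r ?invr_ge0 ?(ltW r8)//.
    apply: (@le_trans _ _ ((C / s + C ^+ 2) * ((1 + `|u|) ^+ 3 * (1 + s) ^+ 3 * (1 + `|vec z|) ^+ 3))).
      rewrite ler_wpM2l ?addr_ge0 ?divr_ge0 ?exprn_ge0// -!exprMn.
      rewrite ler_pXn2r ?nnegrE ?addr_ge0 ?mulr_ge0 ?addr_ge0//.
      by have := @affine_norm_le R m u (vec z) s; rewrite (ger0_norm s0').
    have -> : (C / s + C ^+ 2) * ((1 + `|u|) ^+ 3 * (1 + s) ^+ 3 * (1 + `|vec z|) ^+ 3) =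
      K1 * ((1 + `|u|) ^+ 3 * (1 + `|vec z|) ^+ 3) by rewrite /K1; ring.
    rewrite -[leRHS]mulrA ler_wpM2l// ler_pM ?exprn_ge0 ?addr_ge0//; last exact: pow_le12.
    by rewrite ler_weXn2l.
  have dz : `|d z / s| <= D0 * (1 + `|u|) ^+ 2 * (1 + `|vec z|) ^+ 2 / r ^+ 4.
    rewrite normrM normfV (gtr0_norm s0) ler_pdivrMr//.
    apply: (le_trans (nq_centered_le u (vec z) C0 r0 s0' nq)).
    rewrite le_eqVlt; apply/orP; left; apply/eqP; rewrite /D0.
    by field; rewrite !gt_eqF.
  rewrite -real_normK ?num_real//.
  apply: (@le_trans _ _ ((D0 * (1 + `|u|) ^+ 2 * (1 + `|vec z|) ^+ 2 / r ^+ 4) ^+ 2)).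
    rewrite ler_pXn2r ?nnegrE//.
    rewrite divr_ge0 ?exprn_ge0 ?(ltW r0)// mulr_ge0 ?exprn_ge0 ?addr_ge0//.
    by rewrite mulr_ge0 ?exprn_ge0 ?addr_ge0.
  have -> : (D0 * (1 + `|u|) ^+ 2 * (1 + `|vec z|) ^+ 2 / r ^+ 4) ^+ 2 =
      D0 ^+ 2 * (1 + `|u|) ^+ 4 * (1 + `|vec z|) ^+ 4 / r ^+ 8 by field; rewrite gt_eqF.
  rewrite [leRHS]mulrAC ler_wpM2r ?invr_ge0 ?(ltW r8)//.
  apply: ler_wpM2l; last exact: pow_le12.
  by rewrite mulr_ge0 ?exprn_ge0 ?addr_ge0.
have icst (c : R) : PZ.-integrable setT (EFin \o (fun _ : tuple => c)).
  apply: (integrable_dominated (K := `|c|)) => [|z]; first exact: measurable_cst.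
  by rewrite ler_peMr// exprn_ege1// lerDl.
have id : PZ.-integrable setT (EFin \o d).
  have iq := nq_integrable u s r0 C0 nq.
  have -> : EFin \o d = ((EFin \o (fun z : tuple => (q (u + s *: vec z))%R)) \-
      (EFin \o (fun _ : tuple => (q u + s ^+ 2 * k)%R)))%E.
    by apply/funext => z /=; rewrite -EFinB /d opprD addrA.
  exact: integrableB.
have mg : measurable_fun setT g.
  apply: measurable_funD.
    by apply: measurable_funB => //; exact: measurable_tail_integrand (nq_cont nq).
  by apply: measurable_funM => //; apply: measurable_funM.
have Eg : \int[PZ]_z g z = tail_mean f v u s - Phibar x.
  have iA : PZ.-integrable setT (EFin \o (fun z => Phibar ((v + f (u + s *: vec z)) / s))).
    exact: integrable_tail_integrand (nq_cont nq).
  have iB : PZ.-integrable setT (EFin \o (fun z => Phibar ((v + f (u + s *: vec z)) / s) - Phibar x)).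
    exact: (integrableB measurableT iA (icst (Phibar x))).
  have iC : PZ.-integrable setT (EFin \o (fun z => (phi x / s) * d z)).
    exact: (integrableZl measurableT (phi x / s) id).
  transitivity (\int[PZ]_z ((Phibar ((v + f (u + s *: vec z)) / s) - Phibar x) + (phi x / s) * d z)).
    by apply: eq_Rintegral => z _; rewrite /g mulrA mulrAC.
  rewrite RintegralD// RintegralB// expectation_cst RintegralZl//.
  by rewrite (nq_centered_mean s u C0 r0 nq) mulr0 addr0.
rewrite -Eg; apply: (le_trans (expectation_le mg gb)).
rewrite mulrAC ler_wpM2r ?invr_ge0 ?(ltW r8)// mulrAC ler_wpM2r ?exprn_ge0 ?addr_ge0//.
by rewrite lerDr.
Qed.

(** Up to the radius r^2 = n^(1/4) the polynomial stays bounded, since (1 + |u|)^2 <= 4 r^4. *)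
Lemma nq_bound_ball C r f q k u : 0 <= C -> 1 <= r -> `|u| <= r ^+ 2 ->
  near_quadratic C r f q k -> `|q u| <= 5 * C.
Proof.
move=> C0 r1 ur nq; have r0 : 0 < r by apply: lt_le_trans r1.
apply: (le_trans (nq_bound nq u)); rewrite mulrC ler_wpM2r//.
have r4 : 0 < r ^+ 4 by rewrite exprn_gt0.
rewrite -lerBrDl ler_pdivrMr//.
have -> : (5 - 1) * r ^+ 4 = (2 * r ^+ 2) ^+ 2 by rewrite exprMn -exprM; ring.
have r2 : 1 <= r ^+ 2 by rewrite exprn_ege1.
rewrite ler_pXn2r ?nnegrE ?addr_ge0 ?mulr_ge0 ?exprn_ge0 ?(ltW r0)//; lra.
Qed.

Lemma nq_k_le C r f q k : 0 <= C -> 1 <= r -> near_quadratic C r f q k -> `|k| <= C.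
Proof.
move=> C0 r1 nq; apply: (le_trans (nq_k nq)); have r0 : 0 < r by apply: lt_le_trans r1.
by rewrite ler_pdivrMr ?exprn_gt0// ler_peMr// exprn_ege1.
Qed.

Lemma ler_self_sqr (r : R) : 1 <= r -> r <= r ^+ 2.
Proof. by move=> r1; rewrite expr2 ler_peMr// (le_trans ler01). Qed.

(** Bounded v keeps the argument of [Phibar] in a compact set [-X, X], and |u| <= r makes the error
    of the tail mean at most 16 K1 / r^4, hence admissible in [Phibar_inv_near] for large r. *)
Lemma psi_approx C s M : 1 <= C -> 0 < s -> 0 <= M -> exists2 K, 1 <= K &
  forall r f q k u v, K <= r -> near_quadratic C r f q k -> `|u| <= r -> `|v| <= M ->
  `|s * Phibar_inv (tail_mean f v u s) - (v + q u + s ^+ 2 * k)| <= K * (1 + `|u|) ^+ 4 / r ^+ 8.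
Proof.
move=> C1 s0 M0; have C0 : 0 <= C by apply: le_trans C1.
have [K1 K11 hK1] := tail_mean_approx C1 s0.
have K10 : 0 <= K1 by apply: le_trans K11.
pose X := (M + 5 * C + s ^+ 2 * C) / s.
have p0 := phi_gt0 (X + 1).
pose K := 1 + 16 * K1 / phi (X + 1) + s * K1 / phi (X + 1).
have e1 : 0 <= 16 * K1 / phi (X + 1) by rewrite divr_ge0 ?mulr_ge0// ltW.
have e2 : 0 <= s * K1 / phi (X + 1) by rewrite divr_ge0 ?mulr_ge0// ltW.
exists K; first by rewrite /K -addrA lerDl addr_ge0.
move=> r f q k u v Kr nq ur vM.
have r1 : 1 <= r by apply: le_trans Kr; rewrite /K -addrA lerDl addr_ge0.
have r0 : 0 < r by apply: lt_le_trans r1.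
have r8 : 0 < r ^+ 8 by rewrite exprn_gt0.
set x := (v + q u + s ^+ 2 * k) / s.
have xX : `|x| <= X.
  rewrite /x /X normrM normfV (gtr0_norm s0) ler_wpM2r ?invr_ge0 ?(ltW s0)//.
  apply: (le_trans (ler_normD _ _)); apply: lerD.
    apply: (le_trans (ler_normD _ _)); apply: lerD => //.
    by apply: (nq_bound_ball C0 r1 _ nq); apply: (le_trans ur); exact: ler_self_sqr.
  rewrite normrM (ger0_norm (sqr_ge0 s)) ler_wpM2l ?sqr_ge0//.
  exact: nq_k_le nq.
have h := hK1 r f q k u v r1 nq; rewrite -/x in h.
set eta := K1 * (1 + `|u|) ^+ 4 / r ^+ 8 in h.
have etap : eta <= phi (X + 1).
  rewrite /eta ler_pdivrMr//.
  have : 16 * K1 <= phi (X + 1) * r.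
    rewrite [leRHS]mulrC -ler_pdivrMr//; apply: le_trans Kr.
    by rewrite /K; lra.
  have : (1 + `|u|) ^+ 4 <= 16 * r ^+ 4.
    have -> : 16 * r ^+ 4 = (2 * r) ^+ 4 by rewrite exprMn; ring.
    rewrite ler_pXn2r ?nnegrE ?addr_ge0 ?mulr_ge0 ?(ltW r0)//; lra.
  move=> h1 h2; apply: (le_trans (ler_wpM2l K10 h1)).
  have -> : K1 * (16 * r ^+ 4) = 16 * K1 * r ^+ 4 by ring.
  apply: (le_trans (ler_wpM2r (exprn_ge0 4 (ltW r0)) h2)).
  rewrite -mulrA ler_wpM2l ?(ltW p0)// -exprS ler_weXn2l//.
have := Phibar_inv_near xX etap h => /(ler_wpM2l (ltW s0)).
rewrite -{1}(ger0_norm (ltW s0)) -normrM mulrBr.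
have -> : s * x = v + q u + s ^+ 2 * k by rewrite /x mulrC divfK// gt_eqF.
move=> /le_trans; apply; rewrite /eta.
have -> : s * (K1 * (1 + `|u|) ^+ 4 / r ^+ 8 / phi (X + 1)) =
  s * K1 / phi (X + 1) * (1 + `|u|) ^+ 4 / r ^+ 8 by ring.
rewrite ler_wpM2r ?invr_ge0 ?(ltW r8)// ler_wpM2r ?exprn_ge0 ?addr_ge0//.
by rewrite /K; lra.
Qed.

(** The mass outside radius r^2 / (2 s) has an exponent of order r^4, the density at distance of
    order r only one of order r^2. So the mass is negligible even against the slope of [Phibar] out
    there. *)
Lemma tail_prob_small s B : 0 < s -> 0 <= B -> exists2 K, 1 <= K &
  forall r, K <= r ->
  m%:R * (2 * expR (- ((r ^+ 2 / (2 * s)) ^+ 2 / 4))) <= phi ((r + B) / s + 2).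
Proof.
move=> s0 B0; have p0 : 0 < normal_peak 1 :> R by rewrite normal_peak_gt0// oner_neq0.
pose c := 2 * m%:R / normal_peak 1 : R.
have c0 : 0 <= c by rewrite divr_ge0 ?mulr_ge0// ltW.
pose K := 6 + B + 2 * s + 16 * s ^+ 2 * c.
have sc : 0 <= 16 * s ^+ 2 * c by rewrite mulr_ge0// mulr_ge0// sqr_ge0.
exists K; first by rewrite /K; lra.
move=> r Kr; rewrite phiE.
set a := (r ^+ 2 / (2 * s)) ^+ 2 / 4; set b := ((r + B) / s + 2) ^+ 2 / 2.
have r6 : 6 <= r by move: Kr; rewrite /K; lra.
have rB : B + 2 * s <= r by move: Kr; rewrite /K; lra.
have rc : 16 * s ^+ 2 * c <= r by move: Kr; rewrite /K; lra.
have ab : c <= a - b.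
  have aE : a = r ^+ 4 / (16 * s ^+ 2) by rewrite /a; field; rewrite gt_eqF.
  have bE : b = (r + B + 2 * s) ^+ 2 * 8 / (16 * s ^+ 2) by rewrite /b; field; rewrite gt_eqF.
  rewrite aE bE -mulrBl ler_pdivlMr ?mulr_gt0 ?exprn_gt0// mulrC.
  apply: (le_trans rc).
  have h1 : (r + B + 2 * s) ^+ 2 <= (2 * r) ^+ 2.
    by rewrite ler_pXn2r ?nnegrE ?addr_ge0 ?mulr_ge0 ?(ltW s0)//; lra.
  have h2 : 36 * r ^+ 2 <= r ^+ 4.
    have -> : r ^+ 4 = r ^+ 2 * r ^+ 2 by ring.
    by rewrite ler_wpM2r ?sqr_ge0// expr2; nra.
  have h3 : r <= r ^+ 2 by apply: ler_self_sqr; lra.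
  by move: h1; rewrite exprMn; nra.
have e1 : c <= expR (a - b) by apply: (le_trans ab); apply: (le_trans _ (expR_ge1Dx _)); rewrite lerDr.
have -> : expR (- b) = expR (- a) * expR (a - b) by rewrite -expRD; congr expR; ring.
have -> : m%:R * (2 * expR (- a)) = expR (- a) * (c * normal_peak 1).
  by rewrite /c divfK ?gt_eqF//; ring.
rewrite [leRHS]mulrCA ler_wpM2l ?expR_ge0// [leRHS]mulrC ler_wpM2r// ltW//.
Qed.

(** Outside the ball of radius t the integrand still lies in [0, 1], which costs at most the tail
    mass. *)
Lemma tail_mean_between f u v s B t : continuous f -> 0 < s -> 0 < t -> 0 <= B ->
  (forall x : 'rV[R]_m, `|x| < t -> `|f (u + s *: x)| <= B) ->
  Phibar ((v + B) / s) - m%:R * (2 * expR (- (t ^+ 2 / 4))) <= tail_mean f v u s <=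
  Phibar ((v - B) / s) + m%:R * (2 * expR (- (t ^+ 2 / 4))).
Proof.
move=> cf s0 t0 B0 fB.
pose A := [set z : tuple | t <= `|vec z|].
have mA : measurable A by exact: measurable_norm_ge.
have i1 : PZ.-integrable setT (EFin \o (\1_A : tuple -> R)).
  apply: integrable_unit => [|z]; first exact: measurable_indic.
  by rewrite indicE; case: (_ \in _); rewrite /= ?ler01 ?lexx.
have EA : \int[PZ]_z \1_A z <= m%:R * (2 * expR (- (t ^+ 2 / 4))) :> R.
  rewrite -lee_fin /Rintegral fineK; last exact: integrable_fin_num.
  by rewrite integral_indic// setIT; exact: normal_tuple_tail.
have ig := integrable_tail_integrand v u s cf.
have icst (c : R) : PZ.-integrable setT (EFin \o (fun _ : tuple => c)).
  apply: (integrable_dominated (K := `|c|)) => [|z]; first exact: measurable_cst.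
  by rewrite ler_peMr// exprn_ege1// lerDl.
have sv0 : 0 <= s^-1 by rewrite invr_ge0 ltW.
have b1 z : Phibar ((v + f (u + s *: vec z)) / s) <= Phibar ((v - B) / s) + \1_A z.
  rewrite indicE; case: (boolP (z \in A)) => zA /=.
    by rewrite (le_trans (Phibar_le1 _))// lerDr Phibar_ge0.
  rewrite addr0; apply: Phibar_antitone; rewrite ler_wpM2r// lerD2l.
  have : `|vec z| < t by move: zA; rewrite notin_setE /A/= => /negP; rewrite -ltNge.
  by move/fB; rewrite ler_norml => /andP[].
have b2 z : Phibar ((v + B) / s) - \1_A z <= Phibar ((v + f (u + s *: vec z)) / s).
  rewrite indicE; case: (boolP (z \in A)) => zA /=.
    by rewrite (le_trans _ (Phibar_ge0 _))// subr_le0 Phibar_le1.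
  rewrite subr0; apply: Phibar_antitone; rewrite ler_wpM2r// lerD2l.
  have : `|vec z| < t by move: zA; rewrite notin_setE /A/= => /negP; rewrite -ltNge.
  by move/fB; rewrite ler_norml => /andP[].
apply/andP; split.
  apply: (@le_trans _ _ (\int[PZ]_z (Phibar ((v + B) / s) - \1_A z))).
    by rewrite RintegralB// expectation_cst lerD2l lerN2.
  apply: le_Rintegral => //; exact: (integrableB measurableT (icst _) i1).
apply: (@le_trans _ _ (\int[PZ]_z (Phibar ((v - B) / s) + \1_A z))).
  apply: le_Rintegral => //; exact: (integrableD measurableT (icst _) i1).
by rewrite RintegralD// expectation_cst lerD2l.
Qed.

(** For v of size up to r the inverse of [Phibar] has no uniform Lipschitz constant. The tail mean
    is instead trapped between values of [Phibar], a unit step of the argument outweighing the tail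
    mass. *)
Lemma psi_crude C s : 1 <= C -> 0 < s -> exists2 K, 1 <= K &
  forall r f q k u v, K <= r -> near_quadratic C r f q k -> `|u| <= r -> `|v| <= r ->
  `|s * Phibar_inv (tail_mean f v u s) - v| <= K.
Proof.
move=> C1 s0; have C0 : 0 <= C by apply: le_trans C1.
(* On the ball of radius r^2, |q| <= 5 C and |f - q| <= C. *)
pose B := 6 * C; have B0 : 0 <= B by rewrite mulr_ge0.
have [K1 K11 hK1] := tail_prob_small s0 B0.
pose K := K1 + 2 + C + B + s.
exists K; first by rewrite /K; lra.
move=> r f q k u v Kr nq ur vr.
have r2 : 2 <= r by move: Kr; rewrite /K; lra.
have r1 : 1 <= r by lra.
have r0 : 0 < r by lra.
have rC : C <= r by move: Kr; rewrite /K; lra.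
have rK1 : K1 <= r by move: Kr; rewrite /K; lra.
pose t := r ^+ 2 / (2 * s).
have t0 : 0 < t by rewrite divr_gt0 ?exprn_gt0 ?mulr_gt0.
have fB (x : 'rV[R]_m) : `|x| < t -> `|f (u + s *: x)| <= B.
  move=> xt; set w := u + s *: x.
  have wr : `|w| <= r ^+ 2.
    apply: (le_trans (ler_normD _ _)).
    have -> : `|s *: x| = s * `|x| by rewrite mx_normZ gtr0_norm.
    have : s * `|x| <= r ^+ 2 / 2.
      rewrite mulrC -ler_pdivlMr//; apply: (le_trans (ltW xt)).
      by rewrite /t invfM mulrA.
    by rewrite expr2; nra.
  have w0 := normr_ge0 w.
  have Cw : C * `|w| <= r ^+ 4.
    have -> : r ^+ 4 = r ^+ 2 * r ^+ 2 by ring.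
    rewrite ler_pM//; apply: (le_trans rC); exact: ler_self_sqr.
  have -> : f w = q w + (f w - q w) by ring.
  apply: (le_trans (ler_normD _ _)).
  apply: (le_trans (lerD (nq_bound_ball C0 r1 wr nq) (nq_near nq Cw))).
  have -> : B = 5 * C + C by rewrite /B; ring.
  rewrite lerD2l ler_pdivrMr ?exprn_gt0// ler_wpM2l//.
  apply: (@le_trans _ _ ((r ^+ 2) ^+ 3)).
    by rewrite ler_pXn2r ?nnegrE ?exprn_ge0 ?(ltW r0).
  by rewrite -exprM ler_weXn2l.
have /andP[lo hi] := tail_mean_between v (nq_cont nq) s0 t0 B0 fB.
have tau := hK1 r rK1; rewrite -/t in tau.
set T := m%:R * _ in lo hi tau.
have sv : s * (v / s) = v by rewrite mulrC divfK// gt_eqF.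
have bd (y : R) : `|y| <= (r + B) / s + 1 -> T <= Phibar y - Phibar (y + 1) /\ T <= Phibar (y - 1) - Phibar y.
  move=> yb; have Y0 : 0 <= (r + B) / s by rewrite divr_ge0 ?addr_ge0// ltW.
  move: yb; rewrite ler_norml => /andP[ya yb].
  split; apply: (le_trans tau).
    have := @Phibar_sub_ge R ((r + B) / s + 2) y (y + 1).
    have -> : y + 1 - y = 1 by ring.
    by rewrite mulr1; apply; rewrite ?lerDl// ler_norml; lra.
  have := @Phibar_sub_ge R ((r + B) / s + 2) (y - 1) y.
  have -> : y - (y - 1) = 1 by ring.
  by rewrite mulr1; apply; rewrite ?gerBl// ler_norml; lra.
have sv0 : 0 <= s^-1 by rewrite invr_ge0 ltW.
have nb (e : R) : `|e| <= B -> `|(v + e) / s| <= (r + B) / s + 1.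
  move=> eB; rewrite normrM normfV (gtr0_norm s0); apply: (@le_trans _ _ ((r + B) / s)); last by rewrite lerDl.
  by rewrite ler_wpM2r// (le_trans (ler_normD _ _))// lerD.
have BB : `|B| <= B by rewrite ger0_norm.
have BN : `|- B| <= B by rewrite normrN ger0_norm.
have [h1 _] := bd _ (nb _ BB); have [_ h2] := bd _ (nb _ BN).
have /Phibar_inv_between : Phibar ((v + B) / s + 1) <= tail_mean f v u s <= Phibar ((v - B) / s - 1) by lra.
set y := Phibar_inv _ => /andP[y1 y2].
have z1 := ler_wpM2l (ltW s0) y1; have z2 := ler_wpM2l (ltW s0) y2.
have E1 : s * ((v - B) / s - 1) = v - B - s by field; rewrite gt_eqF.
have E2 : s * ((v + B) / s + 1) = v + B + s by field; rewrite gt_eqF.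
rewrite E1 in z1; rewrite E2 in z2; rewrite ler_norml /K; lra.
Qed.

End psi_expansion.

(** * Extrapolation by linear regression *)

Section least_squares_weights.
Context {R : realType} {K : nat}.
Implicit Types (t x : 'I_K -> R).

(** Regression is linear in the data and reproduces affine functions; the first two identities on
    the weights express the latter. *)
Lemma extrapolate_weights t (t0 : R) : (1 < K)%N -> injective t ->
  exists w : 'I_K -> R, [/\ \sum_i w i = 1, \sum_i w i * t i = t0 &
    forall x, extrapolate t x t0 = \sum_i w i * x i].
Proof.
move=> K1 tI.
have n0 : K%:R != 0 :> R by rewrite pnatr_eq0 -lt0n ltnW.
have sum1 (c : R) : \sum_(i < K) c = c * K%:R by rewrite sumr_const card_ord mulr_natr.
pose tb := (\sum_i t i) / K%:R.
have dt0 : \sum_i (t i - tb) = 0 by rewrite sumrB sum1 /tb divfK// subrr.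
pose S := \sum_i (t i - tb) ^+ 2.
have SE : \sum_i (t i - tb) * t i = S.
  transitivity (S + tb * \sum_i (t i - tb)); last by rewrite dt0 mulr0 addr0.
  by rewrite mulr_sumr -big_split/=; apply: eq_bigr => i _; ring.
have S0 : S != 0.
  apply/negP => /eqP S0.
  have tE i : t i = tb.
    have /eqP := @psumr_eq0P _ _ xpredT (fun i => (t i - tb) ^+ 2) (fun i _ => sqr_ge0 _) S0 i isT.
    by rewrite sqrf_eq0 subr_eq0 => /eqP.
  have /tI/(congr1 val)// : t (Ordinal (ltnW K1)) = t (Ordinal K1) by rewrite !tE.
pose slope x := (\sum_i (t i - tb) * x i) / S.
pose b x : R * R := ((\sum_i x i) / K%:R - slope x * tb, slope x).
have bE x : least_squares t x = b x.
  pose e i := x i - ((b x).1 + (b x).2 * t i).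
  have e0 : \sum_i e i = 0.
    rewrite (eq_bigr (fun i => x i - (\sum_i x i) / K%:R - slope x * (t i - tb))); last first.
      by move=> i _; rewrite /e /b/=; ring.
    by rewrite sumrB -mulr_sumr dt0 mulr0 subr0 sumrB sum1 divfK// subrr.
  have et0 : \sum_i e i * t i = 0.
    have -> : \sum_i e i * t i = \sum_i (t i - tb) * e i.
      transitivity (\sum_i (t i - tb) * e i + tb * \sum_i e i); last by rewrite e0 mulr0 addr0.
      by rewrite mulr_sumr -big_split/=; apply: eq_bigr => i _; ring.
    rewrite (eq_bigr (fun i => (t i - tb) * x i - ((b x).1 * (t i - tb) + slope x * ((t i - tb) * t i)))); last first.
      by move=> i _; rewrite /e /b/=; ring.
    rewrite sumrB big_split/= -!mulr_sumr dt0 mulr0 add0r SE /slope divfK// subrr//.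
  (* Pythagoras: the residuals are orthogonal to the constants and to [t]. *)
  have min b' : rss t x (b x) <= rss t x b'.
    pose g i := ((b x).1 - b'.1) + ((b x).2 - b'.2) * t i.
    have eg : \sum_i e i * g i = 0.
      rewrite (eq_bigr (fun i => ((b x).1 - b'.1) * e i + ((b x).2 - b'.2) * (e i * t i))).
        by rewrite big_split/= -!mulr_sumr e0 et0 !mulr0 addr0.
      by move=> i _; rewrite /g; ring.
    have -> : rss t x b' = rss t x (b x) + (2 * \sum_i e i * g i + \sum_i g i ^+ 2).
      rewrite /rss mulr_sumr -!big_split; apply: eq_bigr => i _; rewrite /e /g /=; ring.
    by rewrite eg mulr0 add0r lerDl sumr_ge0// => i _; exact: sqr_ge0.
  have [b0 [b0min b0uniq]] := least_squares_unique x K1 tI.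
  (* A minimiser exists, so [get] returns one; uniqueness then identifies it with [b x]. *)
  have lsmin : forall b', rss t x (least_squares t x) <= rss t x b'.
    exact: (@getPex _ [set b | forall b', rss t x b <= rss t x b'] (ex_intro _ _ min)).
  by rewrite -(b0uniq _ lsmin) (b0uniq _ min).
exists (fun i => K%:R^-1 + (t i - tb) * (t0 - tb) / S); split.
- rewrite big_split/= sum1 mulVf//.
  by rewrite -mulr_suml -mulr_suml dt0 !mul0r addr0.
- rewrite (eq_bigr (fun i => K%:R^-1 * t i + (t0 - tb) / S * ((t i - tb) * t i))); last first.
    by move=> i _; ring.
  by rewrite big_split/= -!mulr_sumr SE divfK// mulrC -/tb addrC subrK.
- move=> x; rewrite /extrapolate bE /b/= /slope.
  rewrite [RHS](eq_bigr (fun i => K%:R^-1 * x i + (t0 - tb) / S * ((t i - tb) * x i))); last first.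
    by move=> i _; ring.
  by rewrite big_split/= -!mulr_sumr; ring.
Qed.

(** Affine data being reproduced, only the deviation is amplified, by the sum of the absolute
    weights. *)
Lemma extrapolate_approx t (t0 : R) : (1 < K)%N -> injective t ->
  exists2 L : R, 0 <= L & forall x (a b e : R), (forall i, `|x i - (a + b * t i)| <= e) ->
  `|extrapolate t x t0 - (a + b * t0)| <= L * e.
Proof.
move=> K1 tI; have [w [w1 wt wE]] := extrapolate_weights t0 K1 tI.
exists (\sum_i `|w i|) => [|x a b e xe]; first exact: sumr_ge0.
have -> : extrapolate t x t0 - (a + b * t0) = \sum_i w i * (x i - (a + b * t i)).
  have -> : a + b * t0 = \sum_i w i * (a + b * t i).
    rewrite (eq_bigr (fun i => a * w i + b * (w i * t i))); last by move=> i _; ring.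
    by rewrite big_split/= -!mulr_sumr w1 wt mulr1.
  by rewrite wE -sumrB; apply: eq_bigr => i _; rewrite mulrBr.
rewrite mulr_suml; apply: (le_trans (ler_norm_sum _ _ _)).
by apply: ler_sum => i _; rewrite normrM ler_wpM2l.
Qed.

Lemma measurable_extrapolate d (T : measurableType d) t (t0 : R) (x : 'I_K -> T -> R) :
  (1 < K)%N -> injective t -> (forall i, measurable_fun setT (x i)) ->
  measurable_fun setT (fun y => extrapolate t (x ^~ y) t0).
Proof.
move=> K1 tI mx; have [w [_ _ wE]] := extrapolate_weights t0 K1 tI.
rewrite (_ : (fun _ => _) = (fun y => \sum_i w i * x i y)); last first.
  by apply/funext => y; rewrite wE.
by apply: measurable_sum => i; apply: measurable_funM.
Qed.

End least_squares_weights.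

(** * Extrapolated values of psi *)

Section extrapolated_psi.
Context {R : realType} {m K : nat}.
Variables (t : 'I_K -> R) (t0 : R).
Hypotheses (K_gt1 : (1 < K)%N) (t_inj : injective t) (t_gt0 : forall i, 0 < t i).
Implicit Types (f q : 'rV[R]_m -> R) (u : 'rV[R]_m) (v k r C : R).

(** Expressed through [tail_mean] so that a region and, with - f and - v, its complement are treated
    alike. *)
Definition psi_line f u v : R :=
  extrapolate t (fun i => Num.sqrt (t i) * Phibar_inv (tail_mean f v u (Num.sqrt (t i)))) t0.

Lemma psi_extrapolated_region f u v : continuous f ->
  psi_extrapolated t t0 (region f) (u, v) = psi_line f u v.
Proof.
move=> cf; apply: (congr1 (fun x => extrapolate t x t0)); apply/funext => i.
by rewrite /psi (bootstrap_region u v (t_gt0 i) cf).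
Qed.

Lemma psi_extrapolated_setC f u v : continuous f ->
  psi_extrapolated t t0 (~` region f) (u, v) = psi_line (fun w => - f w) u (- v).
Proof.
move=> cf; apply: (congr1 (fun x => extrapolate t x t0)); apply/funext => i.
by rewrite /psi (bootstrap_setC_region u v (t_gt0 i) cf).
Qed.

Lemma measurable_psi_line f : continuous f ->
  measurable_fun setT (fun y : m.-tuple (measurableTypeR R) * measurableTypeR R =>
    psi_line f (vec y.1) y.2).
Proof.
move=> cf; apply: (@measurable_extrapolate R K _ _ t t0
  (fun i (y : m.-tuple (measurableTypeR R) * measurableTypeR R) =>
   Num.sqrt (t i) * Phibar_inv (tail_mean f y.2 (vec y.1) (Num.sqrt (t i))))) => // i.
apply: measurable_funM => //.
apply: (measurable_Phibar_inv (f := fun y : m.-tuple (measurableTypeR R) * measurableTypeR R =>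
  tail_mean f y.2 (vec y.1) (Num.sqrt (t i)))).
  by move=> y; exact: tail_mean01.
exact: measurable_tail_mean.
Qed.

Lemma psi_line_approx C M : 1 <= C -> 0 <= M -> exists2 L, 1 <= L &
  forall r f q k u v, L <= r -> near_quadratic C r f q k -> `|u| <= r -> `|v| <= M ->
  `|psi_line f u v - (v + q u + t0 * k)| <= L * (1 + `|u|) ^+ 4 / r ^+ 8.
Proof.
move=> C1 M0; have [L L0 hL] := extrapolate_approx t0 K_gt1 t_inj.
have st i : 0 < Num.sqrt (t i) by rewrite sqrtr_gt0.
have /choice[k_ hk] : forall i, exists L, 1 <= L /\
  forall r f q k u v, L <= r -> near_quadratic C r f q k -> `|u| <= r -> `|v| <= M ->
  `|Num.sqrt (t i) * Phibar_inv (tail_mean f v u (Num.sqrt (t i))) - (v + q u + t i * k)|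
     <= L * (1 + `|u|) ^+ 4 / r ^+ 8.
  move=> i; have [k_ k1 h] := @psi_approx R m C _ M C1 (st i) M0; exists k_; split=> // r f q k u v.
  by have := h r f q k u v; rewrite sqr_sqrtr// ltW.
pose Ks := \sum_i `|k_ i|.
have Ks0 : 0 <= Ks by apply: sumr_ge0.
exists (1 + Ks + L * Ks); first by rewrite -addrA lerDl addr_ge0 ?mulr_ge0.
move=> r f q k u v Lr nq ur vM.
have LK := mulr_ge0 L0 Ks0.
have r0 : 0 < r by lra.
have W0 : 0 <= (1 + `|u|) ^+ 4 / r ^+ 8.
  by rewrite divr_ge0 ?exprn_ge0 ?addr_ge0// ltW.
have := hL (fun i => Num.sqrt (t i) * Phibar_inv (tail_mean f v u (Num.sqrt (t i))))
  (v + q u) k (Ks * ((1 + `|u|) ^+ 4 / r ^+ 8)).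
rewrite [k * t0]mulrC => /(_ _)/le_trans; apply.
  move=> i; have kK : k_ i <= Ks by exact: bound_sum.
  have [_ h] := hk i; rewrite [k * _]mulrC; apply: (le_trans (h r f q k u v _ nq ur vM)).
    by lra.
  by rewrite -mulrA ler_wpM2r.
rewrite -[leRHS]mulrA [leLHS]mulrA; apply: ler_wpM2r => //; lra.
Qed.

Lemma psi_line_crude C : 1 <= C -> exists2 L, 1 <= L &
  forall r f q k u v, L <= r -> near_quadratic C r f q k -> `|u| <= r -> `|v| <= r ->
  `|psi_line f u v - v| <= L.
Proof.
move=> C1; have [L L0 hL] := extrapolate_approx t0 K_gt1 t_inj.
have st i : 0 < Num.sqrt (t i) by rewrite sqrtr_gt0.
have /choice[k_ hk] : forall i, exists L, 1 <= L /\
  forall r f q k u v, L <= r -> near_quadratic C r f q k -> `|u| <= r -> `|v| <= r ->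
  `|Num.sqrt (t i) * Phibar_inv (tail_mean f v u (Num.sqrt (t i))) - v| <= L.
  by move=> i; have [k_ k1 h] := @psi_crude R m C _ C1 (st i); exists k_.
pose Ks := \sum_i `|k_ i|.
have Ks0 : 0 <= Ks by apply: sumr_ge0.
exists (1 + Ks + L * Ks); first by rewrite -addrA lerDl addr_ge0 ?mulr_ge0.
move=> r f q k u v Lr nq ur vr.
have LK := mulr_ge0 L0 Ks0.
have := hL (fun i => Num.sqrt (t i) * Phibar_inv (tail_mean f v u (Num.sqrt (t i)))) v 0 Ks.
rewrite mul0r addr0 => /(_ _)/le_trans; apply; last by lra.
move=> i; have kK : k_ i <= Ks by exact: bound_sum.
have [_ h] := hk i; rewrite mul0r addr0; apply: (le_trans (h r f q k u v _ nq ur vr)) => //.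
by lra.
Qed.

End extrapolated_psi.

(** * The rejection region *)

Section critical_value.
Context {R : realType}.
Variable (alpha : R).
Hypotheses (alpha_gt0 : 0 < alpha) (alpha_lt1 : alpha < 1).
Implicit Types (B G H : R).
Local Notation N := (normal_prob (0 : R) 1).
Local Notation phi := (normal_pdf (0 : R) 1).

(* The value of [psi_{-1}(H|y)] at which the p-value equals [alpha], when
   [psi_{-1}(H|y) + psi_0(S|y)] equals [G]. *)
Definition critical G : R := Phibar_inv (alpha * Phibar G).

Lemma alpha_Phibar01 G : 0 < alpha * Phibar G < 1.
Proof.
rewrite mulr_gt0 ?Phibar_gt0//= -[ltRHS]mulr1.
by rewrite ltr_pM ?ltW ?Phibar_gt0// Phibar_lt1.
Qed.

Lemma Phibar_critical G : Phibar (critical G) = alpha * Phibar G.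
Proof. by rewrite /critical Phibar_invK// alpha_Phibar01. Qed.

(** [critical] is increasing, so its values at the ends of [-B, B] enclose the others. *)
Lemma critical_bound B : exists2 B', 0 <= B' & forall G, `|G| <= B -> `|critical G| <= B'.
Proof.
exists (`|critical B| + `|critical (- B)|); first by rewrite addr_ge0.
move=> G; rewrite ler_norml => /andP[G1 G2].
have /Phibar_inv_between/andP[] : Phibar (critical B) <= alpha * Phibar G <= Phibar (critical (- B)).
  by rewrite !Phibar_critical !ler_wpM2l ?Phibar_antitone// ltW.
rewrite -/(critical G) ler_norml => h1 h2.
have := ler_norm (critical B); have := ler_norm (- critical (- B)).
have := normr_ge0 (critical B); have := normr_ge0 (critical (- B)).
have := ler_norm (critical (- B)); have := ler_norm (- critical B).
rewrite !normrN; lra.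
Qed.

(** Close arguments are handled by [Phibar_inv_near]; for arguments further apart than phi(B' + 1),
    the bound 2 B' on the difference is enough. The two cases give the two terms of the constant. *)
Lemma critical_lipschitz B : exists2 L, 0 <= L &
  forall G H, `|G| <= B -> `|H| <= B -> `|critical G - critical H| <= L * `|G - H|.
Proof.
have [B' B'0 hB] := critical_bound B.
have p0 := phi_gt0 (B' + 1).
exists ((1 + 2 * B') / phi (B' + 1)); first by rewrite divr_ge0 ?addr_ge0 ?mulr_ge0// ltW.
move=> G H GB HB; have hG := hB G GB; have hH := hB H HB.
have GH : `|alpha * Phibar G - Phibar (critical H)| <= `|G - H|.
  rewrite Phibar_critical -mulrBr normrM (gtr0_norm alpha_gt0) -[leRHS]mul1r.
  by apply: ler_pM => //; [exact: ltW|exact: ltW|exact: Phibar_lipschitz].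
have [small|big] := leP `|G - H| (phi (B' + 1)).
  apply: (le_trans (Phibar_inv_near hH small GH)).
  rewrite [leRHS]mulrAC ler_wpM2r ?invr_ge0 ?(ltW p0)// -[leLHS]mul1r ler_wpM2r//.
  lra.
apply: (@le_trans _ _ (2 * B')).
  by apply: (le_trans (ler_normB _ _)); lra.
rewrite mulrAC ler_pdivlMr//; apply: (@le_trans _ _ (2 * B' * `|G - H|)).
  by rewrite ler_wpM2l ?mulr_ge0// ltW.
by rewrite ler_wpM2r//; lra.
Qed.

Lemma measurable_critical d (T : measurableType d) (g : T -> R) :
  measurable_fun setT g -> measurable_fun setT (critical \o g).
Proof.
move=> mg; apply: (@measurable_Phibar_inv R _ _ (fun y => alpha * Phibar (g y))).
  by move=> y; exact: alpha_Phibar01.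
apply: measurable_funM; first exact: measurable_cst.
exact: (measurableT_comp measurable_Phibar mg).
Qed.

(** Here [a] and [d] stand for the arguments of [Phibar] in the p-value, [x] and [G] for their
    expansions. A shift by eta / phi(B' + 1) changes [Phibar] by at least eta, which absorbs the
    error of [d]; a further eta covers that of [a]. *)
Lemma decision B : exists2 L, 1 <= L & forall G a d x eta,
  `|G| <= B -> 0 <= eta -> L * eta <= 1 -> `|a - x| <= eta -> `|d - G| <= eta ->
  (critical G + L * eta < x -> Phibar a < alpha * Phibar d) /\
  (x < critical G - L * eta -> alpha * Phibar d <= Phibar a).
Proof.
have [B' B'0 hB] := critical_bound B.
have p0 := phi_gt0 (B' + 1); have pv0 : 0 < (phi (B' + 1))^-1 by rewrite invr_gt0.
exists (1 + (phi (B' + 1))^-1); first by rewrite lerDl ltW.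
move=> G a d x eta GB eta0 Leta ax dG; have cB := hB G GB.
set y := eta / phi (B' + 1).
have LE : (1 + (phi (B' + 1))^-1) * eta = eta + y by rewrite /y; ring.
have y0 : 0 <= y by rewrite divr_ge0// ltW.
have yE : phi (B' + 1) * y = eta by rewrite /y mulrC divfK// gt_eqF.
rewrite LE in Leta *.
have dP : `|alpha * Phibar d - Phibar (critical G)| <= eta.
  rewrite Phibar_critical -mulrBr normrM (gtr0_norm alpha_gt0) -[leRHS]mul1r.
  by rewrite ler_pM ?(ltW alpha_gt0) ?(ltW alpha_lt1)// (le_trans (Phibar_lipschitz _ _)).
have s1 := @Phibar_sub_ge R (B' + 1) (critical G) (critical G + y).
have s2 := @Phibar_sub_ge R (B' + 1) (critical G - y) (critical G).
have e1 : critical G + y - critical G = y by ring.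
have e2 : critical G - (critical G - y) = y by ring.
rewrite e1 yE in s1; rewrite e2 yE in s2.
move: cB dP ax; rewrite !ler_norml => /andP[c1 c2] /andP[d1 d2] /andP[a1 a2].
have {}s1 : eta <= Phibar (critical G) - Phibar (critical G + y).
  by apply: s1; rewrite ?lerDl// ler_norml; lra.
have {}s2 : eta <= Phibar (critical G - y) - Phibar (critical G).
  by apply: s2; rewrite ?gerBl// ler_norml; lra.
split=> xc.
  have : Phibar a < Phibar (critical G + y) by apply: Phibar_decr; lra.
  lra.
have : Phibar (critical G - y) <= Phibar a by apply: Phibar_antitone; lra.
lra.
Qed.

(** The sum a + b stays within K1 + K2, so the denominator is bounded below and large y rejects. For
    very negative y the numerator exceeds alpha, while the right side never does. *)
Lemma decision_far K1 K2 : exists2 M, 0 <= M & forall a b y,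
  `|a - y| <= K1 -> `|b - - y| <= K2 ->
  (M < y -> Phibar a < alpha * Phibar (a + b)) /\
  (y < - M -> alpha * Phibar (a + b) <= Phibar a).
Proof.
pose c1 := Phibar_inv (alpha * Phibar (K1 + K2)); pose c2 := Phibar_inv alpha.
exists (`|c1| + `|c2| + `|K1|); first by rewrite !addr_ge0.
move=> a b y; rewrite !ler_norml => /andP[a1 a2] /andP[b1 b2].
have [n1 n2] := (normr_ge0 c1, normr_ge0 c2).
have [l1 l2 l3] : [/\ c1 <= `|c1|, - c2 <= `|c2| & K1 <= `|K1|].
  by split; rewrite ?ler_norm// -normrN ler_norm.
split=> yM.
  have db : Phibar (K1 + K2) <= Phibar (a + b) by apply: Phibar_antitone; lra.
  apply: (@lt_le_trans _ _ (Phibar c1)); first by apply: Phibar_decr; lra.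
  by rewrite /c1 Phibar_invK ?alpha_Phibar01// ler_wpM2l// ltW.
apply: (@le_trans _ _ alpha).
  by rewrite -[leRHS]mulr1 ler_wpM2l ?Phibar_le1// ltW.
rewrite -[leLHS](@Phibar_invK R alpha) ?alpha_gt0//.
by apply: Phibar_antitone; rewrite -/c2; lra.
Qed.

End critical_value.

(** * From thresholds to probabilities on the line *)

Section normal_line.
Context {R : realType}.
Local Notation N := (normal_prob (0 : R) 1).

Lemma threshold_near (P : Prop) (c q k y e eta : R) : e <= eta ->
  (c + e < y + q - k -> P) -> (y + q - k < c - e -> ~ P) ->
  (c - q + k + eta < y -> P) /\ (P -> c - q + k - eta <= y).
Proof.
move=> eeta P1 P2; split=> [cy|p]; first by apply: P1; lra.
by rewrite leNgt; apply/negP => cy; apply: P2 p; lra.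
Qed.

(** Beyond the range of the threshold, the sign of y determines on which side of it y lies. *)
Lemma threshold_far (P : Prop) (T M y eta : R) : `|T| <= M -> M < `|y| -> 0 <= eta ->
  (M < y -> P) -> (y < - M -> ~ P) -> (T + eta < y -> P) /\ (P -> T - eta <= y).
Proof.
rewrite ler_norml => /andP[T1 T2] yM eta0 P1 P2.
have [y0|y0] := leP 0 y.
  by rewrite ger0_norm// in yM; split=> _; [exact: P1|lra].
rewrite ltr0_norm// in yM; split=> [h|p]; first lra.
by exfalso; apply: P2 p; lra.
Qed.

(** Meant for an event [A] that is understood only where |w| < t; the remainder costs a Gaussian
    tail. *)
Lemma prob_le_union (A : set R) (x t : R) : measurable A -> 0 <= t ->
  A `<=` [set w | x < w] `|` [set w | t <= `|w|] ->
  fine (N A) <= Phibar x + 2 * expR (- (t ^+ 2 / 4)).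
Proof.
move=> mA t0 AI.
have mI : measurable ([set w | t <= `|w|] : set R).
  rewrite (_ : mkset _ = (fun x : R => `|x|) @^-1` `[t, +oo[%classic); last first.
    by apply/seteqP; split => w /=; rewrite in_itv/= andbT.
  by rewrite -[X in measurable X]setTI; exact: normr_measurable.
have E : [set w | x < w] = `]x, +oo[%classic.
  by apply/seteqP; split => w /=; rewrite in_itv/= andbT.
rewrite E in AI.
rewrite -lee_fin EFinD fineK ?normal_prob_fin//.
apply: (@le_trans _ _ (N (`]x, +oo[%classic `|` [set w | t <= `|w|]))).
  by apply: le_measure => //; rewrite inE//; exact: measurableU.
apply: (le_trans (measureU2 _ _ _)) => //.
rewrite leeD//; first by rewrite /Phibar fineK ?normal_prob_fin.
exact: normal_tail.
Qed.

Lemma prob_ge_diff (A : set R) (x t : R) : measurable A -> 0 <= t ->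
  [set w | x < w] `<=` A `|` [set w | t <= `|w|] ->
  Phibar x - 2 * expR (- (t ^+ 2 / 4)) <= fine (N A).
Proof.
move=> mA t0 AI.
have mI : measurable ([set w | t <= `|w|] : set R).
  rewrite (_ : mkset _ = (fun x : R => `|x|) @^-1` `[t, +oo[%classic); last first.
    by apply/seteqP; split => w /=; rewrite in_itv/= andbT.
  by rewrite -[X in measurable X]setTI; exact: normr_measurable.
have E : [set w | x < w] = `]x, +oo[%classic.
  by apply/seteqP; split => w /=; rewrite in_itv/= andbT.
rewrite E in AI.
rewrite lerBlDr -lee_fin EFinD fineK ?normal_prob_fin// /Phibar fineK ?normal_prob_fin//.
apply: (@le_trans _ _ (N (A `|` [set w | t <= `|w|]))).
  by apply: le_measure => //; rewrite inE//; exact: measurableU.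
apply: (le_trans (measureU2 _ _ _)) => //.
by rewrite leeD//; exact: normal_tail.
Qed.

(** With x = r^2 / 16 the exponential bound reads (1 + x)^4 <= 4^4 exp(x), and r^8 = 16^4 x^4. *)
Lemma tail_le_pow8 (r : R) : 1 <= r ->
  2 * expR (- ((r / 2) ^+ 2 / 4)) <= 2 * 256 * 16 ^+ 4 / r ^+ 8.
Proof.
move=> r1; have r0 : 0 < r by lra.
have x0 : 0 <= (r / 2) ^+ 2 / 4 by rewrite divr_ge0// sqr_ge0.
have := expR_ge_expn 3 x0; set x := _ / 4 in x0 *; set e := expR x => h.
rewrite expRN -/e -[X in _ <= X / _]mulrA -[leRHS]mulrA ler_wpM2l//.
have e0 : 0 < e by exact: expR_gt0.
rewrite ler_pdivlMr ?exprn_gt0// mulrC ler_pdivrMr//.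
have rx : r ^+ 8 <= 16 ^+ 4 * (1 + x) ^+ 4.
  rewrite -exprMn (exprM _ 2 4) ler_pXn2r ?nnegrE ?mulr_ge0 ?addr_ge0 ?sqr_ge0 ?(ltW r0)//.
  by rewrite /x; have := sqr_ge0 r; rewrite !expr2; lra.
apply: (le_trans rx); have -> : 256 * 16 ^+ 4 * e = 16 ^+ 4 * (4 ^+ 4 * e) :> R by ring.
by rewrite ler_wpM2l ?exprn_ge0.
Qed.

End normal_line.

(** * Rejection given the first m coordinates *)

Section conditional_rejection.
Context {R : realType} {m KH KS : nat}.
Variables (tH : 'I_KH -> R) (tS : 'I_KS -> R) (alpha : R).
Hypotheses (KH_gt1 : (1 < KH)%N) (tH_inj : injective tH) (tH_gt0 : forall i, 0 < tH i).
Hypotheses (KS_gt1 : (1 < KS)%N) (tS_inj : injective tS) (tS_gt0 : forall i, 0 < tS i).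
Hypotheses (alpha_gt0 : 0 < alpha) (alpha_lt1 : alpha < 1).
Implicit Types (h s q : 'rV[R]_m -> R) (u : 'rV[R]_m) (v k r C : R).
Local Notation N := (normal_prob (0 : R) 1).
Local Notation space := (m.-tuple (measurableTypeR R) * measurableTypeR R)%type.

Definition rejects h s u v : Prop :=
  Phibar (psi_line tH (-1) h u v) <
  alpha * Phibar (psi_line tH (-1) h u v + psi_line tS 0 (fun w => - s w) u (- v)).

Lemma rejectsE h s u v : continuous h -> continuous s ->
  (p_SI tH tS (region h) (~` region s) (u, v) < alpha) = rejects h s u v :> Prop.
Proof.
move=> ch cs; rewrite /p_SI psi_extrapolated_region// psi_extrapolated_setC//.
by rewrite ltr_pdivrMr// Phibar_gt0.
Qed.

Lemma measurable_rejects h s : continuous h -> continuous s ->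
  measurable [set z : space | rejects h s (vec z.1) z.2].
Proof.
move=> ch cs; have cNs : continuous (fun w => - s w) by move=> w; apply: continuousN; exact: cs.
have ma := measurable_psi_line (-1) KH_gt1 tH_inj ch.
have mneg : measurable_fun setT (fun z : space => (z.1, - z.2) : space).
  apply: measurable_fun_pair; first exact: measurable_fst.
  exact: (measurableT_comp (@measurable_funN _ _ R setT id (@measurable_id _ _ _)) measurable_snd).
have mb := measurableT_comp (measurable_psi_line 0 KS_gt1 tS_inj cNs) mneg.
pose g (z : space) := Phibar (psi_line tH (-1) h (vec z.1) z.2) -
  alpha * Phibar (psi_line tH (-1) h (vec z.1) z.2 + psi_line tS 0 (fun w => - s w) (vec z.1) (- z.2)).
have mg : measurable_fun setT g.
  apply: measurable_funB; first exact: (measurableT_comp measurable_Phibar ma).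
  apply: measurable_funM => //; apply: (measurableT_comp measurable_Phibar).
  exact: measurable_funD.
rewrite (_ : mkset _ = setT `&` g @^-1` `]-oo, 0[%classic); first exact: mg.
by apply/seteqP; split => z /=; rewrite in_itv/= /g subr_lt0 => //; case.
Qed.

(** Two regimes: for |y| <= M the expansions of psi feed [decision]; for M < |y| <= r the crude
    bounds feed [decision_far]. *)
Lemma rejects_threshold C : 1 <= C -> exists2 L, 1 <= L &
  forall r h qh kh s qs ks u y, L <= r ->
  near_quadratic C r h qh kh -> near_quadratic C r s qs ks ->
  `|u| <= r -> `|y| <= r ->
  let T := critical alpha (qh u - qs u - kh) - qh u + kh in
  let eta := L * ((1 + `|u|) ^+ 4 / r ^+ 8) in
  (T + eta < y -> rejects h s u y) /\ (rejects h s u y -> T - eta <= y).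
Proof.
move=> C1; have C0 : 0 <= C by apply: le_trans C1.
(* |G| is at most 11 C: 5 C for each polynomial and C for kh. *)
have [B' B'0 hB] := critical_bound alpha_gt0 alpha_lt1 (11 * C).
have [L1 L11 hL1] := decision alpha_gt0 alpha_lt1 (11 * C).
have [KHc KHc1 hHc] := psi_line_crude (-1) KH_gt1 tH_inj tH_gt0 (m := m) C1.
have [KSc KSc1 hSc] := psi_line_crude 0 KS_gt1 tS_inj tS_gt0 (m := m) C1.
have [M1 M10 hM] := decision_far alpha_gt0 alpha_lt1 KHc KSc.
(* M must reach the range of [decision_far] and also bound |T| <= B' + 5 C + C. *)
have [M [M0 M1M BM]] : exists M, [/\ 0 <= M, M1 <= M & B' + 6 * C <= M].
  by exists (M1 + (B' + 6 * C)); split; lra.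
have [KHa KHa1 hHa] := psi_line_approx (-1) KH_gt1 tH_inj tH_gt0 (m := m) C1 M0.
have [KSa KSa1 hSa] := psi_line_approx 0 KS_gt1 tS_inj tS_gt0 (m := m) C1 M0.
have [E [E0 EE]] : exists E, 0 <= E /\ E = KHa + KSa by exists (KHa + KSa); split=> //; lra.
have LE0 : 0 <= L1 * E by rewrite mulr_ge0//; lra.
have [L [L_ge1 Lc [La LE]]] : exists L, [/\ 1 <= L, KHc <= L /\ KSc <= L &
    (KHa <= L /\ KSa <= L) /\ 16 * (L1 * E) <= L].
  by exists (KHc + KSc + KHa + KSa + 16 * (L1 * E)); split; [lra|split; lra|split; [split|]; lra].
exists L => // r h qh kh s qs ks u y Lr nh ns ur yr T eta.
have [LcH LcS] : KHc <= r /\ KSc <= r by case: Lc => *; split; apply: le_trans Lr.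
have [LaH LaS] : KHa <= r /\ KSa <= r by case: La => *; split; apply: le_trans Lr.
have r1 : 1 <= r by apply: le_trans Lr.
have r0 : 0 < r by apply: lt_le_trans r1.
have nNs := near_quadraticN r0 C0 ns.
set W := (1 + `|u|) ^+ 4 / r ^+ 8 in eta *.
have W0 : 0 <= W by rewrite divr_ge0 ?exprn_ge0 ?addr_ge0// ltW.
(* |u| <= r gives W <= 16 / r^4, whence the requirement 16 L1 E <= L <= r. *)
have WE : L1 * E * W <= 1.
  have W16 : W <= 16 / r ^+ 4.
    rewrite /W ler_pdivlMr ?exprn_gt0// mulrAC ler_pdivrMr ?exprn_gt0//.
    have -> : 16 * r ^+ 8 = (2 * r) ^+ 4 * r ^+ 4 by ring.
    apply: ler_wpM2r; first by rewrite exprn_ge0 ?(ltW r0).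
    rewrite ler_pXn2r ?nnegrE ?addr_ge0 ?mulr_ge0 ?(ltW r0)//.
    by lra.
  have L4 : 16 * (L1 * E) <= r ^+ 4.
    by apply: (le_trans LE); apply: (le_trans Lr); rewrite -{1}[r]expr1 ler_weXn2l.
  have r4 : 0 < r ^+ 4 by rewrite exprn_gt0.
  apply: (@le_trans _ _ (r ^+ 4 / 16 * (16 / r ^+ 4))); last first.
    by rewrite mulrA divfK// divff// gt_eqF.
  by apply: ler_pM => //; rewrite ler_pdivlMr// mulrC.
have etaE : L1 * (E * W) <= eta by rewrite mulrA; apply: ler_wpM2r => //; lra.
have Leta : L1 * (E * W) <= 1 by rewrite mulrA.
set G := qh u - qs u - kh in T *.
have ur2 : `|u| <= r ^+ 2 by apply: (le_trans ur); exact: ler_self_sqr.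
have bh := nq_bound_ball C0 r1 ur2 nh; have bs := nq_bound_ball C0 r1 ur2 ns.
have bk := nq_k_le C0 r1 nh.
have GB : `|G| <= 11 * C.
  apply: (le_trans (ler_normB _ _)); apply: (le_trans (lerD (ler_normB _ _) (lexx _))).
  by lra.
have TB : `|T| <= M.
  apply: (le_trans (ler_normD _ _)); apply: (le_trans (lerD (ler_normB _ _) (lexx _))).
  by have := hB G GB; lra.
have TE : T = critical alpha G - qh u + kh by [].
have eta0 : 0 <= eta by rewrite mulr_ge0// (le_trans ler01).
have EW0 : 0 <= E * W by rewrite mulr_ge0.
rewrite /rejects.
set a := psi_line tH (-1) h u y; set b := psi_line tS 0 (fun w => - s w) u (- y).
have [yM|yM] := leP `|y| M; last first.
  have cr1 : `|a - y| <= KHc by exact: (hHc r h qh kh).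
  have cr2 : `|b - - y| <= KSc by apply: (hSc r _ _ _ _ _ _ nNs) => //; rewrite normrN.
  have [far1 far2] := hM a b y cr1 cr2.
  apply: (threshold_far TB yM eta0) => yM'; first by apply: far1; exact: le_lt_trans yM'.
  by apply/negP; rewrite -leNgt far2// (lt_le_trans yM')// lerN2.
have h1 : `|a - (y + qh u - kh)| <= KHa * W.
  rewrite mulrA; have -> : y + qh u - kh = y + qh u + -1 * kh by ring.
  exact: (hHa r h qh kh).
have h2 : `|b - (- y - qs u)| <= KSa * W.
  rewrite mulrA; have -> : - y - qs u = - y + - qs u + 0 * - ks by ring.
  by apply: (hSa r _ _ _ _ _ _ nNs) => //; rewrite normrN.
have EWE : E * W = KHa * W + KSa * W by rewrite EE mulrDl.
have dG : `|(a + b) - G| <= E * W.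
  have -> : (a + b) - G = (a - (y + qh u - kh)) + (b - (- y - qs u)) by rewrite /G; ring.
  by rewrite EWE; apply: (le_trans (ler_normD _ _)); exact: lerD.
have aG : `|a - (y + qh u - kh)| <= E * W.
  rewrite EWE; apply: (le_trans h1); rewrite lerDl mulr_ge0//.
  by apply: le_trans KSa1.
have [d1 d2] := hL1 G a (a + b) (y + qh u - kh) (E * W) GB EW0 Leta aG dG.
rewrite TE; apply: (threshold_near etaE d1) => yT.
by apply/negP; rewrite -leNgt; exact: d2.
Qed.

(** The event is squeezed between two rays near T - v, apart from w with |v + w| > r, where the
    threshold is not controlled. *)
Lemma conditional_rejection C B0 : 1 <= C -> 0 <= B0 -> exists2 L, 1 <= L &
  forall r h qh kh s qs ks u v, L <= r ->
  near_quadratic C r h qh kh -> near_quadratic C r s qs ks ->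
  `|u| <= r -> `|v| <= B0 ->
  measurable [set w | rejects h s u (v + w)] ->
  `|fine (N [set w | rejects h s u (v + w)]) -
    Phibar (critical alpha (qh u - qs u - kh) - qh u + kh - v)| <= L * (1 + `|u|) ^+ 4 / r ^+ 8.
Proof.
move=> C1 B00; have [L L1 hL] := rejects_threshold C1.
have [T8 T80 tail8] : exists2 T8 : R, 0 <= T8 &
    forall r : R, 1 <= r -> 2 * expR (- ((r / 2) ^+ 2 / 4)) <= T8 / r ^+ 8.
  eexists; last by move=> r; exact: tail_le_pow8.
  exact: mulr_ge0 (mulr_ge0 (ler0n _ _) (ler0n _ _)) (exprn_ge0 _ (ler0n _ _)).
exists (2 * L + 2 * B0 + T8); first by lra.
move=> r h qh kh s qs ks u v Lr nh ns ur vB mA.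
have r1 : 1 <= r by lra.
have r8 : 0 < r ^+ 8 by rewrite exprn_gt0//; lra.
have Lr' : L <= r by lra.
have B0r : 2 * B0 <= r by lra.
have thr y : `|y| <= r -> _ := hL r h qh kh s qs ks u y Lr' nh ns ur.
have tail := tail8 r r1; clear hL tail8 nh ns Lr.
move: thr; cbv zeta; set T := critical _ _ - _ + _; set W := (1 + `|u|) ^+ 4 / r ^+ 8 => thr.
have W1 : (r ^+ 8)^-1 <= W by rewrite /W ler_peMl ?invr_ge0 ?(ltW r8)// exprn_ege1// lerDl.
have W0 : 0 < W by apply: lt_le_trans W1; rewrite invr_gt0.
have B0W : 0 <= B0 * W by rewrite mulr_ge0// ltW.
have TW : T8 / r ^+ 8 <= T8 * W by rewrite ler_wpM2l.
have eta0 : 0 < L * W by rewrite mulr_gt0//; lra.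
have -> : (2 * L + 2 * B0 + T8) * (1 + `|u|) ^+ 4 / r ^+ 8 =
  2 * (L * W) + 2 * (B0 * W) + T8 * W by rewrite /W; ring.
set eta := L * W in thr eta0 *.
clearbody T W eta.
(* This uses |v| <= B0 <= r / 2. *)
have far w : r < `|v + w| -> r / 2 <= `|w| by have := ler_normD v w; lra.
have r20 : 0 <= r / 2 by lra.
have [p1 p2] := (Phibar_lipschitz (T - v - 2 * eta) (T - v), Phibar_lipschitz (T - v + eta) (T - v)).
have e1 : T - v - 2 * eta - (T - v) = - (2 * eta) by ring.
have e2 : T - v + eta - (T - v) = eta by ring.
rewrite e1 normrN [leRHS]ger0_norm in p1; last by rewrite mulr_ge0// ltW.
rewrite e2 [leRHS]ger0_norm ?(ltW eta0)// in p2.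
set A := mkset _ in mA *.
(* Rejection gives only w >= T - v - eta; the second eta makes the ray open. *)
have up : fine (N A) <= Phibar (T - v - 2 * eta) + 2 * expR (- ((r / 2) ^+ 2 / 4)).
  apply: prob_le_union => // w Aw.
  have [wr|wr] := leP `|v + w| r; last by right; exact: far.
  by left => /=; have [_ /(_ Aw) h1] := thr _ wr; lra.
have lo : Phibar (T - v + eta) - 2 * expR (- ((r / 2) ^+ 2 / 4)) <= fine (N A).
  apply: prob_ge_diff => // w /= xw.
  have [wr|wr] := leP `|v + w| r; last by right; exact: far.
  by left; have [h1 _] := thr _ wr; apply: h1; lra.
by move: p1 p2; rewrite !ler_norml; lra.
Qed.

End conditional_rejection.

(** * Rejection and selection probabilities *)

Section drift.
Context {R : realType} {m : nat}.
Local Notation PZ := (@normal_tuple R m).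
Local Notation phi := (normal_pdf (0 : R) 1).
Local Notation tuple := (m.-tuple (measurableTypeR R)).

Lemma fine_normal_prob01 (A : set R) : measurable A -> 0 <= fine (normal_prob 0 1 A) <= 1.
Proof.
move=> mA; apply/andP; split; first exact/fine_ge0/measure_ge0.
by rewrite -lee_fin fineK ?normal_prob_fin//; exact: probability_le1.
Qed.

Lemma expectation_close (f g : tuple -> R) K :
  measurable_fun setT f -> measurable_fun setT g ->
  (forall z, 0 <= f z <= 1) -> (forall z, 0 <= g z <= 1) ->
  (forall z, `|f z - g z| <= K * (1 + `|vec z|) ^+ 12) ->
  `|\int[PZ]_z f z - \int[PZ]_z g z| <= K * @moment R m.
Proof.
move=> mf mg f01 g01 fg; have [if_ ig] := (integrable_unit mf f01, integrable_unit mg g01).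
rewrite -RintegralB//; apply: expectation_le => //.
exact: measurable_funB.
Qed.

(* A centered perturbation of order r ^- 4 only has an effect of order r ^- 8,
   because [X] itself varies by r ^- 4 only: the first order term is
   [- phi X0 * D], whose mean vanishes. *)
Lemma drift_negligible (X D : tuple -> R) (U : tuple -> 'rV[R]_m) X0 c r :
  1 <= c -> 0 < r -> measurable_fun setT X -> measurable_fun setT D ->
  \int[PZ]_z D z = 0 ->
  (forall z, `|D z| <= c * (1 + `|vec z|) ^+ 2 / r ^+ 4) ->
  (forall z, `|U z| <= c * (1 + `|vec z|)) ->
  (forall z, `|U z| <= r -> `|X z - X0| <= c * (1 + `|vec z|) ^+ 2 / r ^+ 4) ->
  `|\int[PZ]_z Phibar (X z - D z) - \int[PZ]_z Phibar (X z)| <=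
    4 * c ^+ 8 / r ^+ 8 * @moment R m.
Proof.
move=> c1 r0 mX mD D0 Db Ub Xb; have c0 : 0 <= c by apply: le_trans c1.
have r4 : 0 < r ^+ 4 by rewrite exprn_gt0.
pose g z := Phibar (X z - D z) - Phibar (X z) - phi X0 * D z.
have mA : measurable_fun setT (fun z => Phibar (X z - D z)).
  by apply: (measurableT_comp measurable_Phibar); exact: measurable_funB.
have mB : measurable_fun setT (fun z => Phibar (X z)) by exact: (measurableT_comp measurable_Phibar mX).
have mC : measurable_fun setT (fun z => phi X0 * D z) by exact: measurable_funM.
have iA : PZ.-integrable setT (EFin \o (fun z => Phibar (X z - D z))).
  by apply: integrable_unit => // z; exact: Phibar01.
have iB : PZ.-integrable setT (EFin \o (fun z => Phibar (X z))).
  by apply: integrable_unit => // z; exact: Phibar01.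
have iD : PZ.-integrable setT (EFin \o D).
  apply: (integrable_dominated (K := c / r ^+ 4) mD) => z.
  apply: (le_trans (Db z)); rewrite mulrAC ler_wpM2l ?divr_ge0 ?(ltW r4)//.
  exact: pow_le12.
have iAB : PZ.-integrable setT (EFin \o (fun z => Phibar (X z - D z) - Phibar (X z))).
  exact: (integrableB measurableT iA iB).
have iC : PZ.-integrable setT (EFin \o (fun z => phi X0 * D z)).
  exact: (integrableZl measurableT (phi X0) iD).
have -> : \int[PZ]_z Phibar (X z - D z) - \int[PZ]_z Phibar (X z) = \int[PZ]_z g z.
  by rewrite RintegralB// RintegralB// RintegralZl// D0 mulr0 subr0.
apply: expectation_le => [|z]; first by apply: measurable_funB => //; exact: measurable_funB.
set x := 1 + `|vec z|.
have x1 : 1 <= x by rewrite lerDl.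
have x0 : 0 <= x by apply: le_trans x1.
pose y := c * x ^+ 2 / r ^+ 4.
have Dz : `|D z| <= y := Db z.
have Uz : `|U z| <= c * x := Ub z.
have Xz : `|U z| <= r -> `|X z - X0| <= y := Xb z.
have y0 : 0 <= y by apply: le_trans Dz.
have le_pow (i j k l : nat) : (i <= j)%N -> (k <= l)%N -> c ^+ i * x ^+ k <= c ^+ j * x ^+ l.
  by move=> ij kl; rewrite ler_pM ?exprn_ge0// ler_weXn2l.
rewrite [leRHS]mulrAC ler_pdivlMr ?exprn_gt0//.
(* Inside the ball a Taylor expansion gives two errors of size y^2. Outside it r <= c x, so powers
   of r are absorbed by moments. *)
have [Ur|Ur] := leP `|U z| r.
  have gb : `|g z| <= 2 * y ^+ 2.
    have -> : g z = (Phibar (X z - D z) - Phibar (X z) + phi (X z) * - D z) +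
        (phi (X z) - phi X0) * D z by rewrite /g; ring.
    apply: (le_trans (ler_normD _ _)).
    have h1 := Phibar_taylor (X z) (- D z).
    have h2 : (- D z) ^+ 2 <= y ^+ 2.
      by rewrite sqrrN -real_normK ?num_real// ler_pXn2r ?nnegrE.
    have h3 : `|(phi (X z) - phi X0) * D z| <= y * y.
      by rewrite normrM ler_pM// (le_trans (phi_lipschitz _ _))// Xz.
    by rewrite expr2 in h2 *; move: (le_trans h1 h2) h3; rewrite expr2; lra.
  apply: (@le_trans _ _ (2 * y ^+ 2 * r ^+ 8)); first by rewrite ler_wpM2r// exprn_ge0// ltW.
  have -> : 2 * y ^+ 2 * r ^+ 8 = 2 * (c ^+ 2 * x ^+ 4).
    by rewrite /y; field; rewrite gt_eqF.
  have := le_pow 2%N 8%N 4%N 12%N isT isT; have := mulr_ge0 (exprn_ge0 2 c0) (exprn_ge0 4 x0); lra.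
have rcx : r <= c * x by rewrite ltW// (lt_le_trans Ur).
have rp k : r ^+ k <= c ^+ k * x ^+ k.
  by rewrite -exprMn lerXn2r// ?nnegrE ?(ltW r0)// mulr_ge0.
have gb : `|g z| <= 1 + y.
  apply: (le_trans (ler_normB _ _)); rewrite lerD ?Phibar_sub_le1// normrM.
  rewrite -[leRHS]mul1r ler_pM//.
  by rewrite ger0_norm ?phi_le1// ltW ?phi_gt0.
apply: (@le_trans _ _ ((1 + y) * r ^+ 8)); first by rewrite ler_wpM2r// exprn_ge0// ltW.
have -> : (1 + y) * r ^+ 8 = r ^+ 8 + c * x ^+ 2 * r ^+ 4.
  by rewrite /y; field; rewrite gt_eqF.
have h1 := rp 8%N; have h2 := ler_wpM2l (mulr_ge0 c0 (exprn_ge0 2 x0)) (rp 4%N).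
have e2 : c * x ^+ 2 * (c ^+ 4 * x ^+ 4) = c ^+ 5 * x ^+ 6 by ring.
rewrite e2 in h2; have := le_pow 5%N 8%N 6%N 12%N isT isT; have := le_pow 8%N 8%N 8%N 12%N isT isT.
have := mulr_ge0 (exprn_ge0 8 c0) (exprn_ge0 12 x0); lra.
Qed.

End drift.

(** * The two probabilities at a boundary point *)

Section estimates.
Context {R : realType} {m KH KS : nat}.
Variables (tH : 'I_KH -> R) (tS : 'I_KS -> R) (alpha : R).
Hypotheses (KH_gt1 : (1 < KH)%N) (tH_inj : injective tH) (tH_gt0 : forall i, 0 < tH i).
Hypotheses (KS_gt1 : (1 < KS)%N) (tS_inj : injective tS) (tS_gt0 : forall i, 0 < tS i).
Hypotheses (alpha_gt0 : 0 < alpha) (alpha_lt1 : alpha < 1).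
Implicit Types (h s qh qs : 'rV[R]_m -> R) (u : 'rV[R]_m) (kh ks r C : R).
Local Notation N := (normal_prob (0 : R) 1).
Local Notation PZ := (@normal_tuple R m).
Local Notation tuple := (m.-tuple (measurableTypeR R)).
Local Notation space := (tuple * measurableTypeR R)%type.
Local Notation shift u := (fun z : tuple => u + 1 *: vec z).

(** The region is closed, and its points with strict inequality form an open subset. *)
Lemma boundary_region h u v : continuous h -> boundary (region h) (u, v) -> v = - h u.
Proof.
move=> ch [cl nint].
have cg : continuous (fun y : 'rV[R]_m * R => y.2 + h y.1).
  move=> y; apply: (@cvgD _ _ _ (nbhs y)); first exact: cvg_snd.
  by apply: cvg_comp; [exact: cvg_fst|exact: ch].
have clR : closed (region h).
  rewrite (_ : region h = (fun y : 'rV[R]_m * R => y.2 + h y.1) @^-1` [set x | x <= 0]).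
    by apply: closed_comp => //; exact: closed_le.
  by apply/seteqP; split => y /=; rewrite /region/= -lerBrDr sub0r.
have vle : v <= - h u by exact: (clR (u, v) cl).
apply/eqP; rewrite eq_le vle /= leNgt; apply/negP => vlt; apply: nint.
have op : open ((fun y : 'rV[R]_m * R => y.2 + h y.1) @^-1` [set x | x < 0]).
  by apply: open_comp => //; exact: open_lt.
rewrite /interior; apply: filterS (open_nbhs_nbhs (conj op _)).
  by move=> y /= yh; rewrite /region/=; lra.
by rewrite /=; lra.
Qed.

Lemma measurable_section (mu : 'rV[R]_m * R) (D : set ('rV[R]_m * R)) :
  measurable [set z : space | D (vec z.1, z.2)] ->
  (forall z : tuple, measurable [set w : R | D (mu.1 + 1 *: vec z, mu.2 + w)]) /\
  measurable_fun setT (fun z : tuple => fine (N [set w | D (mu.1 + 1 *: vec z, mu.2 + w)])).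
Proof.
move=> mD; have := measurable_affine_preimage mu 1 mD.
set A := mkset _ => mA.
have E (z : tuple) : [set w | D (mu.1 + 1 *: vec z, mu.2 + w)] = xsection A z.
  by apply/seteqP; split => w; rewrite /xsection/= inE /A/= mul1r.
split=> [z|]; first by rewrite E; exact: measurable_xsection.
under eq_fun do rewrite E.
by apply: measurableT_comp => //; exact: measurable_fun_xsection.
Qed.

(** The function G of the overview. *)
Definition threshold qh qs kh u : R := qh u - qs u - kh.

Lemma threshold_bound C r h qh kh s qs ks u : 0 <= C -> 1 <= r -> `|u| <= r ^+ 2 ->
  near_quadratic C r h qh kh -> near_quadratic C r s qs ks ->
  `|threshold qh qs kh u| <= 11 * C.
Proof.
move=> C0 r1 ur nh ns.
have bh := nq_bound_ball C0 r1 ur nh; have bs := nq_bound_ball C0 r1 ur ns.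
have bk := nq_k_le C0 r1 nh.
apply: (le_trans (ler_normB _ _)); apply: (le_trans (lerD (ler_normB _ _) (lexx _))).
lra.
Qed.

Lemma threshold_diff C r h qh kh s qs ks u (x : 'rV[R]_m) R0 : 0 <= C -> 0 < r ->
  near_quadratic C r h qh kh -> near_quadratic C r s qs ks -> `|u| <= R0 ->
  `|threshold qh qs kh (u + x) - threshold qh qs kh u| <=
    2 * C * (1 + R0) ^+ 2 * (1 + `|x|) ^+ 2 / r ^+ 4.
Proof.
move=> C0 r0 nh ns uR; have hd := nq_diff nh u x; have sd := nq_diff ns u x.
have -> : threshold qh qs kh (u + x) - threshold qh qs kh u =
  (qh (u + x) - qh u) - (qs (u + x) - qs u) by rewrite /threshold; ring.
apply: (le_trans (ler_normB _ _)); apply: (le_trans (lerD hd sd)).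
rewrite -mulrDl ler_wpM2r ?invr_ge0 ?exprn_ge0 ?(ltW r0)//.
rewrite -mulrDl ler_wpM2r ?exprn_ge0 ?addr_ge0//.
have -> : C * (1 + `|u|) ^+ 2 + C * (1 + `|u|) ^+ 2 = 2 * C * (1 + `|u|) ^+ 2 by ring.
rewrite ler_wpM2l ?mulr_ge0// ler_pXn2r ?nnegrE ?addr_ge0// ?lerD2l//.
exact: le_trans uR.
Qed.

Lemma threshold_continuous C r h qh kh s qs ks :
  near_quadratic C r h qh kh -> near_quadratic C r s qs ks ->
  continuous (threshold qh qs kh).
Proof.
move=> nh ns u; apply: (@cvgB _ _ _ (nbhs u)); last exact: cvg_cst.
by apply: cvgB; [exact: (nq_qcont nh)|exact: (nq_qcont ns)].
Qed.

Lemma shift_norm C R0 u (z : tuple) : 1 <= C -> `|u| <= R0 ->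
  1 + `|u + 1 *: vec z| <= 5 * C * (1 + R0) ^+ 2 * (1 + `|vec z|).
Proof.
move=> C1 uR; apply: (le_trans (affine_norm_le _ _ _)).
have R1 : 1 <= 1 + R0 by rewrite lerDl (le_trans _ uR).
rewrite normr1 ler_wpM2r ?addr_ge0//.
have h1 : 1 + R0 <= (1 + R0) ^+ 2 by exact: ler_self_sqr.
have h2 : (1 + R0) ^+ 2 <= C * (1 + R0) ^+ 2 by rewrite ler_peMl// exprn_ge0// (le_trans ler01).
rewrite -mulrA; lra.
Qed.

Lemma shift_drift C r h qh kh u R0 : 0 <= C -> 0 < r -> near_quadratic C r h qh kh ->
  `|u| <= R0 ->
  let D := fun z : tuple => qh (u + 1 *: vec z) - qh u - kh in
  [/\ measurable_fun setT D, \int[PZ]_z D z = 0 &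
    forall z, `|D z| <= 5 * C * (1 + R0) ^+ 2 * (1 + `|vec z|) ^+ 2 / r ^+ 4].
Proof.
move=> C0 r0 nq uR; split.
- apply: measurable_funB => //; apply: measurable_funB => //.
  exact: measurable_affine_vec (nq_qcont nq).
- by have := nq_centered_mean 1 u C0 r0 nq; rewrite expr1n mul1r.
- move=> z; have := nq_centered_le u (vec z) C0 r0 ler01 nq; rewrite expr1n mul1r => h1.
  apply: (le_trans h1); rewrite ler_wpM2r ?invr_ge0 ?exprn_ge0 ?(ltW r0)//.
  rewrite ler_wpM2r ?exprn_ge0 ?addr_ge0//.
  have -> : C * ((1 + 1) ^+ 2 + 1) = 5 * C by ring.
  rewrite ler_wpM2l ?mulr_ge0// ler_pXn2r ?nnegrE ?addr_ge0// ?lerD2l//.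
  exact: le_trans uR.
Qed.

Lemma near_at C r h qh kh u R0 : 0 <= C -> 1 <= r -> C * R0 <= r -> near_quadratic C r h qh kh ->
  `|u| <= R0 -> `|h u - qh u| <= C * R0 ^+ 3 / r ^+ 8.
Proof.
move=> C0 r1 CR nq uR; have r0 : 0 < r by apply: lt_le_trans r1.
have rr : r <= r ^+ 4 by rewrite -{1}[r]expr1 ler_weXn2l.
apply: (le_trans (nq_near nq _)).
  by apply: (le_trans _ rr); apply: (le_trans _ CR); rewrite ler_wpM2l.
rewrite ler_wpM2r ?invr_ge0 ?exprn_ge0 ?(ltW r0)// ler_wpM2l//.
by rewrite ler_pXn2r ?nnegrE// (le_trans _ uR).
Qed.

(** The argument h(u) - s(u + Z) is, up to O(1/n), qh(u) - qs(u + Z) = X - D. This splitting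
    isolates a centered drift D and the same function G that governs rejection. *)
Lemma selection_estimate C R0 : 1 <= C -> 0 <= R0 -> exists2 K, 1 <= K &
  forall r h qh kh s qs ks u, K <= r ->
  near_quadratic C r h qh kh -> near_quadratic C r s qs ks -> `|u| <= R0 ->
  `|gaussian (u, - h u) 1 (~` region s) -
    \int[PZ]_z Phibar (threshold qh qs kh (u + 1 *: vec z))| <= K / r ^+ 8.
Proof.
move=> C1 R00; have C0 : 0 <= C by apply: le_trans C1.
pose c := 5 * C * (1 + R0) ^+ 2.
have R1 : 1 <= (1 + R0) ^+ 2 by rewrite exprn_ege1// lerDl.
have c1 : 1 <= c by rewrite mulr_ege1//; lra.
have c0 : 0 <= c by apply: le_trans c1.
pose K1 := (C / 1 + C ^+ 2) * c ^+ 3 + C * R0 ^+ 3.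
have K10 : 0 <= K1 by rewrite addr_ge0// mulr_ge0 ?exprn_ge0// addr_ge0 ?exprn_ge0// divr1.
have M0 := @moment_ge0 R m.
have h3 : 0 <= (K1 + 4 * c ^+ 8) * @moment R m by rewrite mulr_ge0// addr_ge0// mulr_ge0// exprn_ge0.
have CR : 0 <= C * R0 by rewrite mulr_ge0.
exists (1 + C * R0 + (K1 + 4 * c ^+ 8) * @moment R m); first by lra.
move=> r h qh kh s qs ks u Kr nh ns uR.
have r1 : 1 <= r by lra.
have r0 : 0 < r by lra.
have r8 : 0 < r ^+ 8 by rewrite exprn_gt0.
have CRr : C * R0 <= r by lra.
have [mD D0 Db] := shift_drift C0 r0 nh uR; set D := (fun z : tuple => _) in mD D0 Db.
have cs : continuous (fun w => - s w) by move=> w; apply: continuousN; exact: (nq_cont ns).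
set X := fun z : tuple => threshold qh qs kh (u + 1 *: vec z).
have mX : measurable_fun setT X.
  exact: measurable_affine_vec (threshold_continuous nh ns).
have -> : gaussian (u, - h u) 1 (~` region s) =
    \int[PZ]_z Phibar ((h u + - s (u + 1 *: vec z)) / 1).
  have := bootstrap_setC_region u (- h u) ltr01 (nq_cont ns).
  by rewrite /bootstrap_prob sqrtr1 opprK /tail_mean.
have step1 : `|\int[PZ]_z Phibar ((h u + - s (u + 1 *: vec z)) / 1) -
    \int[PZ]_z Phibar (X z - D z)| <= K1 / r ^+ 8 * @moment R m.
  apply: expectation_close => [||z|z|z]; [exact: (measurable_tail_integrand (h u) u 1 cs)| |exact: Phibar01|exact: Phibar01|].
    by apply: (measurableT_comp measurable_Phibar); exact: measurable_funB.
  set w := u + _; have nNs := near_quadraticN r0 C0 ns.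
  have h1 := nq_Phibar (h u) w C1 ltr01 r0 nNs.
  have h2 := Phibar_lipschitz ((h u + - qs w) / 1) (X z - D z).
  have e2 : (h u + - qs w) / 1 - (X z - D z) = h u - qh u.
    by rewrite divr1 /X /D /threshold -/w; ring.
  rewrite e2 in h2; have {}h2 := le_trans h2 (near_at C0 r1 CRr nh uR).
  have x1 : 1 <= (1 + `|vec z|) ^+ 12 by rewrite exprn_ege1// lerDl.
  have -> : Phibar ((h u + - s w) / 1) - Phibar (X z - D z) =
    (Phibar ((h u + - s w) / 1) - Phibar ((h u + - qs w) / 1)) +
    (Phibar ((h u + - qs w) / 1) - Phibar (X z - D z)) by ring.
  have -> : K1 / r ^+ 8 * (1 + `|vec z|) ^+ 12 =
      (C / 1 + C ^+ 2) * (c ^+ 3 * (1 + `|vec z|) ^+ 12) / r ^+ 8 +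
      C * R0 ^+ 3 * (1 + `|vec z|) ^+ 12 / r ^+ 8 by rewrite /K1; ring.
  apply: (le_trans (ler_normD _ _)); rewrite lerD//.
    apply: (le_trans h1); rewrite ler_wpM2r ?invr_ge0 ?(ltW r8)// ler_wpM2l//.
      by rewrite addr_ge0 ?exprn_ge0// divr1.
    apply: (@le_trans _ _ ((c * (1 + `|vec z|)) ^+ 3)).
      by rewrite ler_pXn2r ?nnegrE ?mulr_ge0 ?addr_ge0// shift_norm.
    by rewrite exprMn ler_wpM2l ?exprn_ge0// pow_le12.
  apply: (le_trans h2); rewrite ler_wpM2r ?invr_ge0 ?(ltW r8)// ler_peMr//.
  by rewrite mulr_ge0// exprn_ge0.
have step2 : `|\int[PZ]_z Phibar (X z - D z) - \int[PZ]_z Phibar (X z)| <=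
    4 * c ^+ 8 / r ^+ 8 * @moment R m.
  apply: (@drift_negligible R m X D (fun z => u + 1 *: vec z) (threshold qh qs kh u)) => // z.
    by apply: le_trans (shift_norm z C1 uR); rewrite lerDr.
  move=> _; rewrite /X scale1r; apply: (le_trans (threshold_diff (vec z) C0 r0 nh ns uR)).
  rewrite ler_wpM2r ?invr_ge0 ?exprn_ge0 ?(ltW r0)// ler_wpM2r ?exprn_ge0 ?addr_ge0//.
  rewrite /c ler_wpM2r//; [exact: le_trans R1|lra].
apply: (le_trans (ler_distD (\int[PZ]_z Phibar (X z - D z)) _ _)).
apply: (le_trans (lerD step1 step2)).
have -> : K1 / r ^+ 8 * @moment R m + 4 * c ^+ 8 / r ^+ 8 * @moment R m =
  (K1 + 4 * c ^+ 8) * @moment R m / r ^+ 8 by ring.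
by rewrite ler_wpM2r ?invr_ge0 ?(ltW r8)// lerDr addr_ge0.
Qed.

(** Once the drift is dropped, the factor alpha comes out exactly, by the defining equation of
    [critical]. *)
Lemma rejection_estimate C R0 : 1 <= C -> 0 <= R0 -> exists2 K, 1 <= K &
  forall r h qh kh s qs ks u, K <= r ->
  near_quadratic C r h qh kh -> near_quadratic C r s qs ks -> `|u| <= R0 -> `|h u| <= R0 ->
  `|gaussian (u, - h u) 1 [set y | p_SI tH tS (region h) (~` region s) y < alpha] -
    alpha * \int[PZ]_z Phibar (threshold qh qs kh (u + 1 *: vec z))| <= K / r ^+ 8.
Proof.
move=> C1 R00; have C0 : 0 <= C by apply: le_trans C1.
have [L L1 hL] := conditional_rejection KH_gt1 tH_inj tH_gt0 KS_gt1 tS_inj tS_gt0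
  alpha_gt0 alpha_lt1 (m := m) C1 R00.
have [Lc Lc0 hLc] := critical_lipschitz alpha_gt0 alpha_lt1 (11 * C).
have L0 : 0 <= L by apply: le_trans L1.
pose c' := 5 * C * (1 + R0) ^+ 2.
have R1 : 1 <= (1 + R0) ^+ 2 by rewrite exprn_ege1// lerDl.
have c'1 : 1 <= c' by rewrite mulr_ege1//; lra.
(* [critical] multiplies the variation of G by at most Lc. *)
pose c := (1 + Lc) * c'.
have c'c : c' <= c by rewrite /c ler_peMl ?lerDl//; apply: le_trans c'1.
have Lc'c : Lc * c' <= c by rewrite /c mulrDl mul1r lerDr; apply: le_trans c'1.
have c1 : 1 <= c by apply: le_trans c'c.
have c0 : 0 <= c by apply: le_trans c1.
pose K1 := (L + 1) * c ^+ 8 + C * R0 ^+ 3.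
have K10 : 0 <= K1 by rewrite addr_ge0// mulr_ge0 ?exprn_ge0// addr_ge0.
have M0 := @moment_ge0 R m.
have h3 : 0 <= (K1 + 4 * c ^+ 8) * @moment R m by rewrite mulr_ge0// addr_ge0// mulr_ge0// exprn_ge0.
have CR : 0 <= C * R0 by rewrite mulr_ge0.
exists (L + R0 + C * R0 + (K1 + 4 * c ^+ 8) * @moment R m); first by lra.
move=> r h qh kh s qs ks u Kr nh ns uR hR.
have r1 : 1 <= r by lra.
have r0 : 0 < r by lra.
have r8 : 0 < r ^+ 8 by rewrite exprn_gt0.
have r4 : 0 < r ^+ 4 by rewrite exprn_gt0.
have CRr : C * R0 <= r by lra.
have Lr : L <= r by lra.
have R0r : R0 <= r by lra.
have [mD D0 Db'] := shift_drift C0 r0 nh uR; set D := (fun z : tuple => _) in mD D0 Db'.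
have Db z : `|D z| <= c * (1 + `|vec z|) ^+ 2 / r ^+ 4.
  apply: (le_trans (Db' z)); rewrite ler_wpM2r ?invr_ge0 ?(ltW r4)//.
  by rewrite ler_wpM2r ?exprn_ge0 ?addr_ge0.
have Ub (z : tuple) : 1 + `|u + 1 *: vec z| <= c * (1 + `|vec z|).
  by apply: (le_trans (shift_norm z C1 uR)); rewrite ler_wpM2r ?addr_ge0.
set X := fun z : tuple => critical alpha (threshold qh qs kh (u + 1 *: vec z)).
have mG : measurable_fun setT (fun z : tuple => threshold qh qs kh (u + 1 *: vec z)).
  exact: measurable_affine_vec (threshold_continuous nh ns).
have mX : measurable_fun setT X := measurable_critical alpha_gt0 alpha_lt1 mG.
have -> : [set y | p_SI tH tS (region h) (~` region s) y < alpha] =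
    [set y | rejects tH tS alpha h s y.1 y.2].
  by apply/funext => -[a b]; apply: rejectsE => //; [exact: (nq_cont nh)|exact: (nq_cont ns)].
have mR := measurable_rejects alpha KH_gt1 tH_inj KS_gt1 tS_inj (nq_cont nh) (nq_cont ns).
have [mS mP] := @measurable_section (u, - h u) [set y | rejects tH tS alpha h s y.1 y.2] mR.
have -> : gaussian (u, - h u) 1 [set y | rejects tH tS alpha h s y.1 y.2] =
    \int[PZ]_z fine (N [set w | rejects tH tS alpha h s (u + 1 *: vec z) (- h u + w)]).
  rewrite (gaussian_sections (u, - h u) ltr01 mR) sqrtr1.
  apply: eq_Rintegral => z _ /=; apply: (congr1 (fun A => fine (N A))).
  by apply/funext => w /=; rewrite mul1r.
have step1 : `|\int[PZ]_z fine (N [set w | rejects tH tS alpha h s (u + 1 *: vec z) (- h u + w)]) -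
    \int[PZ]_z Phibar (X z - D z)| <= K1 / r ^+ 8 * @moment R m.
  have P01 z : 0 <= fine (N [set w | rejects tH tS alpha h s (u + 1 *: vec z) (- h u + w)]) <= 1.
    exact: (fine_normal_prob01 (mS z)).
  apply: expectation_close => // [|z|z]; [|exact: Phibar01|].
    by apply: (measurableT_comp measurable_Phibar); exact: measurable_funB.
  set w := u + _ in mS *; set x := 1 + `|vec z|.
  have Uz : 1 + `|w| <= c * x by exact: Ub.
  have x1 : 1 <= x by rewrite lerDl.
  have x0 : 0 <= x by apply: le_trans x1.
  have U8 : (1 + `|w|) ^+ 8 <= c ^+ 8 * x ^+ 12.
    apply: (@le_trans _ _ ((c * x) ^+ 8)).
      by rewrite ler_pXn2r ?nnegrE ?mulr_ge0 ?addr_ge0.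
    by rewrite exprMn ler_wpM2l ?exprn_ge0// ler_weXn2l.
  have U1 : 1 <= 1 + `|w| by rewrite lerDl.
  (* Off the ball the trivial bound 1 is absorbed by ((1 + |w|) / r)^8. *)
  have [wr|wr] := leP `|w| r; last first.
    apply: (@le_trans _ _ 1).
      have := P01 z; rewrite -/w; have := Phibar_ge0 (X z - D z); have := Phibar_le1 (X z - D z).
      by rewrite ler_norml; lra.
    rewrite mulrAC ler_pdivlMr// mul1r.
    apply: (@le_trans _ _ (c ^+ 8 * x ^+ 12)).
      by apply: (le_trans _ U8); rewrite ler_pXn2r ?nnegrE ?addr_ge0 ?(ltW r0)//; lra.
    rewrite ler_wpM2r ?exprn_ge0// /K1.
    have := mulr_ge0 L0 (exprn_ge0 8 c0); have := mulr_ge0 C0 (exprn_ge0 3 R00).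
    by rewrite mulrDl; lra.
  have h1 := hL r h qh kh s qs ks w (- h u) Lr nh ns wr.
  rewrite normrN in h1; have {}h1 := h1 hR (mS z).
  set y := critical _ _ - _ + _ - _ in h1.
  have h2 := Phibar_lipschitz y (X z - D z).
  have e2 : y - (X z - D z) = h u - qh u by rewrite /y /X /D /threshold -/w; ring.
  rewrite e2 in h2; have {}h2 := le_trans h2 (near_at C0 r1 CRr nh uR).
  have -> : K1 / r ^+ 8 * x ^+ 12 =
      (L * (c ^+ 8 * x ^+ 12) + c ^+ 8 * x ^+ 12) / r ^+ 8 +
      C * R0 ^+ 3 * x ^+ 12 / r ^+ 8 by rewrite /K1; ring.
  apply: (le_trans (ler_distD (Phibar y) _ _)); rewrite lerD//.
    apply: (le_trans h1); rewrite ler_wpM2r ?invr_ge0 ?(ltW r8)//.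
    have U4 : (1 + `|w|) ^+ 4 <= (1 + `|w|) ^+ 8 by rewrite ler_weXn2l.
    have := ler_wpM2l L0 (le_trans U4 U8); have := mulr_ge0 (exprn_ge0 8 c0) (exprn_ge0 12 x0).
    lra.
  apply: (le_trans h2); rewrite ler_wpM2r ?invr_ge0 ?(ltW r8)// ler_peMr//.
    by rewrite mulr_ge0// exprn_ge0.
  by rewrite exprn_ege1.
have step2 : `|\int[PZ]_z Phibar (X z - D z) - \int[PZ]_z Phibar (X z)| <=
    4 * c ^+ 8 / r ^+ 8 * @moment R m.
  apply: (@drift_negligible R m X D (fun z => u + 1 *: vec z) (critical alpha (threshold qh qs kh u))) => // z.
    by apply: (le_trans _ (Ub z)); rewrite lerDr.
  move=> Ur; have rr := ler_self_sqr r1.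
  have b1 := threshold_bound C0 r1 (le_trans Ur rr) nh ns.
  have b2 := threshold_bound C0 r1 (le_trans (le_trans uR R0r) rr) nh ns.
  apply: (le_trans (hLc _ _ b1 b2)).
  have h1 := threshold_diff (vec z) C0 r0 nh ns uR; rewrite scale1r.
  apply: (le_trans (ler_wpM2l Lc0 h1)).
  have -> : Lc * (2 * C * (1 + R0) ^+ 2 * (1 + `|vec z|) ^+ 2 / r ^+ 4) =
    Lc * (2 * C * (1 + R0) ^+ 2) * (1 + `|vec z|) ^+ 2 / r ^+ 4 by ring.
  rewrite ler_wpM2r ?invr_ge0 ?(ltW r4)// ler_wpM2r ?exprn_ge0 ?addr_ge0//.
  apply: (le_trans _ Lc'c); rewrite ler_wpM2l// /c'.
  rewrite ler_wpM2r//; [exact: le_trans R1|lra].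
have EX : \int[PZ]_z Phibar (X z) =
    alpha * \int[PZ]_z Phibar (threshold qh qs kh (u + 1 *: vec z)).
  under eq_Rintegral do rewrite /X Phibar_critical//.
  rewrite RintegralZl//; apply: integrable_unit => [|z]; last exact: Phibar01.
  exact: (measurableT_comp measurable_Phibar mG).
rewrite -EX; apply: (le_trans (ler_distD (\int[PZ]_z Phibar (X z - D z)) _ _)).
apply: (le_trans (lerD step1 step2)).
have -> : K1 / r ^+ 8 * @moment R m + 4 * c ^+ 8 / r ^+ 8 * @moment R m =
  (K1 + 4 * c ^+ 8) * @moment R m / r ^+ 8 by ring.
by rewrite ler_wpM2r ?invr_ge0 ?(ltW r8)// lerDr addr_ge0// addr_ge0.
Qed.

(** Keeps the selection probability away from 0, so that the quotient preserves the order of the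
    errors. The mean is within O(r^-4) of Phibar(G(u)), and |G(u)| <= 11 C. *)
Lemma threshold_mean_ge C R0 : 1 <= C -> 0 <= R0 -> exists2 K, 1 <= K &
  forall r h qh kh s qs ks u, K <= r ->
  near_quadratic C r h qh kh -> near_quadratic C r s qs ks -> `|u| <= R0 ->
  Phibar (11 * C) / 2 <= \int[PZ]_z Phibar (threshold qh qs kh (u + 1 *: vec z)).
Proof.
move=> C1 R00; have C0 : 0 <= C by apply: le_trans C1.
pose c := 2 * C * (1 + R0) ^+ 2.
have c0 : 0 <= c by rewrite mulr_ge0 ?exprn_ge0 ?addr_ge0 ?mulr_ge0.
have p0 := Phibar_gt0 (11 * C).
pose M := @moment R m; have M0 : 0 <= M := @moment_ge0 R m.
have q0 : 0 <= 2 * c * M / Phibar (11 * C) by rewrite divr_ge0 ?(ltW p0)// mulr_ge0// mulr_ge0.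
exists (1 + R0 + 2 * c * M / Phibar (11 * C)); first by lra.
move=> r h qh kh s qs ks u Kr nh ns uR.
have r1 : 1 <= r by lra.
have r0 : 0 < r by lra.
have r4 : 0 < r ^+ 4 by rewrite exprn_gt0.
have rr4 : r <= r ^+ 4 by rewrite -{1}[r]expr1 ler_weXn2l.
have ur : `|u| <= r ^+ 2 by apply: (le_trans _ (ler_self_sqr r1)); lra.
set G := threshold qh qs kh.
have GB : `|G u| <= 11 * C := threshold_bound C0 r1 ur nh ns.
have mG : measurable_fun setT (fun z : tuple => G (u + 1 *: vec z)).
  exact: measurable_affine_vec (threshold_continuous nh ns).
have close : `|\int[PZ]_z Phibar (G (u + 1 *: vec z)) - \int[PZ]_z Phibar (G u)| <= c / r ^+ 4 * M.
  apply: expectation_close => [||z|z|z]; [|exact: measurable_cst|exact: Phibar01|exact: Phibar01|].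
    exact: (measurableT_comp measurable_Phibar mG).
  apply: (le_trans (Phibar_lipschitz _ _)).
  rewrite scale1r; apply: (le_trans (threshold_diff (vec z) C0 r0 nh ns uR)).
  rewrite -/c [leRHS]mulrAC ler_wpM2r ?invr_ge0 ?(ltW r4)//.
  by rewrite ler_wpM2l// pow_le12.
have small : c / r ^+ 4 * M <= Phibar (11 * C) / 2.
  have h1 : 2 * c * M / Phibar (11 * C) <= r ^+ 4 by apply: (le_trans _ rr4); lra.
  by rewrite ler_pdivrMr// in h1; rewrite mulrAC ler_pdivrMr//; lra.
have Pu : Phibar (11 * C) <= Phibar (G u).
  by apply: Phibar_antitone; move: GB; rewrite ler_norml => /andP[].
rewrite (@expectation_cst R m) in close.
by move: close; rewrite ler_norml; lra.
Qed.

End estimates.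

(** * The quotient of the two probabilities *)

Section accuracy.
Context {R : realType} {m : nat}.
Implicit Types (f q : 'rV[R]_m -> R).

Lemma near_quadratic_mono C C' r f q k : 0 < r -> C <= C' ->
  near_quadratic C r f q k -> near_quadratic C' r f q k.
Proof.
move=> r0 CC [cf cq qb qd kb qm qn]; have r4 : 0 < r ^+ 4 by rewrite exprn_gt0.
split=> //.
- move=> w; apply: (le_trans (qb w)); rewrite ler_wpM2r// addr_ge0// divr_ge0 ?(ltW r4)//.
- move=> u x; apply: (le_trans (qd u x)); rewrite ler_wpM2r ?invr_ge0 ?(ltW r4)//.
  by rewrite !ler_wpM2r// exprn_ge0// addr_ge0.
- by apply: (le_trans kb); rewrite ler_wpM2r// invr_ge0 ltW.
- move=> w wr; apply: (le_trans (qn w _)); first by apply: (le_trans _ wr); rewrite ler_wpM2r.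
  by rewrite ler_wpM2r ?invr_ge0 ?exprn_ge0 ?(ltW r0)// ler_wpM2r// exprn_ge0.
Qed.

Lemma root8_ge (L : R) : \forall n \near \oo, L <= root8 n.
Proof.
have [|L0] := leP L 0; first by move=> L0; near=> n; rewrite (le_trans L0)// /root8 sqrtr_ge0.
near=> n; rewrite -(@ler_pXn2r _ 8)// ?nnegrE ?(ltW L0) ?sqrtr_ge0// root8_8.
by near: n; exact: nbhs_infty_ger.
Unshelve. all: by end_near. Qed.

(** The smallness of e gives y >= c / 2, and |x - a y| <= 2 e. *)
Lemma ratio_close (a p x y e c : R) : 0 < c -> `|a| <= 1 ->
  c <= p -> `|x - a * p| <= e -> `|y - p| <= e -> e <= c / 2 ->
  `|x / y - a| <= 4 * e / c.
Proof.
move=> c0 a1 cp xe ye ec.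
have yc : c / 2 <= y by move: ye; rewrite ler_norml; lra.
have y0 : 0 < y by apply: lt_le_trans yc; rewrite divr_gt0.
have e0 : 0 <= e by apply: le_trans ye.
have -> : x / y - a = (x - a * y) / y by field; rewrite gt_eqF.
rewrite normrM normfV (gtr0_norm y0) ler_pdivrMr//.
have h : `|x - a * y| <= 2 * e.
  have -> : x - a * y = (x - a * p) - a * (y - p) by ring.
  apply: (le_trans (ler_normB _ _)); rewrite normrM.
  have : `|a| * `|y - p| <= 1 * e by rewrite ler_pM.
  lra.
apply: (le_trans h); have -> : 4 * e / c * y = 2 * e * (2 * y / c) by ring.
rewrite ler_peMr ?mulr_ge0// ler_pdivlMr// mul1r; lra.
Qed.

End accuracy.

Theorem theorem4p3 (R : realType) (m : nat) (h s : nat -> 'rV[R]_m -> R)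
    (hT : nearly_parallel h) (sT : nearly_parallel s)
    (KH KS : nat) (tH : 'I_KH -> R) (tS : 'I_KS -> R)
    (KH_ge2 : (2 <= KH)%N) (tH_inj : injective tH) (tH_gt0 : forall i, 0 < tH i)
    (KS_ge2 : (2 <= KS)%N) (tS_inj : injective tS) (tS_gt0 : forall i, 0 < tS i)
    (alpha : R) (alpha_gt0 : 0 < alpha) (alpha_lt1 : alpha < 1) :
  let H n := region (h n) in
  let S n := ~` region (s n) in
  let Rej n := [set y | p_SI tH tS (H n) (S n) y < alpha] in
  forall r : R,
    doteq_on (fun n => [set mu | boundary (H n) mu /\ `|mu| <= r])
             (fun n mu => gaussian mu 1 (Rej n) / gaussian mu 1 (S n))
             (fun _ _ => alpha).
Proof.
move=> H S Rej r0.
have [C1 C11 nh] := nearly_parallel_quadratic hT.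
have [C2 C21 ns] := nearly_parallel_quadratic sT.
pose C := C1 + C2; pose R0 := `|r0|.
have [C1C C2C] : C1 <= C /\ C2 <= C by rewrite /C; split; lra.
have Cge1 : 1 <= C by apply: le_trans C1C.
have R00 : 0 <= R0 := normr_ge0 r0.
have [K1 K11 rej] := rejection_estimate KH_ge2 tH_inj tH_gt0 KS_ge2 tS_inj tS_gt0
  alpha_gt0 alpha_lt1 (m := m) Cge1 R00.
have [K2 K21 sel] := selection_estimate (m := m) Cge1 R00.
have [K3 K31 thr] := threshold_mean_ge (m := m) Cge1 R00.
pose p := Phibar (11 * C) / 2; have p0 : 0 < p by rewrite divr_gt0// Phibar_gt0.
pose K := K1 + K2.
have K0 : 0 < K by rewrite /K; lra.
exists (4 * K / p); near=> n => -[u v] [bd mr].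
have n0 : (0 < n)%N by near: n; exact: nbhs_infty_gt.
(* The last summand makes the common error K / n at most p / 2. *)
have r1 : K1 + K2 + K3 + 2 * K / p <= root8 n by near: n; exact: root8_ge.
have rpos := @root8_gt0 R n n0.
have [qh [kh /(near_quadratic_mono rpos C1C) nqh]] :
  exists q k, near_quadratic C1 (root8 n) (h n) q k by near: n.
have [qs [ks /(near_quadratic_mono rpos C2C) nqs]] :
  exists q k, near_quadratic C2 (root8 n) (s n) q k by near: n.
have vE := boundary_region (nq_cont nqh) bd.
have Kp : 0 <= 2 * K / p by apply: divr_ge0; [apply: mulr_ge0 => //; exact: ltW|exact: ltW].
have [uR vR] : `|u| <= R0 /\ `|v| <= R0.
  have := le_trans mr (ler_norm r0); rewrite prod_normE/= ge_max => /andP[]//.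
rewrite vE normrN in vR *.
have c1 : K1 <= root8 n by lra.
have c2 : K2 <= root8 n by lra.
have c3 : K3 <= root8 n by lra.
have e1 := rej _ _ _ _ _ _ _ _ c1 nqh nqs uR vR.
have e2 := sel _ _ _ _ _ _ _ _ c2 nqh nqs uR.
have e3 := thr _ _ _ _ _ _ _ _ c3 nqh nqs uR.
have r8 : 0 < root8 n ^+ 8 :> R by rewrite exprn_gt0.
have -> : 4 * K / p * n%:R^-1 = 4 * (K / root8 n ^+ 8) / p by rewrite root8_8; ring.
have KE : (K1 / root8 n ^+ 8 <= K / root8 n ^+ 8) && (K2 / root8 n ^+ 8 <= K / root8 n ^+ 8).
  by rewrite !ler_wpM2r ?invr_ge0 ?(ltW r8)//= /K; lra.
case/andP: KE => KE1 KE2.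
apply: (ratio_close p0 _ e3 (le_trans e1 KE1) (le_trans e2 KE2)).
  by rewrite gtr0_norm// ltW.
have r1' : 1 <= root8 n :> R by lra.
have rr8 : root8 n <= root8 n ^+ 8 :> R by rewrite -{1}[root8 n]expr1 ler_weXn2l.
have h1 : 2 * K / p <= root8 n ^+ 8 by apply: (le_trans _ rr8); lra.
rewrite ler_pdivrMr// in h1; rewrite ler_pdivrMr//; lra.
Unshelve. all: by end_near. Qed.
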